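(* Suppose that the directed graph $(\mathcal X,\to)$ is symmetric, connected, of bounded degree and without loops, and that the reference intensity $j:[0,1]\times\mathcal A\to[0,\infty)$ satisfies (1) $\sup_{t\in[0,1],z\in\mathcal X}\bar j(t,z)<\infty$, (2) $t\mapsto j(t,z\to z')$ is continuously differentiable on $[0,1]$ for every arc $(z\to z')\in\mathcal A$, (3) $j(t,z\to z')>0$ for all $t\in[0,1]$ and $(z\to z')\in\mathcal A$. Let $P$ be any random walk in the reciprocal class $\mathcal R(j)$. (a) For any $t\in(0,1)$ and any arc $(z\to z')\in\mathcal A$, as $h\to0^+$, $$P\big(T^t_1\le t+h/2\ \big|\ X_t=z,\ X_{t+h}=z',\ T^t_2>t+h\big)=\frac12-\frac h8\,\chi_a[j](t,z\to z')+o(h).$$ (b) For any $t\in(0,1)$ and any closed walk $\mathbf c=(x_0\to x_1\to\cdots\to x_{|\mathbf c|}=x_0)$, as $h\to0^+$, $$P\Big((X_t\to X_{T^t_1}\to\cdots\to X_{T^t_{|\mathbf c|}}=X_t)=\mathbf c,\ T^t_{|\mathbf c|}<t+h<T^t_{|\mathbf c|+1}\ \Big|\ X_t=X_{t+h}=x_0\Big)=\chi_c[j](t,\mathbf c)\,\frac{h^{|\mathbf c|}}{|\mathbf c|!}+o(h^{|\mathbf c|}).$$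
   Context: Graph. $\mathcal X$ is a countable set with the discrete topology and $\mathcal A\subset\mathcal X\times\mathcal X$ is the set of arcs; $z\to z'$ means $(z,z')\in\mathcal A$, and the arc is then written $(z\to z')$. The graph is symmetric if $(x\to y)\in\mathcal A$ implies $(y\to x)\in\mathcal A$; connected if for any $x,y$ there is a directed walk from $x$ to $y$; it has no loops if $(z\to z)\notin\mathcal A$ for all $z$. A walk is a sequence $(x_0\to x_1\to\cdots\to x_n)$, $n\ge1$, with each $(x_i\to x_{i+1})\in\mathcal A$; it is closed if $x_n=x_0$, and its length $n$ is denoted $|\mathbf c|$. Random walks. $\Omega\subset\mathcal X^{[0,1]}$ is the set of càdlàg piecewise constant paths $\omega$ with finitely many jumps, such that $\omega_{1^-}=\omega_1$ and for $t\in(0,1)$, $\omega_{t^-}\neq\omega_t$ implies $\omega_{t^-}\to\omega_t$. $(X_t)_{0\le t\le1}$ is the canonical process, and $\Omega$ carries the $\sigma$-field it generates. $\mathrm P(Y)$ denotes the probability measures on $Y$; any $P\in\mathrm P(\Omega)$ is called a random walk. $R_{01}$ denotes the law of $(X_0,X_1)$ under $R$; the support of a probability measure on a countable set is the set of points of positive mass. Jump times. For $0\le t<1$, $T^t_1=\inf\{s\in(t,1]:X_{s^-}\ne X_s\}$ and for $k\ge2$, $T^t_k=\inf\{s\in(T^t_{k-1},1]:X_{s^-}\neq X_s\}$, with $\inf\emptyset=+\infty$. Reference walk. $\bar j(t,z)=\sum_{z':z\to z'}j(t,z\to z')$. For each $x\in\mathcal X$, $R^x\in\mathrm P(\Omega)$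 is the unique Markov walk started at $x$ with jump intensity $j$, i.e. the unique solution of the martingale problem with initial law $\delta_x$ for the generators $L_tu(z)=\sum_{z':z\to z'}j(t,z\to z')(u(z')-u(z))$, $u$ finitely supported. $R=\sum_xR_0(x)R^x$, where $R_0\in\mathrm P(\mathcal X)$ is any probability measure with full support; $R^{xy}=R^x(\cdot\mid X_1=y)$ is well defined for all $x,y$. The reciprocal class is $$\mathcal R(j)=\Big\{\sum_{x,y\in\mathcal X}\pi(x,y)R^{xy}:\ \pi\in\mathrm P(\mathcal X^2),\ \operatorname{supp}\pi\subset\operatorname{supp}R_{01}\Big\}.$$ Reciprocal characteristics. For $t\in(0,1)$: for every arc, $\chi_a[j](t,z\to z')=\partial_t\log j(t,z\to z')+\bar j(t,z')-\bar j(t,z)$; for every closed walk $\mathbf c=(x_0\to\cdots\to x_{|\mathbf c|}=x_0)$, $\chi_c[j](t,\mathbf c)=\prod_{i=0}^{|\mathbf c|-1}j(t,x_i\to x_{i+1})$. *)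

(* Defs.v *)
From HB Require Import structures.
From mathcomp Require Import all_boot all_order all_algebra.
From mathcomp Require Import all_classical all_reals all_analysis.

Set Implicit Arguments.
Unset Strict Implicit.
Unset Printing Implicit Defensive.

Import Order.TTheory GRing.Theory Num.Theory.
Import numFieldNormedType.Exports.

Local Open Scope classical_set_scope.
Local Open Scope ring_scope.

(* A graph is given by the set of its arcs, as a relation A on the type of
   vertices; [A x y] means x -> y. *)
Section graph.
Variables (X : choiceType) (A : rel X).

(* the walk x -> p_1 -> ... -> p_n, of length n = size p >= 1 *)
Definition walk (x : X) (p : seq X) : bool := (p != [::]) && path A x p.

Definition closed_walk (x : X) (p : seq X) : bool :=
  walk x p && (last x p == x).

Definition connected_graph : Prop :=
  forall x y : X, exists2 p : seq X, walk x p & last x p = y.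

Definition neighbours (z : X) : set X := [set z' | A z z'].

Definition bounded_degree : Prop :=
  exists D : nat, forall z : X, (neighbours z #<= `I_D)%card.

End graph.

(* Convergence in the discrete space X is eventual equality.  When no left
   limit exists, the default value [w t] is returned. *)
Definition left_lim (R : realType) (X : choiceType) (w : R -> X) (t : R) : X :=
  xget (w t) [set x | \forall s \near t^'-, w s = x].

(* An element of X^[0,1] is represented by its extension to R that is constant
   on ]-oo, 0] and on [1, +oo[ (first clause); in particular the left limit at 0
   is w 0, so that 0 is never a jump time. *)
Definition is_path (R : realType) (X : choiceType) (A : rel X) (w : R -> X) :
    Prop :=
  [/\ (forall t, w t = w (Num.max 0 (Num.min 1 t))),
      (forall t : R, 0 <= t < 1 -> \forall s \near t^'+, w s = w t) /\
      (forall t : R, 0 < t <= 1 -> exists x, \forall s \near t^'-, w s = x),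
      finite_set [set t | 0 <= t <= 1 /\ left_lim w t <> w t] /\
      (forall s t : R, 0 <= s -> s <= t -> t <= 1 ->
         (forall r : R, s < r <= t -> left_lim w r = w r) -> w s = w t),
      left_lim w 1 = w 1 &
      forall t : R, 0 < t < 1 -> left_lim w t <> w t -> A (left_lim w t) (w t)].

Definition Omega (R : realType) (X : choiceType) (A : rel X) : Type :=
  set_type [set w : R -> X | is_path A w].

HB.instance Definition _ (R : realType) (X : choiceType) (A : rel X) :=
  Choice.on (Omega R A).

(* the canonical process *)
Definition canproc (R : realType) (X : choiceType) (A : rel X) (t : R)
  (w : Omega R A) : X := sval w t.

Lemma left_lim_cst (R : realType) (X : choiceType) (x : X) (t : R) :
  left_lim (fun=> x) t = x.
Proof.
rewrite /left_lim; case: xgetP => [y _ /= Hy|//].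
have [s] : exists s : R, x = y by apply: (@filter_ex _ (t^'-)).
by [].
Qed.

Lemma is_path_cst (R : realType) (X : choiceType) (A : rel X) (x : X) :
  is_path A (fun _ : R => x).
Proof.
split=> //.
- by split=> [t _|t _]; [|exists x]; exact: filterE.
- split=> //; rewrite (_ : mkset _ = set0) //.
  by apply/seteqP; split=> // t [_]; rewrite left_lim_cst.
- exact: left_lim_cst.
- by move=> t _; rewrite left_lim_cst.
Qed.

HB.instance Definition _ (R : realType) (X : pointedType) (A : rel X) :=
  isPointed.Build (Omega R A) (SigSub (mem_set (is_path_cst R A (point : X)))).

(* the events {X_r \in B}, 0 <= r <= s *)
Definition cylinders (R : realType) (X : choiceType) (A : rel X) (s : R) :
    set (set (Omega R A)) :=
  [set C | exists (r : R) (B : set X), 0 <= r <= s /\ C = canproc r @^-1` B].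

(* Omega with the sigma-field generated by the canonical process *)
Definition path_space (R : realType) (X : pointedType) (A : rel X) :=
  g_sigma_algebraType (@cylinders R X A 1).

(* X with the sigma-field of all its subsets *)
Definition discrete (X : pointedType) := g_sigma_algebraType [set: set X].

Section probability.
Context {R : realType}.

(* martingale on the time interval [0,1]; the last clause says that
   E[M_t | F_s] = M_s *)
Definition martingale01 d (T : measurableType d) (P : probability T R)
    (F : R -> set (set T)) (M : R -> T -> R) : Prop :=
  [/\ (forall (t : R) (B : set R), 0 <= t <= 1 -> measurable B -> F t (M t @^-1` B)),
      (forall t : R, 0 <= t <= 1 -> P.-integrable setT (EFin \o M t)) &
      forall (s t : R) (C : set T), 0 <= s -> s <= t -> t <= 1 -> F s C ->
        (\int[P]_(w in C) (M t w)%:E = \int[P]_(w in C) (M s w)%:E)%E].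

Definition cond_prob (T : Type) (P : set T -> \bar R) (E F : set T) : R :=
  fine (P (E `&` F)) / fine (P F).

Definition supp (X : Type) (m : set X -> \bar R) : set X :=
  [set x | (0 < m [set x])%E].

Definition mixture (I : choiceType) (T : Type) (p : set I -> \bar R)
    (Q : I -> set T -> \bar R) (E : set T) : \bar R :=
  (\esum_(i in [set: I]) (p [set i] * Q i E))%E.

End probability.

(* f is C^1 on [0,1], with one-sided derivatives at 0 and 1 *)
Definition C1_01 (R : realType) (f : R -> R) : Prop :=
  exists2 df : R -> R, {within `[0, 1], continuous df} &
    forall t : R, 0 <= t <= 1 ->
      (f s - f t) / (s - t) @[s --> within `[0, 1] t^'] --> df t.

Section walk.
Context {R : realType} {X : pointedType}.
Variables (A : rel X) (j : R -> X -> X -> R).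

(* [j t z z'] is only relevant for 0 <= t <= 1 and z -> z'.  The sums below are
   over a finite set in a graph of bounded degree. *)
Definition jbar (t : R) (z : X) : R := \sum_(z' \in neighbours A z) j t z z'.

Definition generator (t : R) (u : X -> R) (z : X) : R :=
  \sum_(z' \in neighbours A z) j t z z' * (u z' - u z).

(* Q solves the martingale problem with initial law delta_x for the generators
   [generator t] *)
Definition markov_walk (x : X) (Q : probability (path_space R A) R) : Prop :=
  Q [set w | canproc 0 w = x] = 1%E /\
  forall u : X -> R, finite_set [set z | u z <> 0] ->
    martingale01 Q (fun s => <<s @cylinders R X A s >>)
      (fun t w => u (canproc t w) - u (canproc 0 w)
         - \int[lebesgue_measure]_(s in `[0, t]) generator s u (canproc s w)).

(* R^{xy} = R^x( . | X_1 = y) *)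
Definition bridge (Rx : X -> probability (path_space R A) R) (xy : X * X)
    (E : set (path_space R A)) : \bar R :=
  (cond_prob (Rx xy.1) E [set w | canproc 1 w = xy.2])%:E.

Definition endpoints_law (Q : set (path_space R A) -> \bar R) :
    set (discrete (X * X)%type) -> \bar R :=
  pushforward Q (fun w => (canproc 0 w, canproc 1 w) : discrete (X * X)%type).

(* Here [mixture R0 Rx] is the reference walk R; the intensity j enters through
   the requirement that every [Rx x] be a [markov_walk j x]. *)
Definition reciprocal_class (R0 : probability (discrete X) R)
    (Rx : X -> probability (path_space R A) R) :
    set (probability (path_space R A) R) :=
  [set P | exists2 p : probability (discrete (X * X)%type) R,
     supp p `<=` supp (endpoints_law (mixture R0 Rx)) &
     forall E : set (path_space R A), measurable E ->
       P E = mixture p (bridge Rx) E].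

(* T^t_k, with the convention T^t_0 = t; the infimum of set0 is +oo *)
Fixpoint jump_time (t : R) (k : nat) (w : Omega R A) : \bar R :=
  if k is k'.+1 then
    ereal_inf [set s%:E | s in
      [set s : R | (jump_time t k' w < s%:E)%E /\ s <= 1 /\
                   left_lim (sval w) s <> sval w s]]
  else t%:E.

(* the sequence (X_t, X_{T^t_1}, ..., X_{T^t_n}), meaningful when T^t_n is
   finite *)
Definition visited (t : R) (n : nat) (w : Omega R A) : seq X :=
  mkseq (fun k => canproc (fine (jump_time t k w)) w) n.+1.

Definition chi_a (t : R) (z z' : X) : R :=
  derive1 (fun s => ln (j s z z')) t + jbar t z' - jbar t z.

Definition chi_c (t : R) (x0 : X) (p : seq X) : R :=
  \prod_(i < size p) j t (nth x0 (x0 :: p) i) (nth x0 (x0 :: p) i.+1).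

End walk.

(* Main.v *)
Require Import Defs.
From mathcomp Require Import all_boot all_order all_algebra finmap.
From mathcomp Require Import all_classical all_reals all_analysis measurable_realfun.
From mathcomp Require Import ring lra.

(** The walks R^x are given by a martingale problem, and everything below rests
on one consequence of it: the explicit law of the itinerary of a time interval,
that is, of the list of the values that the path takes at its successive jumps.
Up to a null event, the two events of the theorem speak of the states at t and
t + h and of the itinerary of ]t, t + h] only.

Testing the martingale problem against the indicator functions of the vertices
bounds by M (t - r) the probability of moving between times r and t, whatever
the past of r, where M bounds the total jump intensity. On a grid, this shows
that each jump costs a factor M (t - r) ([itin_size_le]). So, up to an error of
order (t - r)^2, the walk either stays where it is or makes one jump, with
probabilities that are read on the intensity at time r ([local_nil],
[local_one]). Hence the probability that the itinerary of ]s, a] is p solves, as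
a function of a, a linear equation whose source is the probability of p deprived
of its last vertex ([step_nil], [step_rcons]). Errors that are quadratic in the
length of the time step vanish when the steps are refined ([telescope]), and
therefore:
- the equation has only one solution, so that the law of the itinerary given the
  state at time s depends neither on the past of s nor on the initial vertex
  ([itin_uniq]); summing over the itineraries, the same holds for the state at a
  later time ([state_uniq]). This is the Markov property;
- the law of the itinerary has explicit expansions as the interval shrinks
  ([trans_asympt], [trans_one_expand2]).

A walk P of the reciprocal class is a mixture of bridges. Given the states z at
time t and z' at time t + h, the past of t and the future of t + h contribute to
the probability of an event of [t, t + h], under the bridge from x to y, factors
that depend on x, y, z and z' only. They cancel in the conditional probabilities
([pr_proportional]), which are thus those of the reference walk. For the closed
walks, the numerator is given by [trans_asympt], and the denominator is the
probability of being back at the initial vertex, which tends to 1. For the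
single jump z -> z', the density of the jump time at t + s is proportional to
g(s) = j(t + s, z -> z') exp(- int_t^{t+s} (jbar(z) - jbar(z'))), whose
logarithmic derivative at 0 is chi_a: the first half of the interval has
probability 1/2 - h chi_a / 8 up to o(h). The computation is carried out on the
second order expansions ([half_ratio]). *)

Import Order.TTheory GRing.Theory Num.Theory.
Import numFieldNormedType.Exports.

Set Implicit Arguments.
Unset Strict Implicit.
Unset Printing Implicit Defensive.

Local Open Scope classical_set_scope.
Local Open Scope ring_scope.

(** * Itineraries of the paths *)

Section paths.
Context {R : realType} {X : choiceType} {A : rel X}.
Implicit Types (w : Omega R A) (r s t : R).

Lemma left_limE (f : R -> X) t x :
  (\forall s \near t^'-, f s = x) -> left_lim f t = x.
Proof.
move=> fx; rewrite /left_lim; case: xgetP => [y _ /= fy|/(_ x)//].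
by have [s [<- <-]] : exists s, f s = x /\ f s = y by apply: (@filter_ex _ (t^'-)); exact: filterI.
Qed.

(** The jump times are sorted, so that cutting a time interval in two cuts the
itinerary into a concatenation. *)
Definition jumps w : seq R :=
  sort <=%R (enum_fset
    (fset_set [set t : R | 0 <= t <= 1 /\ left_lim (sval w) t <> sval w t])).

Lemma omegaP w : is_path A (sval w).
Proof. by have := svalP w; rewrite inE. Qed.

Lemma mem_jumps w t :
  t \in jumps w <-> 0 <= t <= 1 /\ left_lim (sval w) t <> sval w t.
Proof.
rewrite /jumps mem_sort.
case: (omegaP w) => _ _ [fin _] _ _.
by rewrite -[_ \in _]/(t \in fset_set _) (in_fset_set fin) inE.
Qed.

Lemma jumps_sorted w : sorted <%R (jumps w).
Proof.
by rewrite lt_sorted_uniq_le sort_uniq fset_uniq /= sort_le_sorted.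
Qed.

Lemma path_cst w s t : 0 <= s -> s <= t -> t <= 1 ->
  (forall r, r \in jumps w -> s < r <= t -> False) -> sval w s = sval w t.
Proof.
move=> s0 st t1 nj; case: (omegaP w) => _ _ [_ +] _ _.
apply=> // r /andP[sr rt]; apply: contrapT => jr.
apply: (nj r); last by rewrite sr.
by apply/mem_jumps; split=> //; apply/andP; split; lra.
Qed.

Definition jumps_in s t w : seq R := [seq r <- jumps w | s < r <= t].

(** The initial value is left out, so that the itineraries of consecutive intervals
concatenate without repetition. *)
Definition itin s t w : seq X := [seq canproc r w | r <- jumps_in s t w].

Lemma jumps_in_cat r s t w : s <= r -> r <= t ->
  jumps_in s t w = jumps_in s r w ++ jumps_in r t w.
Proof.
move=> sr rt; rewrite /jumps_in; have := jumps_sorted w.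
elim: (jumps w) => [//|a l IH] /= al.
have {}IH := IH (path_sorted al).
have [sa|sa] := ltP s a; last first.
  have -> /= : (r < a) = false by lra.
  exact: IH.
have [ra|ra] /= := ltP r a; last first.
  have -> /= : a <= t by lra.
  by rewrite IH.
rewrite IH.
have -> // : [seq x <- l | s < x <= r] = [::].
  apply/eqP; rewrite -(negbK (_ == _)) -has_filter; apply/hasPn => b bl.
  have := order_path_min lt_trans al => /allP/(_ _ bl) ab.
  by apply/negP => /andP[_]; lra.
Qed.

Lemma itin_cat r s t w : s <= r -> r <= t ->
  itin s t w = itin s r w ++ itin r t w.
Proof. by move=> sr rt; rewrite /itin (jumps_in_cat w sr rt) map_cat. Qed.

Lemma itin_last s t w : 0 <= s -> s <= t -> t <= 1 ->
  last (canproc s w) (itin s t w) = canproc t w.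
Proof.
move=> s0 st t1; rewrite /itin; have := jumps_sorted w.
move/(sorted_filter lt_trans (fun r => s < r <= t)); rewrite -/(jumps_in s t w).
have E a : (a \in jumps_in s t w) = (s < a <= t) && (a \in jumps w).
  by rewrite mem_filter.
case/lastP: (jumps_in s t w) E => [|l a] E srt /=.
  apply: path_cst => // r rw rst.
  by have := E r; rewrite rw rst.
rewrite map_rcons last_rcons.
have := E a; rewrite mem_rcons in_cons eqxx /= => /esym/andP[/andP[sa at_] aw].
apply: path_cst => //; first by lra.
move=> r rw /andP[ar rt].
have := E r; rewrite rw rt (lt_trans sa ar) mem_rcons in_cons /= => /orP[|rl].
  by move=> /eqP ra; rewrite ra ltxx in ar.
move: srt; rewrite lt_sorted_pairwise pairwise_rcons.
by case/andP=> /allP/(_ _ rl) => /= ra _; have := lt_trans ra ar; rewrite ltxx.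
Qed.

Lemma itin_nil s t w : 0 <= s -> s <= t -> t <= 1 ->
  itin s t w = [::] -> canproc s w = canproc t w.
Proof. by move=> s0 st t1 E; have := itin_last w s0 st t1; rewrite E. Qed.

Lemma itinxx s w : itin s s w = [::].
Proof.
rewrite /itin /jumps_in (@eq_filter _ _ pred0) ?filter_pred0// => r /=.
by apply/negP => /andP[]; lra.
Qed.

Lemma itin_le_nil s t r v w : s <= r -> r <= v -> v <= t ->
  itin s t w = [::] -> itin r v w = [::].
Proof.
move=> sr rv vt; rewrite (@itin_cat r s t) //; last by lra.
rewrite (@itin_cat v r t) // => /nilP.
by rewrite /nilp !size_cat !addn_eq0 => /and3P[_ /nilP].
Qed.

(** The path stays at its initial value until the jump, so this value is the left
limit at the jump time. *)
Lemma itin1_neq s t w y : 0 <= s -> s <= t -> t <= 1 ->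
  itin s t w = [:: y] -> canproc s w <> canproc t w.
Proof.
move=> s0 st t1 E; have := itin_last w s0 st t1; move: E; rewrite /itin.
have := jumps_sorted w.
have E a : (a \in jumps_in s t w) = (s < a <= t) && (a \in jumps w).
  by rewrite mem_filter.
case: (jumps_in s t w) E => [//|a [|//]] E srt [ay] /= <- sa.
have := E a; rewrite in_cons eqxx /= => /esym/andP[/andP[sa_ at_] aw].
have /mem_jumps[_] := aw; apply.
rewrite -[sval w a]/(canproc a w) -sa; apply: left_limE; near=> r.
have sr : s < r by near: r; exact: nbhs_left_gt.
have ra : r < a by near: r; exact: nbhs_left_lt.
apply/esym/path_cst => //; [lra|lra|] => v vw /andP[sv vr].
by have := E v; rewrite vw sv (_ : v <= t) ?in_cons ?in_nil; lra.
Unshelve. all: by end_near. Qed.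

Lemma itin_size1 s t w : 0 <= s -> s <= t -> t <= 1 -> (size (itin s t w) <= 1)%N ->
  itin s t w = if canproc s w == canproc t w then [::] else [:: canproc t w].
Proof.
move=> s0 st t1; case E : (itin s t w) => [|y [|//]] _.
  by rewrite (itin_nil _ _ _ E) ?eqxx.
have /eqP/negPf -> := itin1_neq s0 st t1 E.
by have := itin_last w s0 st t1; rewrite E /= => ->.
Qed.

Lemma seq_gap (l : seq R) : exists2 d : R, 0 < d &
  forall a b, a \in l -> b \in l -> a < b -> d <= b - a.
Proof.
have lb (k : seq R) : exists2 d : R, 0 < d &
    forall x, x \in k -> 0 < x -> d <= x.
  elim: k => [|x k [d d0 dk]]; first by exists 1.
  exists (if 0 < x then Num.min x d else d).
    by case: ifPn => // x0; rewrite lt_min x0.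
  move=> y; rewrite in_cons => /orP[/eqP -> x0|yk y0].
    by rewrite x0 ge_min lexx.
  by case: ifPn => _; rewrite ?ge_min dk ?orbT.
have [d d0 dk] := lb [seq b - a | a <- l, b <- l].
exists d => // a b al bl ab; apply: dk; last by rewrite subr_gt0.
by apply/allpairsP; exists (a, b).
Qed.

(** The jump times are finitely many, hence uniformly separated. *)
Lemma itin_small w : exists2 d : R, 0 < d &
  forall s t, t - s < d -> (size (itin s t w) <= 1)%N.
Proof.
have [d d0 dP] := seq_gap (jumps w); exists d => // s t std.
rewrite size_map; have := jumps_sorted w.
move/(sorted_filter lt_trans (fun r => s < r <= t)); rewrite -/(jumps_in s t w).
have E a : (a \in jumps_in s t w) = (s < a <= t) && (a \in jumps w).
  by rewrite mem_filter.
case: (jumps_in s t w) E => [//|a [//|b l]] E /= /andP[ab _].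
have := E a; rewrite in_cons eqxx /= => /esym/andP[/andP[sa_ at_] aw].
have := E b; rewrite !in_cons eqxx orbT /= => /esym/andP[/andP[sb bt] bw].
by have := dP _ _ aw bw ab; lra.
Qed.

(** The itinerary as seen through the coordinates at s, s + e, ..., s + k e. *)
Fixpoint grid_itin s (e : R) (k : nat) w : seq X :=
  if k is k'.+1 then
    if canproc (s + k'%:R * e) w == canproc (s + k%:R * e) w
    then grid_itin s e k' w
    else rcons (grid_itin s e k' w) (canproc (s + k%:R * e) w)
  else [::].

Lemma grid_itinE s e k w : 0 <= s -> 0 <= e -> s + k%:R * e <= 1 ->
  (forall r, (size (itin r (r + e) w) <= 1)%N) ->
  itin s (s + k%:R * e) w = grid_itin s e k w.
Proof.
move=> s0 e0; elim: k => [|k IH] sk1 sz; first by rewrite mul0r addr0 itinxx.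
have E : s + k.+1%:R * e = s + k%:R * e + e by rewrite -natr1; ring.
have ke : 0 <= k%:R * e by rewrite mulr_ge0.
rewrite (@itin_cat (s + k%:R * e)); [|lra|lra].
rewrite IH //; last by lra.
rewrite /= E itin_size1 //; [|lra|lra|lra].
by case: ifP; rewrite ?cats0 ?cats1.
Qed.

(** Once the mesh is smaller than the gaps between jumps, each cell contains at most
one jump, and a single jump changes the value. *)
Lemma grid_itin_near s t w : 0 <= s -> s <= t -> t <= 1 ->
  exists n0 : nat, forall n, (n0 <= n)%N ->
    grid_itin s ((t - s) / n.+1%:R) n.+1 w = itin s t w.
Proof.
move=> s0 st t1; have [d d0 dP] := itin_small w.
exists (Num.truncn ((t - s) / d)) => n n0n.
have n1 : 0 < n.+1%:R :> R by [].
have ed : (t - s) / n.+1%:R < d.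
  rewrite ltr_pdivrMr// mulrC -ltr_pdivrMr//.
  by rewrite (lt_le_trans (truncnS_gt _))// ler_nat.
have E : s + n.+1%:R * ((t - s) / n.+1%:R) = t.
  by rewrite mulrC divfK ?pnatr_eq0// addrC subrK.
rewrite -grid_itinE ?E// ?divr_ge0 ?subr_ge0//.
by move=> r; apply: dP; rewrite addrC addKr.
Qed.

End paths.

(** * Probabilities, and the past of a time *)

Section prob.
Context {R : realType} d (T : measurableType d).
Implicit Types (Q : probability T R) (D E : set T).

(** Real-valued, so that the estimates are carried out in R. *)
Definition pr Q E : R := fine (Q E).

Lemma EFin_pr Q E : measurable E -> (pr Q E)%:E = Q E.
Proof. by move=> mE; rewrite /pr fineK// fin_num_measure. Qed.

Lemma pr_ge0 Q E : 0 <= pr Q E.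
Proof. by rewrite fine_ge0. Qed.

Lemma pr_le Q D E : measurable D -> measurable E -> D `<=` E ->
  pr Q D <= pr Q E.
Proof.
by move=> mD mE DE; rewrite -lee_fin !EFin_pr// le_measure ?inE.
Qed.

Lemma pr_le1 Q E : measurable E -> pr Q E <= 1.
Proof. by move=> mE; rewrite -lee_fin EFin_pr// probability_le1. Qed.

Lemma pr0 Q : pr Q set0 = 0.
Proof. by rewrite /pr measure0. Qed.

Lemma prU Q D E : measurable D -> measurable E -> D `&` E = set0 ->
  pr Q (D `|` E) = pr Q D + pr Q E.
Proof.
move=> mD mE DE; apply: EFin_inj; rewrite EFinD !EFin_pr ?measureU//.
exact: measurableU.
Qed.

Lemma prU_le Q D E : measurable D -> measurable E ->
  pr Q (D `|` E) <= pr Q D + pr Q E.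
Proof.
move=> mD mE; rewrite -lee_fin EFinD !EFin_pr ?measureU2//.
exact: measurableU.
Qed.

Lemma prID Q D E : measurable D -> measurable E ->
  pr Q D = pr Q (D `&` E) + pr Q (D `&` ~` E).
Proof.
move=> mD mE; rewrite -prU.
- by rewrite -setIUr setUv setIT.
- exact: measurableI.
- by apply: measurableI => //; exact: measurableC.
- by rewrite setIACA setICr setI0.
Qed.

(** Fatou's inequality, for events. *)
Lemma pr_liminf Q D (E : (set T)^nat) (b : R) : measurable D ->
  (forall n, measurable (E n)) ->
  (forall w, D w -> exists n0 : nat, forall n, (n0 <= n)%N -> E n w) ->
  (forall n, pr Q (E n) <= b) -> pr Q D <= b.
Proof.
move=> mD mE DE Eb.
pose F n := \bigcap_(k in [set k | (n <= k)%N]) E k.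
have mF n : measurable (F n) by apply: bigcap_measurable => //; exists n => /=.
have mbF : measurable (\bigcup_n F n) by exact: bigcupT_measurable.
have F_cvg : Q \o F @ \oo --> Q (\bigcup_n F n).
  apply: nondecreasing_cvg_mu => //; apply/nondecreasing_seqP => n.
  by apply/subsetPset => w Fw k /= nk; apply: Fw; exact: ltnW.
apply: (@le_trans _ _ (pr Q (\bigcup_n F n))).
  by apply: pr_le => // w /DE[n nE]; exists n.
rewrite -lee_fin EFin_pr// -(cvg_lim _ F_cvg)//.
apply: lime_le; first by apply/cvg_ex; exists (Q (\bigcup_n F n)).
apply: nearW => n /=; rewrite -EFin_pr// lee_fin (le_trans _ (Eb n))//.
by apply: pr_le => // w; apply => /=.
Qed.

End prob.

Section countable_split.
Context {R : realType} d (T : measurableType d) (I : choiceType).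
Hypothesis I_countable : countable [set: I].
Variable f : T -> I.
Hypothesis mf : forall i, measurable (f @^-1` [set i]).

(** The level sets of a variable with countably many values, enumerated by the
natural numbers. *)
Lemma split_seriesE :
  exists2 F : (set T)^nat,
    (forall n, F n = set0 \/ exists i, F n = f @^-1` [set i]) &
    forall (Q : probability T R) E, measurable E ->
      Q E = (\sum_(0 <= n <oo) Q (E `&` F n))%E.
Proof.
have /countable_injP[g injg'] := I_countable.
have injg x y : g x = g y -> x = y by apply: injg'; exact: mem_set.
pose F n := [set w | g (f w) = n].
have FP n : F n = set0 \/ exists i, F n = f @^-1` [set i].
  have [[i gi]|ni] := pselect (exists i, g i = n); [right|left].
    exists i; apply/seteqP; split=> w /=; last by rewrite /F /= => ->.
    by rewrite /F /= -gi => /injg.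
  by apply/seteqP; split=> w //= wn; apply: ni; exists (f w).
exists F => // Q E mE.
have mF n : measurable (F n) by have [->|[i ->]] := FP n.
rewrite (_ : Q E = Q (\bigcup_n (E `&` F n))).
  rewrite measure_bigcup; first by apply: eq_eseriesl => n; rewrite mem_setT.
    by move=> n _; exact: measurableI.
  by apply/trivIsetP => m n _ _ mn; rewrite setIACA; apply/seteqP; split=> w //=
    [_ [wm wn]]; rewrite -wm -wn eqxx in mn.
congr (Q _); apply/seteqP; split=> [w Ew|w [n _ []]//].
by exists (g (f w)).
Qed.

(** Two probability measures are involved because the Markov property compares walks
that start at different vertices. *)
Lemma pr_split_le (Q1 Q2 : probability T R) E1 E2 (a b : R) :
  0 <= a -> 0 <= b -> measurable E1 -> measurable E2 ->
  (forall i, a * pr Q1 (E1 `&` f @^-1` [set i]) <=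
             b * pr Q2 (E2 `&` f @^-1` [set i])) ->
  a * pr Q1 E1 <= b * pr Q2 E2.
Proof.
move=> a0 b0 m1 m2 H; have [F FP FE] := split_seriesE.
have mF n : measurable (F n) by have [->|[i ->]] := FP n.
rewrite -lee_fin !EFinM !EFin_pr// (FE Q1 E1)// (FE Q2 E2)//.
rewrite -!nneseriesZl//; apply: lee_nneseries => n _; first by rewrite mule_ge0// lee_fin.
have [->|[i ->]] := FP n; first by rewrite !setI0 !measure0 !mule0.
rewrite -(EFin_pr Q1 (measurableI _ _ m1 (mf i))).
by rewrite -(EFin_pr Q2 (measurableI _ _ m2 (mf i))) -!EFinM lee_fin.
Qed.

Lemma pr_split_eq (Q1 Q2 : probability T R) E1 E2 (a b : R) :
  0 <= a -> 0 <= b -> measurable E1 -> measurable E2 ->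
  (forall i, a * pr Q1 (E1 `&` f @^-1` [set i]) =
             b * pr Q2 (E2 `&` f @^-1` [set i])) ->
  a * pr Q1 E1 = b * pr Q2 E2.
Proof.
by move=> a0 b0 m1 m2 H; apply/eqP; rewrite eq_le !pr_split_le// => i; rewrite H.
Qed.

End countable_split.

Lemma countable_seq (X : choiceType) : countable [set: X] ->
  countable [set: seq X].
Proof.
move=> /countable_injP[g injg]; apply/countable_injP.
exists (fun p : seq X => choice.pickle (map g p)).
move=> p q _ _ /(pcan_inj choice.pickleK); apply: inj_map => x y.
by apply: injg; exact: mem_set.
Qed.

Section filtration.
Context {R : realType} {X : pointedType} {A : rel X}.
Hypothesis X_countable : countable [set: X].
Implicit Types (r s t e : R).

(** The past of time s. *)
Definition Ft s (E : set (Omega R A)) : Prop :=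
  @measurable _ (g_sigma_algebraType (@cylinders R X A s)) E.

Lemma Ft_mono s t E : s <= t -> Ft s E -> Ft t E.
Proof.
move=> st; apply: sub_sigma_algebra2 => C [r [B [/andP[r0 rs] ->]]].
by exists r, B; split=> //; rewrite r0 (le_trans rs).
Qed.

Lemma Ft_measurable s E : s <= 1 -> Ft s E ->
  measurable (E : set (path_space R A)).
Proof. exact: Ft_mono. Qed.

Lemma Ft_sigma s E : Ft s E -> <<s @cylinders R X A s >> E.
Proof. by []. Qed.

Lemma Ft_I s D E : Ft s D -> Ft s E -> Ft s (D `&` E).
Proof. exact: measurableI. Qed.

Lemma Ft_U s D E : Ft s D -> Ft s E -> Ft s (D `|` E).
Proof. exact: measurableU. Qed.

Lemma Ft_C s E : Ft s E -> Ft s (~` E).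
Proof. exact: measurableC. Qed.

Lemma Ft_T s : Ft s setT.
Proof. exact: measurableT. Qed.

Lemma Ft_0 s : Ft s set0.
Proof. exact: measurable0. Qed.

Lemma Ft_cyl r s (B : set X) : 0 <= r -> r <= s ->
  Ft s [set w | B (canproc r w)].
Proof.
by move=> r0 rs; apply: sub_sigma_algebra; exists r, B; rewrite r0 rs.
Qed.

Lemma Ft_at r s x : 0 <= r -> r <= s -> Ft s [set w | canproc r w = x].
Proof. exact: (@Ft_cyl r s [set x]). Qed.

Lemma Ft_eq r s t : 0 <= r -> r <= t -> 0 <= s -> s <= t ->
  Ft t [set w | canproc r w = canproc s w].
Proof.
move=> r0 rt s0 st.
have -> : [set w | canproc r w = canproc s w] = \bigcup_x
    ([set w : Omega R A | canproc r w = x] `&` [set w | canproc s w = x]).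
  apply/seteqP; split=> [w /= rs|w [x _ /= [-> ->]]//].
  by exists (canproc s w).
apply: countable_bigcupT_measurable => // x.
by apply: Ft_I; exact: Ft_at.
Qed.

Lemma Ft_grid s e k p : 0 <= s -> 0 <= e ->
  Ft (s + k%:R * e) [set w | grid_itin s e k w = p].
Proof.
move=> s0 e0; elim: k p => [|k IH] p.
  rewrite /=; have [->|pN] := eqVneq p [::].
    by rewrite (_ : [set _ | _] = setT); [exact: Ft_T|apply/seteqP; split].
  rewrite (_ : [set _ | _] = set0); first exact: Ft_0.
  by apply/seteqP; split=> // w /= /eqP; rewrite eq_sym (negPf pN).
have k0 : 0 <= k%:R * e by rewrite mulr_ge0.
have kS : s + k%:R * e <= s + k.+1%:R * e by rewrite lerD2l ler_wpM2r// ler_nat.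
have k1 : 0 <= s + k.+1%:R * e by lra.
pose E := [set w : Omega R A |
  canproc (s + k%:R * e) w = canproc (s + k.+1%:R * e) w].
have FE : Ft (s + k.+1%:R * e) E by apply: Ft_eq => //; lra.
rewrite (_ : [set _ | _] = (E `&` [set w | grid_itin s e k w = p]) `|`
  (~` E `&` [set w | rcons (grid_itin s e k w) (canproc (s + k.+1%:R * e) w) = p]));
  last first.
  apply/seteqP; split=> w; rewrite /E /=; case: eqP => wE.
  - by left.
  - by right.
  - by case=> [[]|[]].
  - by case=> [[]|[]].
apply: Ft_U; apply: Ft_I => //; first by apply: Ft_mono (IH _).
  exact: Ft_C.
case/lastP: p => [|p y].
  rewrite (_ : [set _ | _] = set0); first exact: Ft_0.
  by apply/seteqP; split=> // w /= /(congr1 size); rewrite size_rcons.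
rewrite (_ : [set _ | _] = [set w | grid_itin s e k w = p] `&`
    [set w | canproc (s + k.+1%:R * e) w = y]); last first.
  apply/seteqP; split=> w /=; last by case=> -> ->.
  by move=> /eqP; rewrite eqseq_rcons => /andP[/eqP -> /eqP ->].
by apply: Ft_I; [apply: Ft_mono (IH _)|exact: Ft_at].
Qed.

Lemma Ft_grid_in s e k (B : set (seq X)) : 0 <= s -> 0 <= e ->
  Ft (s + k%:R * e) [set w | B (grid_itin s e k w)].
Proof.
move=> s0 e0.
have -> : [set w | B (grid_itin s e k w)] = \bigcup_(p : seq X)
    ([set w : Omega R A | B p] `&` [set w | grid_itin s e k w = p]).
  apply/seteqP; split=> [w /= Bw|w [p _ /= [? ->]]//].
  by exists (grid_itin s e k w).
apply: countable_bigcupT_measurable => [|p]; first exact: countable_seq.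
apply: Ft_I; last exact: Ft_grid.
have [Bp|nBp] := pselect (B p).
  by rewrite (_ : [set _ | _] = setT); [exact: Ft_T|apply/seteqP; split].
by rewrite (_ : [set _ | _] = set0); [exact: Ft_0|apply/seteqP; split].
Qed.

(** The grid itinerary is eventually the itinerary, hence the event that the latter
lies in B is the lower limit of observable events. *)
Lemma Ft_itin s t (B : set (seq X)) : 0 <= s -> s <= t -> t <= 1 ->
  Ft t [set w | B (itin s t w)].
Proof.
move=> s0 st t1.
pose e n : R := (t - s) / n.+1%:R.
have e0 n : 0 <= e n by rewrite divr_ge0// subr_ge0.
have tE n : s + n.+1%:R * e n = t by rewrite mulrC divfK ?pnatr_eq0// addrC subrK.
have -> : [set w : Omega R A | B (itin s t w)] =
    \bigcup_m \bigcap_(n in [set n | (m <= n)%N])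
      [set w | B (grid_itin s (e n) n.+1 w)].
  apply/seteqP; split=> w; have [m mP] := grid_itin_near w s0 st t1.
    by move=> Bw; exists m => // n mn; rewrite /mkset mP.
  move=> [k _ /(_ (maxn m k) (leq_maxr m k))].
  by rewrite /mkset mP ?leq_maxl.
apply: bigcupT_measurable => m; apply: bigcap_measurable => [|n _].
  by exists m => /=.
by have := @Ft_grid_in s (e n) n.+1 B s0 (e0 n); rewrite tE.
Qed.

End filtration.

(* From now on an event belongs to the past of s only by the lemmas above. *)
#[global] Opaque Ft.

(** * Intensities of class C^1 *)

Section C1.
Context {R : realType}.
Implicit Types (f df : R -> R) (s t e d K : R).

Lemma C1_diff_quotient f df t : 0 <= t <= 1 ->
  (f s - f t) / (s - t) @[s --> within `[0, 1] t^'] --> df t ->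
  forall e, 0 < e -> exists2 d, 0 < d & forall s, 0 <= s <= 1 ->
    `|s - t| < d -> `|f s - f t - df t * (s - t)| <= e * `|s - t|.
Proof.
move=> t01 /cvgrPdist_le fdf e e0.
have /nbhs_ballP[d d0 dP] := fdf e e0.
exists d => // s s01 std; have [->|st] := eqVneq s t.
  by rewrite !subrr mulr0 subrr normr0 mulr0.
have /= := dP s; rewrite /ball/= distrC => /(_ std st).
rewrite in_itv/= s01 => /(_ isT).
have st0 : s - t != 0 by rewrite subr_eq0.
rewrite distrC -(ler_pM2r (_ : 0 < `|s - t|)) ?normr_gt0// -normrM.
by rewrite mulrBl divfK.
Qed.

Lemma C1_is_derive f df t : 0 < t < 1 ->
  (f s - f t) / (s - t) @[s --> within `[0, 1] t^'] --> df t ->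
  is_derive t 1 f (df t).
Proof.
move=> /andP[t0 t1] fdf; have t01 : 0 <= t <= 1 by apply/andP; split; lra.
have H : h^-1 *: (f (h *: 1 + t) - f t) @[h --> 0^'] --> df t.
  apply/cvgrPdist_le => e e0.
  have [d d0 dP] := C1_diff_quotient t01 fdf e0.
  near=> h.
  have h0 : h != 0 by near: h; exact: nbhs_dnbhs_neq.
  have hd : `|h| < Num.min d (Num.min t (1 - t)).
    near: h; apply: dnbhs0_lt; rewrite !lt_min d0 t0 /=; lra.
  move: hd; rewrite !lt_min => /and3P[hd ht ht'].
  have := dP (h + t); rewrite addrK => /(_ _ hd).
  rewrite [_ *: 1]mulr1 [h^-1 *: _]mulrC distrC => H.
  rewrite -(ler_pM2r (_ : 0 < `|h|)) ?normr_gt0// -normrM mulrBl divfK//.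
  apply: H; move: ht ht'; rewrite !ltr_norml => /andP[? ?] /andP[? ?].
  by apply/andP; split; lra.
have dt : derivable f t 1 by apply/cvg_ex; exists (df t).
by apply: DeriveDef => //; apply/cvg_lim.
Unshelve. all: by end_near. Qed.

Lemma C1_cont f df :
  (forall t, 0 <= t <= 1 ->
     (f s - f t) / (s - t) @[s --> within `[0, 1] t^'] --> df t) ->
  {within `[0, 1], continuous f}.
Proof.
move=> fdf; apply/continuous_within_itvP => //.
have H t : 0 <= t <= 1 -> forall e, 0 < e ->
    exists2 d, 0 < d & forall s, 0 <= s <= 1 -> `|s - t| < d ->
      `|f t - f s| <= e.
  move=> t01 e e0; have [d d0 dP] := C1_diff_quotient t01 (fdf _ t01) ltr01.
  have D0 : 0 < `|df t| + 1 by have := normr_ge0 (df t); lra.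
  exists (Num.min d (e / (`|df t| + 1))).
    by rewrite lt_min d0 divr_gt0.
  move=> s s01; rewrite lt_min => /andP[sd /ltW se].
  have := dP s s01 sd; rewrite mul1r => Hs.
  apply: (@le_trans _ _ ((`|df t| + 1) * `|s - t|)).
    have := ler_normD (f s - f t - df t * (s - t)) (df t * (s - t)).
    by rewrite subrK distrC normrM mulrDl mul1r; lra.
  by rewrite mulrC -ler_pdivlMr.
split.
- move=> t; rewrite in_itv/= => /andP[t0 t1].
  apply: differentiable_continuous; apply/derivable1_diffP.
  have [] // := @C1_is_derive f df t _ (fdf t _); apply/andP; split; lra.
- apply/cvgrPdist_le => e e0; have z01 : (0 : R) <= 0 <= (1 : R) by rewrite lexx ler01.
  have [d d0 dP] := H 0 z01 e e0.
  near=> s; apply: dP.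
    apply/andP; split; first by apply: ltW; near: s; exact: nbhs_right_gt.
    by near: s; apply: nbhs_right_le.
  rewrite subr0 gtr0_norm; first by near: s; apply: nbhs_right_lt.
  by near: s; exact: nbhs_right_gt.
- apply/cvgrPdist_le => e e0; have z01 : (0 : R) <= 1 <= (1 : R) by rewrite ler01 lexx.
  have [d d0 dP] := H 1 z01 e e0.
  near=> s; have s1 : s < 1 by near: s; exact: nbhs_left_lt.
  apply: dP.
    apply/andP; split; last exact: ltW.
    by near: s; apply: nbhs_left_ge.
  rewrite distrC gtr0_norm ?subr_gt0//.
  rewrite ltrBlDl -ltrBlDr; near: s; apply: nbhs_left_gt; lra.
Unshelve. all: by end_near. Qed.

(** Mean value theorem, the derivative being bounded on a compact interval. *)
Lemma C1_lipschitz f : C1_01 f ->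
  exists2 K : R, 0 <= K & forall s t, 0 <= s -> s <= t -> t <= 1 ->
    `|f t - f s| <= K * (t - s).
Proof.
move=> [df dfc fdf].
have cf := C1_cont fdf.
have dfa : {within `[0, 1], continuous (fun x => `|df x|)}.
  move=> x; apply: continuous_comp; first exact: dfc.
  exact: norm_continuous.
have [c c01 cP] := EVT_max ler01 dfa.
exists `|df c| => // s t s0; rewrite le_eqVlt => /orP[/eqP <-|st] t1.
  by rewrite !subrr normr0 mulr0.
have dst x : x \in `]s, t[ -> is_derive x 1 f (df x).
  rewrite in_itv /= => /andP[sx xt].
  by apply: C1_is_derive; [|apply: fdf]; apply/andP; split; lra.
have cst : {within `[s, t], continuous f}.
  apply: continuous_subspaceW cf => x /=; rewrite !in_itv/= => /andP[sx xt].
  by apply/andP; split; lra.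
have [x xst ->] := MVT st dst cst.
rewrite normrM [X in _ * X]ger0_norm ?subr_ge0 ?(ltW st)// ler_wpM2r ?subr_ge0 ?(ltW st)//.
apply: cP; move: xst; rewrite !in_itv/= => /andP[sx xt].
by apply/andP; split; lra.
Qed.

End C1.

(** * Rates of the generator along a path *)

(** The hypotheses on the graph and on the intensity, with the bound M on the total
intensity made explicit. *)
Record admissible {R : realType} {X : pointedType} (A : rel X)
    (j : R -> X -> X -> R) (M : R) : Prop := Admissible {
  adm_countable : countable [set: X];
  adm_bounded : bounded_degree A;
  adm_loopless : forall z, ~~ A z z;
  adm_C1 : forall z z', A z z' -> C1_01 (fun t => j t z z');
  adm_gt0 : forall t z z', 0 <= t <= 1 -> A z z' -> 0 < j t z z';
  adm_jbar : forall t z, 0 <= t <= 1 -> jbar A j t z <= M }.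

Section intensity.
Context {R : realType} {X : pointedType}.
Variables (A : rel X) (j : R -> X -> X -> R) (M : R).
Hypothesis adm : admissible A j M.
Let A_bounded := adm_bounded adm.
Let A_loopless := adm_loopless adm.
Let j_C1 := adm_C1 adm.
Let j_gt0 := adm_gt0 adm.
Let jbarM := adm_jbar adm.
Implicit Types (r s t : R) (x y z : X).

Lemma finite_neighbours z : finite_set (neighbours A z).
Proof.
have [D DP] := A_bounded.
by apply: card_le_finite (DP z) _; exact: finite_II.
Qed.

(** The intensity, extended by 0 to the pairs that are not arcs. *)
Definition arc_rate s z y : R := if A z y then j s z y else 0.

(** The coefficients of the generator: L_s applied to the indicator of y is
[gen_coef s z y] at z. *)
Definition gen_coef s z y : R := if z == y then - jbar A j s z else arc_rate s z y.

Lemma generator_indic s y z :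
  generator A j s (fun x => (x == y)%:R) z = gen_coef s z y.
Proof.
rewrite /generator /gen_coef; case: eqVneq => [->|zy].
  have fN := finite_neighbours y.
  rewrite /jbar !fsbig_finite// -sumrN big_seq [RHS]big_seq.
  apply: eq_bigr => z'; rewrite (in_fset_set fN) inE /neighbours/= => Ayz'.
  by case: eqVneq Ayz' => [->|_ _]; rewrite ?(negPf (A_loopless y))// sub0r mulrN1.
under eq_fsbigr do rewrite subr0.
rewrite /arc_rate; case: ifPn => Azy.
  rewrite (fsbigD1 y) //; last exact: finite_neighbours.
  rewrite eqxx mulr1 fsbig1 => [|z' [_ /= z'y]]; first exact: addr0.
  by case: eqVneq => [/z'y//|]; rewrite mulr0.
rewrite fsbig1// => z' /= Azz'; case: eqVneq => [z'y|]; last by rewrite mulr0.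
by rewrite -z'y Azz' in Azy.
Qed.

Lemma jbarE t z : jbar A j t z =
  \sum_(z' <- enum_fset (fset_set (neighbours A z))) j t z z'.
Proof. by rewrite /jbar fsbig_finite//; exact: finite_neighbours. Qed.

Lemma jbar_ge0 t z : 0 <= t <= 1 -> 0 <= jbar A j t z.
Proof.
move=> t01; apply: fsumr_ge0 => z' Azz'.
by rewrite ltW// j_gt0.
Qed.

Lemma arc_rate_ge0 t z y : 0 <= t <= 1 -> 0 <= arc_rate t z y.
Proof. by move=> t01; rewrite /arc_rate; case: ifP => // Azy; rewrite ltW// j_gt0. Qed.

Lemma arc_rate_le t z y : 0 <= t <= 1 -> arc_rate t z y <= M.
Proof.
move=> t01; apply: le_trans (@jbarM t z t01); rewrite /arc_rate.
case: ifP => Azy; last exact: jbar_ge0.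
rewrite /jbar (fsbigD1 y)//; last exact: finite_neighbours.
rewrite lerDl; apply: fsumr_ge0 => z' [Azz' _].
by rewrite ltW// j_gt0.
Qed.

Lemma M_ge0 : 0 <= M.
Proof.
have t01 : (0 : R) <= 0 <= (1 : R) by rewrite lexx ler01.
exact: le_trans (jbar_ge0 point t01) (@jbarM _ _ t01).
Qed.

Lemma gen_coef_le t z y : 0 <= t <= 1 -> - M <= gen_coef t z y <= M.
Proof.
move=> t01; rewrite /gen_coef; have M0 := M_ge0; case: ifP => _.
  have := jbar_ge0 z t01; have := @jbarM t z t01; lra.
by rewrite arc_rate_le// andbT; have := arc_rate_ge0 z y t01; lra.
Qed.

Definition lip01 (f : R -> R) (K : R) := forall s t,
  0 <= s -> s <= t -> t <= 1 -> `|f t - f s| <= K * (t - s).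

Lemma arc_rate_lip z y : exists2 K : R, 0 <= K & lip01 (fun t => arc_rate t z y) K.
Proof.
rewrite /arc_rate; case Azy : (A z y); first exact: C1_lipschitz (j_C1 Azy).
by exists 0 => // s t; rewrite subrr normr0 mul0r.
Qed.

Lemma jbar_lip z : exists2 K : R, 0 <= K & lip01 (fun t => jbar A j t z) K.
Proof.
have [K K0 H] : exists2 K : R, 0 <= K & lip01 (fun t =>
    \sum_(z' <- enum_fset (fset_set (neighbours A z))) arc_rate t z z') K.
  elim: (enum_fset _) => [|y l [K K0 IH]].
    by exists 0 => // s t; rewrite !big_nil subrr normr0 mul0r.
  have [L L0 HL] := arc_rate_lip z y.
  exists (L + K) => [|s t s0 st t1]; first exact: addr_ge0.
  rewrite !big_cons opprD addrACA mulrDl.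
  apply: le_trans (ler_normD _ _) _.
  by apply: lerD; [exact: HL|exact: IH].
exists K => // s t s0 st t1; have := H s t s0 st t1.
have E r : jbar A j r z =
    \sum_(z' <- enum_fset (fset_set (neighbours A z))) arc_rate r z z'.
  rewrite jbarE big_seq [RHS]big_seq; apply: eq_bigr => z' zz'.
  have /set_mem/= Azz' : z' \in neighbours A z.
    by rewrite -(in_fset_set (finite_neighbours z)).
  by rewrite /arc_rate ifT.
by rewrite !E.
Qed.

Lemma gen_coef_lip z y : exists2 K : R, 0 <= K & lip01 (fun t => gen_coef t z y) K.
Proof.
rewrite /gen_coef; case: (z == y); last exact: arc_rate_lip.
have [K K0 H] := jbar_lip z; exists K => // s t s0 st t1.
by rewrite -opprD normrN; exact: H.
Qed.

Section path_integral.
Variables (w : Omega R A) (y : X).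

Let f s : R := gen_coef s (canproc s w) y.

(** Away from the jump times the path is locally constant, and the coefficient
inherits the continuity of the intensity; the remaining times form a finite set. *)
Lemma measurable_path_rate : measurable_fun (`[0, 1]%classic : set R) f.
Proof.
(* 0 and 1 are put aside as well, since continuity is used on an open set. *)
pose J := [set` 0 :: 1 :: jumps w].
have fJ : finite_set J by exact: finite_seq.
pose U : set R := `]0, 1[%classic `&` ~` J.
have mJ : measurable J.
  by apply: countable_measurable => //; exact: finite_set_countable.
apply: (@measurable_funS _ _ _ _ (U `|` J)).
- by apply: measurableU => //; apply: measurableI => //; exact: measurableC.
- move=> s /=; rewrite !in_itv/= => /andP[s0 s1].
  have [sJ|sJ] := pselect (J s); [by right|left; split=> //].
  rewrite /= in_itv/= !lt_neqAle s0 s1 !andbT; apply/andP; split.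
    by apply/eqP => s0'; apply: sJ; rewrite -s0' /J /= in_cons eqxx.
  by apply/eqP => s1'; apply: sJ; rewrite s1' /J /= !in_cons eqxx orbT.
apply/measurable_funU => //; first by apply: measurableI => //; exact: measurableC.
split; last first.
  move=> _ Y mY; apply: countable_measurable => //.
  by apply: finite_set_countable; apply: sub_finite_set fJ => ? [].
apply: open_continuous_measurable_fun.
  apply: openI; first exact: interval_open.
  apply: closed_openC; apply: (compact_closed (@Rhausdorff R)).
  exact: finite_compact.
move=> s /set_mem [/=]; rewrite in_itv/= => /andP[s0 s1] sJ.
(* Within distance d of s there is no jump. *)
have [d d0 dP] := seq_gap (s :: jumps w).
have [K K0 HK] := gen_coef_lip (canproc s w) y.
have near_cst r : 0 <= r <= 1 -> `|r - s| < d -> canproc r w = canproc s w.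
  rewrite ltr_norml => /andP[r0 r1] /andP[rs sr].
  have jd a : a \in jumps w -> a < s -> d <= s - a.
    by move=> aw; apply: dP; rewrite !in_cons ?aw ?eqxx ?orbT.
  have jd' a : a \in jumps w -> s < a -> d <= a - s.
    by move=> aw; apply: dP; rewrite !in_cons ?aw ?eqxx ?orbT.
  have sj a : a \in jumps w -> a <> s.
    by move=> aw as_; apply: sJ; rewrite /J /= -as_ !in_cons aw !orbT.
  have [rs'|sr'] := leP r s.
    apply: path_cst => // [|a aw /andP[ra as_]]; first lra.
    have := jd _ aw; rewrite lt_neqAle as_ andbT.
    by move/eqP : (sj _ aw) => -> /(_ isT); lra.
  apply/esym/path_cst => // [||a aw /andP[sa ar]]; [lra|lra|].
  by have := jd' _ aw sa; lra.
apply/cvgrPdist_le => e e0; near=> r.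
have rd : `|s - r| < Num.min d (Num.min s (Num.min (1 - s) (e / (K + 1)))).
  near: r; apply: cvgr_dist_lt => //; rewrite !lt_min d0 s0 subr_gt0 s1 /=.
  by rewrite divr_gt0//; lra.
move: rd; rewrite !lt_min => /and4P[rd rs rs1 re].
have r01 : 0 <= r <= 1.
  move: rs rs1; rewrite !ltr_norml => /andP[? ?] /andP[? ?].
  by apply/andP; split; lra.
rewrite /f (near_cst r r01); last by rewrite distrC.
apply: (@le_trans _ _ (K * `|s - r|)).
  have /andP[r0 r1] := r01.
  have [rs'|sr'] := leP r s.
    by rewrite [X in _ * X]ger0_norm ?subr_ge0//; apply: HK => //; lra.
  rewrite distrC [X in _ * X]distrC [X in _ * X]gtr0_norm ?subr_gt0//.
  by apply: HK => //; lra.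
have : `|s - r| * (K + 1) < e by rewrite -ltr_pdivlMr//; lra.
have := normr_ge0 (s - r); nra.
Unshelve. all: by end_near. Qed.

Lemma integrable_path_rate :
  lebesgue_measure.-integrable (`[0, 1]%classic : set R) (EFin \o f).
Proof.
apply: measurable_bounded_integrable => //.
- by rewrite /= lebesgue_measure_itv/= lte_fin ltr01 oppr0 adde0 ltry.
- exact: measurable_path_rate.
- exists M; split; first exact: num_real.
  move=> N MN s /=; rewrite in_itv/= => s01.
  by have /andP[h1 h2] := gen_coef_le (canproc s w) y s01; rewrite ler_norml /f; lra.
Qed.

Lemma path_rate_integralB r t : 0 <= r -> r <= t -> t <= 1 ->
  \int[lebesgue_measure]_(s in `[0, t]) f s
  - \int[lebesgue_measure]_(s in `[0, r]) f s
  = \int[lebesgue_measure]_(s in `]r, t]) f s.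
Proof.
move=> r0 rt t1; rewrite Rintegral_itvB//.
apply: integrableS integrable_path_rate => //.
by apply: subset_itvl; rewrite bnd_simp.
Qed.

(** Only constant bounds of the integrand are ever needed, so that no integral over
time has to be exchanged with an expectation. *)
Lemma path_rate_integral_le r t a b : 0 <= r -> r <= t -> t <= 1 ->
  (forall s, r <= s <= t -> a <= f s <= b) ->
  a * (t - r) <= \int[lebesgue_measure]_(s in `]r, t]) f s <= b * (t - r).
Proof.
move=> r0 rt t1 fab.
have mu : fine (lebesgue_measure (`]r, t]%classic : set R)) = t - r.
  rewrite lebesgue_measure_itv/= lte_fin; case: ltP => //= tr.
  by apply/eqP; rewrite eq_sym subr_eq0 eq_le tr.
have fI : lebesgue_measure.-integrable (`]r, t]%classic : set R) (EFin \o f).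
  apply: integrableS integrable_path_rate => // s /=.
  by rewrite !in_itv/=; lra.
have cI c : lebesgue_measure.-integrable (`]r, t]%classic : set R) (EFin \o cst c).
  apply: measurable_bounded_integrable => //.
  - by rewrite /= lebesgue_measure_itv/=; case: ifP; rewrite ?ltry// -EFinB ltry.
  - exists `|c|; split; first exact: num_real.
    by move=> N cN s _ /=; exact: ltW.
rewrite -mu -!Rintegral_cst//.
apply/andP; split; apply: le_Rintegral => //; try exact: (cI _).
  move=> s /=; rewrite in_itv/= => /andP[/ltW rs st].
  by have /fab/andP[] : r <= s <= t by rewrite rs.
move=> s /=; rewrite in_itv/= => /andP[/ltW rs st].
by have /fab/andP[] : r <= s <= t by rewrite rs.
Qed.

End path_integral.

End intensity.

(** * Martingale problem and number of jumps *)

Section local.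
Context {R : realType} {X : pointedType}.
Variables (A : rel X) (j : R -> X -> X -> R) (M : R).
Hypothesis adm : admissible A j M.
Let X_countable := adm_countable adm.
Implicit Types (r s t : R) (x y z : X) (D : set (Omega R A)).
Implicit Types (Q : probability (path_space R A) R).

(** The martingale problem without its initial condition. *)
Definition solves Q := forall u : X -> R, finite_set [set z | u z <> 0] ->
    martingale01 Q (fun s => <<s @cylinders R X A s >>)
      (fun t w => u (canproc t w) - u (canproc 0 w)
         - \int[lebesgue_measure]_(s in `[0, t]) generator A j s u (canproc s w)).

Let Y y r t (w : Omega R A) : R :=
  \int[lebesgue_measure]_(s in `]r, t]) gen_coef A j s (canproc s w) y.

Lemma Rintegral_indic Q (D E : set (path_space R A)) :
  measurable D -> measurable E ->
  \int[Q]_(w in D) (\1_E w : R) = pr Q (D `&` E).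
Proof. by move=> mD mE; rewrite /Rintegral integral_indic// setIC. Qed.

Lemma integrable_indicS Q (D E : set (path_space R A)) :
  measurable D -> measurable E -> Q.-integrable D (EFin \o \1_E).
Proof.
by move=> mD mE; apply: integrableS (integrable_indic _ mE).
Qed.

(** Dynkin's formula for the indicator of y, localised on an event of the past: the
increment of the martingale has mean 0 on D. *)
Lemma dynkin Q y r t D : solves Q -> 0 <= r -> r <= t -> t <= 1 -> Ft r D ->
  Q.-integrable (D : set (path_space R A)) (EFin \o Y y r t) /\
  pr Q (D `&` [set w | canproc t w = y]) - pr Q (D `&` [set w | canproc r w = y])
    = \int[Q]_(w in D) Y y r t w.
Proof.
move=> SQ r0 rt t1 FD.
have r1 : r <= 1 by exact: le_trans t1.
have t0 : 0 <= t by exact: le_trans rt.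
have mD : measurable (D : set (path_space R A)) by exact: (Ft_measurable r1 FD).
pose u x : R := (x == y)%:R.
have fu : finite_set [set z | u z <> 0].
  apply: (@sub_finite_set _ _ [set y]); last exact: finite_set1.
  by move=> z /=; rewrite /u; case: eqVneq.
have [_ MI ME] := SQ u fu.
pose N t (w : Omega R A) := u (canproc t w) - u (canproc 0 w)
  - \int[lebesgue_measure]_(s in `[0, t]) generator A j s u (canproc s w).
have NE : \int[Q]_(w in D) N t w = \int[Q]_(w in D) N r w.
  exact: (congr1 fine (ME r t D r0 rt t1 (Ft_sigma FD))).
have NI s : 0 <= s -> s <= 1 ->
    Q.-integrable (D : set (path_space R A)) (EFin \o N s).
  move=> s0 s1; have s01 : 0 <= s <= 1 by rewrite s0.
  exact: (integrableS measurableT mD (@subsetT _ _) (MI s s01)).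
pose E s : set (path_space R A) := [set w | canproc s w = y].
have mE s : 0 <= s -> s <= 1 -> measurable (E s).
  by move=> s0 s1; exact: Ft_measurable s1 (Ft_at y s0 (lexx s)).
have uE s w : u (canproc s w) = \1_(E s) w.
  rewrite /u indicE /E; congr (nat_of_bool _)%:R.
  by apply/eqP/idP; rewrite inE.
have YE : Y y r t = (fun w => \1_(E t) w - \1_(E r) w - (N t w - N r w)).
  apply/funext => w; rewrite /N /Y -!uE.
  rewrite -(path_rate_integralB adm w y r0 rt t1).
  have EI s : \int[lebesgue_measure]_(r in `[0, s]) generator A j r u (canproc r w)
      = \int[lebesgue_measure]_(r in `[0, s]) gen_coef A j r (canproc r w) y.
    by apply: eq_Rintegral => v _; rewrite (generator_indic adm).
  by rewrite !EI; ring.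
have mDE s : 0 <= s -> s <= 1 ->
    Q.-integrable (D : set (path_space R A)) (EFin \o \1_(E s)).
  by move=> s0 s1; exact: (integrable_indicS Q mD (mE s s0 s1)).
have I1 : Q.-integrable (D : set (path_space R A))
    (EFin \o (fun w => \1_(E t) w - \1_(E r) w : R)).
  by have := integrableB mD (mDE _ t0 t1) (mDE _ r0 r1).
have I2 : Q.-integrable (D : set (path_space R A))
    (EFin \o (fun w => N t w - N r w : R)).
  by have := integrableB mD (NI _ t0 t1) (NI _ r0 r1).
split; first by rewrite YE; have := integrableB mD I1 I2.
rewrite YE (RintegralB mD I1 I2).
rewrite (RintegralB mD (mDE _ t0 t1) (mDE _ r0 r1)).
rewrite (RintegralB mD (NI _ t0 t1) (NI _ r0 r1)) NE subrr subr0.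
by rewrite (Rintegral_indic Q mD (mE _ t0 t1)) (Rintegral_indic Q mD (mE _ r0 r1)).
Qed.

(** The time integral is controlled precisely on the event G that nothing happens, and
roughly, by b, on its complement, which has a small probability. *)
Lemma dynkin_bounds Q y r t D (G : set (Omega R A)) (c a b : R) :
  solves Q -> 0 <= r -> r <= t -> t <= 1 -> Ft r D -> Ft 1 G ->
  (forall w, D w -> G w -> `|Y y r t w - c| <= a) ->
  (forall w, D w -> ~ G w -> `|Y y r t w - c| <= b) ->
  `|pr Q (D `&` [set w | canproc t w = y])
    - pr Q (D `&` [set w | canproc r w = y]) - c * pr Q D|
    <= a * pr Q (D `&` G) + b * pr Q (D `&` ~` G).
Proof.
move=> SQ r0 rt t1 FD FG Ha Hb.
have r1 : r <= 1 by exact: le_trans t1.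
have mD : measurable (D : set (path_space R A)) by exact: (Ft_measurable r1 FD).
have mG : measurable (G : set (path_space R A)) by exact: (Ft_measurable (lexx 1) FG).
have mCG : measurable (~` G : set (path_space R A)) by exact: measurableC.
have [YI ->] := dynkin y SQ r0 rt t1 FD.
have cI k : Q.-integrable (D : set (path_space R A)) (EFin \o (fun=> k : R)).
  exact: finite_measure_integrable_cst.
have indI (H : set (path_space R A)) k : measurable H -> Q.-integrable
    (D : set (path_space R A)) (EFin \o (fun w => k * \1_H w)).
  by move=> mH; exact: (integrableZl mD k (integrable_indicS Q mD mH)).
have cE : c * pr Q D = \int[Q]_(w in D) c by rewrite (Rintegral_cst Q mD).
have aE (H : set (path_space R A)) k : measurable H ->
    k * pr Q (D `&` H) = \int[Q]_(w in D) (k * \1_H w).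
  move=> mH; rewrite (RintegralZl k mD (integrable_indicS Q mD mH)).
  by rewrite (Rintegral_indic Q mD mH).
have DI : Q.-integrable (D : set (path_space R A))
    (EFin \o (fun w => Y y r t w - c)).
  exact: (integrableB mD YI (cI c)).
rewrite cE -(RintegralB mD YI (cI c)).
apply: le_trans (le_normr_Rintegral mD DI) _.
rewrite (aE G a mG) (aE (~` G) b mCG) -(RintegralD mD (indI _ a mG) (indI _ b mCG)).
apply: (le_Rintegral mD).
- exact: (integrable_abse DI).
- exact: (integrableD mD (indI _ a mG) (indI _ b mCG)).
move=> w Dw; rewrite !indicE.
have [Gw|nGw] := pselect (G w).
  rewrite mem_set// memNset ?mulr1 ?mulr0 ?addr0 => [|//]; exact: Ha.
rewrite memNset// mem_set ?mulr1 ?mulr0 ?add0r => [|//]; exact: Hb.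
Qed.

Lemma Y_bound y r t w : 0 <= r -> r <= t -> t <= 1 ->
  `|Y y r t w| <= M * (t - r).
Proof.
move=> r0 rt t1; rewrite ler_norml -mulNr.
apply: (path_rate_integral_le adm) => // s /andP[rs st].
by apply: (gen_coef_le adm); lra.
Qed.

(** The test function is the indicator of z: at worst its generator is - M. *)
Lemma leave_at Q r t z D : solves Q -> 0 <= r -> r <= t -> t <= 1 ->
  Ft r D -> D `<=` [set w | canproc r w = z] ->
  pr Q (D `&` [set w | canproc r w <> canproc t w]) <= M * (t - r) * pr Q D.
Proof.
move=> SQ r0 rt t1 FD Dz; have r1 : r <= 1 by exact: le_trans t1.
have mD : measurable (D : set (path_space R A)) by exact: (Ft_measurable r1 FD).
have mE : measurable ([set w | canproc t w = z] : set (path_space R A)).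
  by apply: (@Ft_measurable _ _ _ t) => //; apply: Ft_at => //; lra.
have DE : D `&` [set w | canproc r w = z] = D by apply: setIidl.
have H1 w : D w -> setT w -> `|Y z r t w - 0| <= M * (t - r).
  by move=> _ _; rewrite subr0; exact: Y_bound.
have H2 w : D w -> ~ setT w -> `|Y z r t w - 0| <= 0 by move=> _ /(_ I).
have := dynkin_bounds SQ r0 rt t1 FD (@Ft_T R X A 1) H1 H2.
rewrite DE setIT mul0r subr0 mul0r addr0 => H.
have -> : D `&` [set w | canproc r w <> canproc t w] =
    D `&` ~` [set w | canproc t w = z].
  by apply/seteqP; split=> w [Dw] /=; have /= -> := Dz _ Dw; split => //; exact/nesym.
have := prID Q mD mE.
by move: H; rewrite ler_norml => /andP[+ _]; lra.
Qed.

Lemma leave Q r t D : solves Q -> 0 <= r -> r <= t -> t <= 1 -> Ft r D ->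
  pr Q (D `&` [set w | canproc r w <> canproc t w]) <= M * (t - r) * pr Q D.
Proof.
move=> SQ r0 rt t1 FD; have r1 : r <= 1 by exact: le_trans t1.
have t0 : 0 <= t by exact: le_trans rt.
rewrite -[leLHS]mul1r.
apply: (@pr_split_le _ _ (path_space R A) _ X_countable
  (canproc r : path_space R A -> X)) => //.
- by move=> x; apply: (@Ft_measurable _ _ _ r) => //; exact: Ft_at.
- by rewrite mulr_ge0 ?(M_ge0 adm)// subr_ge0.
- apply: (@Ft_measurable _ _ _ t) => //; apply: Ft_I; first exact: (Ft_mono rt FD).
  by apply: Ft_C; exact: Ft_eq.
- exact: (Ft_measurable r1 FD).
move=> x; rewrite mul1r setIAC; apply: (@leave_at _ _ _ x) => //.
  by apply: Ft_I => //; exact: Ft_at.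
Qed.

(** A union bound: for the grid itinerary to grow in one cell, the walk must move
between the two ends of the cell, which costs a factor M e. *)
Lemma grid_size Q r e D i k : solves Q -> 0 <= r -> 0 <= e ->
  r + k%:R * e <= 1 -> Ft r D ->
  pr Q (D `&` [set w | (i <= size (grid_itin r e k w))%N])
    <= (k%:R * (M * e)) ^+ i * pr Q D.
Proof.
move=> SQ r0 e0 + FD; elim: k i => [|k IH] i rk1.
  have mD : measurable (D : set (path_space R A)).
    by apply: (Ft_measurable _ FD); lra.
  case: i => [|i]; last first.
    rewrite mul0r expr0n mul0r (_ : _ `&` _ = set0) ?pr0//.
    by apply/seteqP; split=> // w [].
  by rewrite expr0 mul1r (_ : _ `&` _ = D)//; apply/seteqP; split=> [w []|].
have k0 : 0 <= k%:R * e by rewrite mulr_ge0.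
have kS : r + k.+1%:R * e = r + k%:R * e + e by rewrite -natr1; ring.
have mD : measurable (D : set (path_space R A)).
  by apply: (Ft_measurable _ FD); lra.
have Fsz m n : (n <= k.+1)%N -> Ft (r + n%:R * e) (D `&` [set w | (m <= size (grid_itin r e n w))%N]).
  move=> nk; apply: Ft_I; first by apply: (Ft_mono _ FD); rewrite lerDl mulr_ge0.
  exact: (@Ft_grid_in _ _ _ X_countable r e n [set p | (m <= size p)%N]).
have nk1 n : (n <= k.+1)%N -> r + n%:R * e <= 1.
  by move=> nk; apply: le_trans rk1; rewrite lerD2l ler_wpM2r// ler_nat.
case: i => [|i].
  rewrite expr0 mul1r pr_le//; first exact: (Ft_measurable rk1 (Fsz _ _ (leqnn _))).
pose B := [set w : Omega R A | canproc (r + k%:R * e) w <> canproc (r + k.+1%:R * e) w].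
have FB : Ft (r + k.+1%:R * e) B by apply: Ft_C; apply: Ft_eq => //; lra.
have me : 0 <= M * e by rewrite mulr_ge0// (M_ge0 adm).
apply: (@le_trans _ _
  (pr Q ((D `&` [set w | (i.+1 <= size (grid_itin r e k w))%N]) `|`
    ((D `&` [set w | (i <= size (grid_itin r e k w))%N]) `&` B)))).
  apply: pr_le.
  - exact: (Ft_measurable rk1 (Fsz _ _ (leqnn _))).
  - apply: measurableU; first exact: (Ft_measurable (nk1 _ (leqnSn _)) (Fsz _ _ (leqnSn _))).
    apply: measurableI; last exact: (Ft_measurable rk1 FB).
    exact: (Ft_measurable (nk1 _ (leqnSn _)) (Fsz _ _ (leqnSn _))).
  move=> w [Dw] /=; case: eqP => [_ iw|ne]; first by left.
  by rewrite size_rcons ltnS => iw; right.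
apply: le_trans (prU_le _ _ _) _.
- exact: (Ft_measurable (nk1 _ (leqnSn _)) (Fsz _ _ (leqnSn _))).
- apply: measurableI; last exact: (Ft_measurable rk1 FB).
  exact: (Ft_measurable (nk1 _ (leqnSn _)) (Fsz _ _ (leqnSn _))).
have H1 : pr Q ((D `&` [set w | (i <= size (grid_itin r e k w))%N]) `&` B) <=
    M * e * ((k%:R * (M * e)) ^+ i * pr Q D).
  have Ee : r + k.+1%:R * e - (r + k%:R * e) = e by rewrite kS; ring.
  have ab : r + k%:R * e <= r + k.+1%:R * e by rewrite kS lerDl.
  have := leave SQ (addr_ge0 r0 k0) ab rk1 (Fsz i k (leqnSn k)).
  rewrite Ee => /le_trans; apply.
  by rewrite ler_wpM2l// IH// nk1.
apply: le_trans (lerD (IH _ (nk1 _ (leqnSn _))) H1) _.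
rewrite [X in _ + X]mulrA -mulrDl ler_wpM2r ?pr_ge0//.
set c := M * e in me *.
have b0 : 0 <= k%:R * c by rewrite mulr_ge0.
have -> : k.+1%:R * c = k%:R * c + c by rewrite -natr1 mulrDl mul1r.
rewrite !exprS -mulrDl.
apply: ler_pM => //; [exact: addr_ge0|exact: exprn_ge0|].
by apply: lerXn2r; rewrite ?nnegrE ?addr_ge0// lerDl.
Qed.

(** Limit of the bound on grids when the mesh tends to 0: every jump costs a factor
M (t - r). *)
Lemma itin_size_le Q r t D i : solves Q -> 0 <= r -> r <= t -> t <= 1 -> Ft r D ->
  pr Q (D `&` [set w | (i <= size (itin r t w))%N]) <= (M * (t - r)) ^+ i * pr Q D.
Proof.
move=> SQ r0 rt t1 FD.
pose e n : R := (t - r) / n.+1%:R.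
have e0 n : 0 <= e n by rewrite divr_ge0// subr_ge0.
have tE n : n.+1%:R * e n = t - r by rewrite mulrC divfK ?pnatr_eq0.
have tE' n : r + n.+1%:R * e n = t by rewrite tE addrC subrK.
have mD : measurable (D : set (path_space R A)) by apply: (Ft_measurable _ FD); lra.
apply: (@pr_liminf _ _ (path_space R A) Q _
  (fun n => D `&` [set w | (i <= size (grid_itin r (e n) n.+1 w))%N])).
- apply: measurableI => //.
  exact: (Ft_measurable t1 (Ft_itin X_countable [set p | (i <= size p)%N] r0 rt t1)).
- move=> n; apply: measurableI => //.
  have := @Ft_grid_in R X A X_countable r (e n) n.+1 [set p | (i <= size p)%N] r0 (e0 n).
  by rewrite tE' => H; exact: (Ft_measurable t1 H).
- move=> w [Dw iw]; have [n0 n0P] := grid_itin_near w r0 rt t1.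
  by exists n0 => n nn0; split=> //; rewrite /mkset n0P.
- move=> n; apply: le_trans (grid_size i SQ r0 (e0 n) _ FD) _; first by rewrite tE'.
  by rewrite mulrCA tE.
Qed.

End local.

(** * Short time intervals *)

Section expansion.
Context {R : realType} {X : pointedType}.
Variables (A : rel X) (j : R -> X -> X -> R) (M : R).
Hypothesis adm : admissible A j M.
Let X_countable := adm_countable adm.
Implicit Types (r s t : R) (x y z : X) (C D E : set (Omega R A)).
Implicit Types (Q : probability (path_space R A) R).

Let jump_set r t i : set (Omega R A) := [set w | (i <= size (itin r t w))%N].

Lemma Ft_itin_eq r t p : 0 <= r -> r <= t -> t <= 1 ->
  Ft t [set w : Omega R A | itin r t w = p].
Proof.
by move=> r0 rt t1; exact: (@Ft_itin R X A X_countable r t [set q | q = p]).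
Qed.

Lemma Ft_jump_set r t i : 0 <= r -> r <= t -> t <= 1 -> Ft t (jump_set r t i).
Proof.
by move=> r0 rt t1; exact: (@Ft_itin R X A X_countable r t [set q | (i <= size q)%N]).
Qed.

Lemma pr_approx Q E F S (b : R) :
  measurable (E : set (path_space R A)) -> measurable (F : set (path_space R A)) ->
  measurable (S : set (path_space R A)) ->
  E `<=` F -> F `<=` E `|` S -> pr Q S <= b -> 0 <= pr Q F - pr Q E <= b.
Proof.
move=> mE mF mS EF FES Sb.
have h1 := pr_le Q mE mF EF.
have h2 := pr_le Q mF (measurableU _ _ mE mS) FES.
have h3 := prU_le Q mE mS; apply/andP; split; lra.
Qed.

(** If nothing happens in [r, t], the integrand is [gen_coef r z y] up to a Lipschitz
error; otherwise it is bounded, on an event of probability O(t - r). *)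
Lemma local_state z y : exists2 K : R, 0 <= K & forall Q r t D,
  solves j Q -> 0 <= r -> r <= t -> t <= 1 -> Ft r D ->
  D `<=` [set w | canproc r w = z] ->
  `|pr Q (D `&` [set w | canproc t w = y]) - pr Q (D `&` [set w | canproc r w = y])
    - (t - r) * gen_coef A j r z y * pr Q D| <= K * (t - r) ^+ 2 * pr Q D.
Proof.
have [K K0 HK] := gen_coef_lip adm z y.
have M0 := M_ge0 adm.
exists (K + 2 * M ^+ 2) => [|Q r t D SQ r0 rt t1 FD Dz].
  by rewrite addr_ge0// mulr_ge0// exprn_ge0.
have d0 : 0 <= t - r by rewrite subr_ge0.
have r1 : r <= 1 by exact: le_trans t1.
have FG := Ft_mono t1 (Ft_itin_eq [::] r0 rt t1).
have mG : measurable ([set w | itin r t w = [::]] : set (path_space R A)).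
  exact: Ft_measurable (lexx 1) FG.
have mD : measurable (D : set (path_space R A)) by exact: Ft_measurable r1 FD.
have Ha w : D w -> itin r t w = [::] ->
    `|\int[lebesgue_measure]_(s in `]r, t]) gen_coef A j s (canproc s w) y
      - (t - r) * gen_coef A j r z y| <= K * (t - r) ^+ 2.
  move=> Dw Gw.
  have := path_rate_integral_le adm (w := w) (y := y) r0 rt t1
    (a := gen_coef A j r z y - K * (t - r)) (b := gen_coef A j r z y + K * (t - r)).
  move=> H; rewrite ler_norml expr2; apply/andP.
  suff /H/andP[]: forall s, r <= s <= t -> gen_coef A j r z y - K * (t - r) <=
      gen_coef A j s (canproc s w) y <= gen_coef A j r z y + K * (t - r).
    by split; lra.
  move=> s /andP[rs st].
  have -> : canproc s w = z.
    have /= <- := Dz _ Dw; apply/esym/itin_nil => //; first by lra.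
    exact: itin_le_nil Gw.
  have := HK r s r0 rs (le_trans st t1).
  have : K * (s - r) <= K * (t - r) by rewrite ler_wpM2l// lerD2r.
  by rewrite ler_norml => ? /andP[? ?]; apply/andP; split; lra.
have Hb w : D w -> ~ itin r t w = [::] ->
    `|\int[lebesgue_measure]_(s in `]r, t]) gen_coef A j s (canproc s w) y
      - (t - r) * gen_coef A j r z y| <= 2 * (M * (t - r)).
  move=> Dw _; have := Y_bound adm y w r0 rt t1.
  have r01 : 0 <= r <= 1 by rewrite r0.
  have /andP[h1 h2] := gen_coef_le adm z y r01.
  have h3 : - (M * (t - r)) <= (t - r) * gen_coef A j r z y.
    by rewrite -mulNr mulrC ler_wpM2l.
  have h4 : (t - r) * gen_coef A j r z y <= M * (t - r).
    by rewrite mulrC ler_wpM2r.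
  by rewrite !ler_norml => /andP[? ?]; apply/andP; split; lra.
have := dynkin_bounds adm SQ r0 rt t1 FD FG Ha Hb.
move=> /le_trans; apply.
have h1 : pr Q (D `&` [set w | itin r t w = [::]]) <= pr Q D.
  by apply: pr_le => //; exact: measurableI.
have h2 : pr Q (D `&` ~` [set w | itin r t w = [::]]) <= M * (t - r) * pr Q D.
  have := itin_size_le adm 1 SQ r0 rt t1 FD; rewrite expr1.
  rewrite (_ : [set w | (1 <= size _)%N] = ~` [set w | itin r t w = [::]])//.
  by apply/seteqP; split=> w /=; case: (itin r t w).
have h3 : 0 <= K * (t - r) ^+ 2 by rewrite mulr_ge0// exprn_ge0.
have h4 : 0 <= 2 * (M * (t - r)) by rewrite !mulr_ge0.
apply: le_trans (lerD (ler_wpM2l h3 h1) (ler_wpM2l h4 h2)) _.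
by rewrite le_eqVlt; apply/orP; left; apply/eqP; ring.
Qed.

(** Being at z at time t without having stayed there takes two jumps. *)
Lemma local_nil z : exists2 K : R, 0 <= K & forall Q r t D,
  solves j Q -> 0 <= r -> r <= t -> t <= 1 -> Ft r D ->
  D `<=` [set w | canproc r w = z] ->
  `|pr Q (D `&` [set w | itin r t w = [::]])
    - (1 - (t - r) * jbar A j r z) * pr Q D| <= K * (t - r) ^+ 2 * pr Q D.
Proof.
have [K K0 HK] := local_state z z.
exists (K + M ^+ 2) => [|Q r t D SQ r0 rt t1 FD Dz].
  by rewrite addr_ge0// exprn_ge0// (M_ge0 adm).
have t0 : 0 <= t by exact: le_trans rt.
have FDt := Ft_mono rt FD.
have := HK Q r t D SQ r0 rt t1 FD Dz.
have -> : D `&` [set w | canproc r w = z] = D by apply: setIidl.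
rewrite /gen_coef eqxx.
have : 0 <= pr Q (D `&` [set w | canproc t w = z])
    - pr Q (D `&` [set w | itin r t w = [::]]) <= M ^+ 2 * (t - r) ^+ 2 * pr Q D.
  apply: (@pr_approx _ _ _ (D `&` jump_set r t 2)).
  - exact: Ft_measurable t1 (Ft_I FDt (Ft_itin_eq _ r0 rt t1)).
  - exact: Ft_measurable t1 (Ft_I FDt (Ft_at _ t0 (lexx t))).
  - exact: Ft_measurable t1 (Ft_I FDt (Ft_jump_set _ r0 rt t1)).
  - move=> w [Dw /= E]; split=> //=.
    by rewrite -(itin_nil r0 rt t1 E); exact: Dz.
  - move=> w [Dw /= tz]; rewrite /jump_set /=.
    case E : (itin r t w) => [|y [|y' l]]; [by left|exfalso|by right].
    by have := itin1_neq r0 rt t1 E; rewrite tz; apply; exact: Dz.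
  by rewrite -exprMn; exact: (itin_size_le adm 2 SQ r0 rt t1 FD).
by rewrite !ler_norml => /andP[? ?] /andP[? ?]; apply/andP; split; lra.
Qed.

(** Being at y at time t otherwise than by a jump from z takes two jumps. *)
Lemma local_one z y : exists2 K : R, 0 <= K & forall Q r t D,
  solves j Q -> 0 <= r -> r <= t -> t <= 1 -> Ft r D ->
  D `<=` [set w | canproc r w = z] ->
  `|pr Q (D `&` [set w | itin r t w = [:: y]])
    - (t - r) * arc_rate A j r z y * pr Q D| <= K * (t - r) ^+ 2 * pr Q D.
Proof.
have [K K0 HK] := local_state z y.
exists (K + M ^+ 2) => [|Q r t D SQ r0 rt t1 FD Dz].
  by rewrite addr_ge0// exprn_ge0// (M_ge0 adm).
have t0 : 0 <= t by exact: le_trans rt.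
have lastE (w : Omega R A) : itin r t w = [:: y] -> canproc t w = y.
  by move=> E; rewrite -(itin_last w r0 rt t1) E.
have [zy|zy] := eqVneq z y.
  have -> : D `&` [set w | itin r t w = [:: y]] = set0.
    apply/seteqP; split=> // w [Dw /= E].
    by have := itin1_neq r0 rt t1 E; rewrite (lastE w E) -zy; apply; exact: Dz.
  rewrite pr0 /arc_rate zy (negPf (adm_loopless adm y)) mulr0 mul0r subrr normr0.
  by rewrite mulr_ge0 ?pr_ge0// mulr_ge0 ?exprn_ge0 ?subr_ge0// addr_ge0// exprn_ge0// (M_ge0 adm).
have FDt := Ft_mono rt FD.
have := HK Q r t D SQ r0 rt t1 FD Dz.
have -> : D `&` [set w | canproc r w = y] = set0.
  apply/seteqP; split=> // w [Dw /= ry]; move/eqP: zy; apply.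
  by rewrite -ry; have /= -> := Dz _ Dw.
rewrite /gen_coef (negPf zy) pr0 subr0.
have : 0 <= pr Q (D `&` [set w | canproc t w = y])
    - pr Q (D `&` [set w | itin r t w = [:: y]]) <= M ^+ 2 * (t - r) ^+ 2 * pr Q D.
  apply: (@pr_approx _ _ _ (D `&` jump_set r t 2)).
  - exact: Ft_measurable t1 (Ft_I FDt (Ft_itin_eq _ r0 rt t1)).
  - exact: Ft_measurable t1 (Ft_I FDt (Ft_at _ t0 (lexx t))).
  - exact: Ft_measurable t1 (Ft_I FDt (Ft_jump_set _ r0 rt t1)).
  - by move=> w [Dw /= E]; split=> //=; exact: lastE.
  - move=> w [Dw /= ty]; rewrite /jump_set /=.
    case E : (itin r t w) => [|y' [|y'' l]]; [exfalso| |by right].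
      move/eqP : zy; apply; rewrite -ty -(itin_nil r0 rt t1 E).
      by have /= -> := Dz _ Dw.
    by left; split=> //=; rewrite -ty -(itin_last w r0 rt t1) E.
  by rewrite -exprMn; exact: (itin_size_le adm 2 SQ r0 rt t1 FD).
by rewrite !ler_norml => /andP[? ?] /andP[? ?]; apply/andP; split; lra.
Qed.

Lemma step_nil z : exists2 K : R, 0 <= K & forall Q s C a b,
  solves j Q -> 0 <= s -> s <= a -> a <= b -> b <= 1 -> Ft s C ->
  C `<=` [set w | canproc s w = z] ->
  `|pr Q (C `&` [set w | itin s b w = [::]])
    - (1 - (b - a) * jbar A j a z) * pr Q (C `&` [set w | itin s a w = [::]])|
  <= K * (b - a) ^+ 2 * pr Q C.
Proof.
have [K K0 HK] := local_nil z; exists K => // Q s C a b SQ s0 sa ab b1 FC Cz.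
have a0 : 0 <= a by exact: le_trans sa.
have a1 : a <= 1 by exact: le_trans b1.
have FD := Ft_I (Ft_mono sa FC) (Ft_itin_eq [::] s0 sa a1).
have Dz : C `&` [set w | itin s a w = [::]] `<=` [set w | canproc a w = z].
  by move=> w [Cw /= E]; rewrite /= -(itin_nil s0 sa a1 E); exact: Cz.
have := HK Q a b _ SQ a0 ab b1 FD Dz.
have -> : C `&` [set w | itin s a w = [::]] `&` [set w | itin a b w = [::]] =
    C `&` [set w | itin s b w = [::]].
  rewrite -setIA; congr (_ `&` _); apply/seteqP; split=> w /=.
    by case=> E1 E2; rewrite (itin_cat w sa ab) E1 E2.
  by rewrite (itin_cat w sa ab); case: (itin s a w) => //=.
move=> /le_trans; apply; rewrite ler_wpM2l ?mulr_ge0 ?exprn_ge0 ?subr_ge0//.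
apply: pr_le.
- exact: Ft_measurable a1 FD.
- exact: Ft_measurable (le_trans sa a1) FC.
exact: subIsetl.
Qed.

(** The itinerary p y of [s, b] is completed either before a, and then the walk stays
at y, or by a jump to y after time a; any other way takes two jumps in [a, b]. *)
Lemma step_rcons z p y : exists2 K : R, 0 <= K & forall Q s C a b,
  solves j Q -> 0 <= s -> s <= a -> a <= b -> b <= 1 -> Ft s C ->
  C `<=` [set w | canproc s w = z] ->
  `|pr Q (C `&` [set w | itin s b w = rcons p y])
    - (1 - (b - a) * jbar A j a y) * pr Q (C `&` [set w | itin s a w = rcons p y])
    - (b - a) * arc_rate A j a (last z p) y * pr Q (C `&` [set w | itin s a w = p])|
  <= K * (b - a) ^+ 2 * pr Q C.
Proof.
have [K1 K10 H1] := local_nil y; have [K2 K20 H2] := local_one (last z p) y.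
exists (K1 + K2 + M ^+ 2) => [|Q s C a b SQ s0 sa ab b1 FC Cz].
  by rewrite !addr_ge0// exprn_ge0// (M_ge0 adm).
have a0 : 0 <= a by exact: le_trans sa.
have a1 : a <= 1 by exact: le_trans b1.
have sb : s <= b by exact: le_trans ab.
have s1 : s <= 1 by exact: le_trans a1.
pose D1 := C `&` [set w | itin s a w = rcons p y].
pose D2 := C `&` [set w | itin s a w = p].
have FD1 : Ft a D1 := Ft_I (Ft_mono sa FC) (Ft_itin_eq (rcons p y) s0 sa a1).
have FD2 : Ft a D2 := Ft_I (Ft_mono sa FC) (Ft_itin_eq p s0 sa a1).
have D1y : D1 `<=` [set w | canproc a w = y].
  by move=> w [Cw /= E]; rewrite /= -(itin_last w s0 sa a1) E last_rcons.
have D2z : D2 `<=` [set w | canproc a w = last z p].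
  move=> w [Cw /= E]; rewrite /= -(itin_last w s0 sa a1) E.
  by have /= -> := Cz _ Cw.
have := H1 Q a b _ SQ a0 ab b1 FD1 D1y.
have := H2 Q a b _ SQ a0 ab b1 FD2 D2z.
have FE1 := Ft_I (Ft_mono ab FD1) (Ft_itin_eq [::] a0 ab b1).
have FE2 := Ft_I (Ft_mono ab FD2) (Ft_itin_eq [:: y] a0 ab b1).
have mC := Ft_measurable s1 FC.
have le1 : pr Q D1 <= pr Q C.
  by apply: (pr_le _ (Ft_measurable a1 FD1) mC); exact: subIsetl.
have le2 : pr Q D2 <= pr Q C.
  by apply: (pr_le _ (Ft_measurable a1 FD2) mC); exact: subIsetl.
have D12 : D1 `&` [set w | itin a b w = [::]] `&`
    (D2 `&` [set w | itin a b w = [:: y]]) = set0.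
  by apply/seteqP; split=> // w [[_ /= ->] [_]].
have := prU Q (Ft_measurable b1 FE1) (Ft_measurable b1 FE2) D12.
have : 0 <= pr Q (C `&` [set w | itin s b w = rcons p y])
    - pr Q (D1 `&` [set w | itin a b w = [::]] `|`
            D2 `&` [set w | itin a b w = [:: y]])
    <= M ^+ 2 * (b - a) ^+ 2 * pr Q C.
  apply: (@pr_approx _ _ _ (C `&` jump_set a b 2)).
  - exact: measurableU (Ft_measurable b1 FE1) (Ft_measurable b1 FE2).
  - exact: Ft_measurable b1 (Ft_I (Ft_mono sb FC) (Ft_itin_eq _ s0 sb b1)).
  - exact: Ft_measurable b1 (Ft_I (Ft_mono sb FC) (Ft_jump_set _ a0 ab b1)).
  - move=> w [[[Cw /= E1] E2]|[[Cw /= E1] E2]]; split=> //=.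
      by rewrite (itin_cat w sa ab) E1 E2 cats0.
    by rewrite (itin_cat w sa ab) E1 E2 cats1.
  - move=> w [Cw /=]; rewrite (itin_cat w sa ab) /jump_set /D1 /D2 /=.
    case E : (itin a b w) => [|y1 [|y2 l]]; last by right.
      by rewrite cats0 => E'; left; left.
    rewrite cats1 => /eqP; rewrite eqseq_rcons => /andP[/eqP -> /eqP ->].
    by left; right.
  rewrite -exprMn.
  exact: (itin_size_le adm 2 SQ a0 ab b1 (Ft_mono sa FC)).
have d2 : 0 <= (b - a) ^+ 2 by rewrite exprn_ge0// subr_ge0.
have l1 : K1 * (b - a) ^+ 2 * pr Q D1 <= K1 * (b - a) ^+ 2 * pr Q C.
  by rewrite ler_wpM2l// mulr_ge0.
have l2 : K2 * (b - a) ^+ 2 * pr Q D2 <= K2 * (b - a) ^+ 2 * pr Q C.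
  by rewrite ler_wpM2l// mulr_ge0.
rewrite !ler_norml => /andP[? ?] ? /andP[? ?] /andP[? ?]; apply/andP; split; lra.
Qed.

End expansion.

(** * Markov property for itineraries *)

Section telescoping.
Context {R : realType}.
Implicit Types (s t a b h x B K : R) (n : nat).

(** Subdividing [s, t] into n intervals, the quadratic errors add up to K (t - s)^2 / n. *)
Lemma telescope (F : R -> R) s t B K (d0 : R) : s <= t -> 0 <= K -> 0 < d0 ->
  (forall a b, s <= a -> a <= b -> b <= t -> b - a <= d0 ->
     F b - F a <= (b - a) * B + K * (b - a) ^+ 2) ->
  F t - F s <= (t - s) * B.
Proof.
move=> st K0 d00 HF; apply/ler_addgt0Pr => e e0.
pose T := t - s; have T0 : 0 <= T by rewrite subr_ge0.
(* This n makes the mesh smaller than d0 and the total error smaller than e. *)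
pose n := maxn (Num.truncn (T / d0)) (Num.truncn (K * T ^+ 2 / e)).
pose h := T / n.+1%:R.
have nE : n.+1%:R * h = T by rewrite mulrC divfK// pnatr_eq0.
have h0 : 0 <= h by rewrite divr_ge0.
have hd : h <= d0.
  rewrite ler_pdivrMr// mulrC -ler_pdivrMr// ltW// (lt_le_trans (truncnS_gt _))//.
  by rewrite ler_nat ltnS leq_maxl.
have He : K * T * h <= e.
  rewrite mulrA ler_pdivrMr// [e * _]mulrC -ler_pdivrMr// -mulrA -expr2 ltW//.
  by rewrite (lt_le_trans (truncnS_gt _))// ler_nat ltnS leq_maxr.
have H k : (k <= n.+1)%N -> F (s + k%:R * h) - F s <= k%:R * (h * B + K * h ^+ 2).
  elim: k => [|k IH] kn; first by rewrite !mul0r addr0 subrr.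
  have kE : s + k.+1%:R * h = s + k%:R * h + h by rewrite -natr1; ring.
  have kh0 : 0 <= k%:R * h by rewrite mulr_ge0.
  have kT : k.+1%:R * h <= T by rewrite -nE ler_wpM2r// ler_nat.
  have := IH (ltnW kn).
  have := HF (s + k%:R * h) (s + k.+1%:R * h).
  have -> : s + k.+1%:R * h - (s + k%:R * h) = h by rewrite kE; ring.
  rewrite kE; move: kT; rewrite -natr1 mulrDl mul1r => kT.
  have tT : t = s + T by rewrite /T; ring.
  move=> /(_ _ _ _ hd) H1 H2.
  have := H1 ltac:(lra) ltac:(lra) ltac:(lra).
  by lra.
have sT : s + T = t by rewrite /T addrC subrK.
have := H n.+1 (leqnn _); rewrite nE sT => /le_trans; apply.
have -> : n.+1%:R * (h * B + K * h ^+ 2) =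
    n.+1%:R * h * B + K * (n.+1%:R * h) * h by ring.
by rewrite nE lerD2l.
Qed.

Lemma telescope_abs (F : R -> R) s t B K : s <= t -> 0 <= K ->
  (forall a b, s <= a -> a <= b -> b <= t ->
     `|F b - F a| <= (b - a) * B + K * (b - a) ^+ 2) ->
  `|F t - F s| <= (t - s) * B.
Proof.
move=> st K0 HF; rewrite ler_norml; apply/andP; split.
  rewrite lerNl opprB.
  have := @telescope (fun a => - F a) s t B K 1 st K0 ltr01.
  rewrite opprK addrC; apply => a b sa ab bt _.
  rewrite opprK addrC -[leLHS]opprB.
  by have := HF a b sa ab bt; rewrite ler_norml => /andP[]; lra.
apply: (@telescope F s t B K 1 st K0 ltr01) => a b sa ab bt _.
by have := HF a b sa ab bt; rewrite ler_norml => /andP[].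
Qed.

(** A discrete Gronwall inequality: the equation d' = - c d has no other solution
started at 0. *)
Lemma linear_uniq (d c : R -> R) s t K M : s <= t -> 0 <= K -> 0 <= M ->
  d s = 0 -> (forall a, s <= a -> a <= t -> 0 <= c a <= M) ->
  (forall a b, s <= a -> a <= b -> b <= t ->
    `|d b - (1 - (b - a) * c a) * d a| <= K * (b - a) ^+ 2) ->
  d t = 0.
Proof.
move=> st K0 M0 ds cM Hd; apply/eqP; rewrite -normr_eq0 eq_le normr_ge0 andbT.
have M1 : 0 < M + 1 by lra.
suff : `|d t| - `|d s| <= (t - s) * 0 by rewrite ds normr0; lra.
apply: (@telescope (fun a => `|d a|) s t 0 K (M + 1)^-1) => //.
  by rewrite invr_gt0.
move=> a b sa ab bt; rewrite -[_^-1]mul1r ler_pdivlMr// => abM.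
have /andP[c0 c1] := cM a sa (le_trans ab bt).
have ba0 : 0 <= b - a by rewrite subr_ge0.
have bc0 : 0 <= (b - a) * c a by rewrite mulr_ge0.
have bc1 : (b - a) * c a <= 1.
  apply: le_trans abM; rewrite ler_wpM2l//; lra.
have := ler_normD (d b - (1 - (b - a) * c a) * d a) ((1 - (b - a) * c a) * d a).
have n1 : `|1 - (b - a) * c a| = 1 - (b - a) * c a.
  by rewrite ger0_norm// subr_ge0.
rewrite subrK normrM n1.
have := Hd a b sa ab bt.
have : (1 - (b - a) * c a) * `|d a| <= `|d a|.
  by rewrite ler_piMl//; lra.
by rewrite mulr0 add0r; lra.
Qed.

Lemma pow_incr a b n : 0 <= a -> a <= b -> b <= 1 ->
  0 <= b ^+ n.+1 - a ^+ n.+1 - n.+1%:R * ((b - a) * a ^+ n)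
    <= n.+1%:R ^+ 2 * (b - a) ^+ 2.
Proof.
move=> a0 ab b1; have a1 := le_trans ab b1; have b0 := le_trans a0 ab.
elim: n => [|n /andP[IH0 IH1]].
  rewrite !expr1 expr0 mulr1 !mul1r subrr lexx expr1n mul1r.
  by rewrite exprn_ge0// subr_ge0.
set e := b ^+ n.+1 - _ - _ in IH0 IH1.
have -> : b ^+ n.+2 - a ^+ n.+2 - n.+2%:R * ((b - a) * a ^+ n.+1) =
    n.+1%:R * ((b - a) ^+ 2 * a ^+ n) + b * e.
  by rewrite /e !exprS -[n.+2%:R]natr1; ring.
have h1 : 0 <= (b - a) ^+ 2 by rewrite exprn_ge0// subr_ge0.
have h2 : 0 <= a ^+ n <= 1 by rewrite exprn_ge0// exprn_ile1.
have /andP[h20 h21] := h2.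
have h3 : 0 <= n.+1%:R * ((b - a) ^+ 2 * a ^+ n).
  by rewrite mulr_ge0// mulr_ge0.
have h4 : 0 <= b * e by rewrite mulr_ge0.
apply/andP; split; first exact: addr_ge0.
apply: (@le_trans _ _ (n.+1%:R * (b - a) ^+ 2 + n.+1%:R ^+ 2 * (b - a) ^+ 2)).
  apply: lerD; first by rewrite ler_wpM2l// ler_piMr.
  by apply: le_trans IH1; rewrite ler_piMl.
rewrite -mulrDl ler_wpM2r// -[n.+2%:R]natr1.
have : 0 <= n.+1%:R :> R by [].
by move: (n.+1%:R : R) => x x0; nra.
Qed.

Lemma normr_cross_le (m m' c x x' : R) : 0 <= m <= 1 -> 0 <= m' <= 1 -> 0 <= c ->
  `|x| <= c * m -> `|x'| <= c * m' -> `|x * m' - x' * m| <= 2 * c.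
Proof.
move=> /andP[m0 m1] /andP[m'0 m'1] c0 xm xm'.
apply: le_trans (ler_normB _ _) _; rewrite !normrM (ger0_norm m0) (ger0_norm m'0).
have h1 : `|x| * m' <= c * m * m' by rewrite ler_wpM2r.
have h2 : `|x'| * m <= c * m' * m by rewrite ler_wpM2r.
have : m * m' <= 1 by rewrite mulr_ile1.
move=> h3; have : c * (m * m') <= c by rewrite ler_piMr.
lra.
Qed.

Lemma window t h : 0 <= t -> 0 < h -> t + h < 1 ->
  [/\ 0 <= t, t < t + h & t + h <= 1].
Proof. by move=> t0 h0 th1; split; lra. Qed.

Lemma half_window t h : 0 <= t -> 0 < h -> t + h < 1 ->
  [/\ t <= t + h / 2, t + h / 2 <= t + h, t + h / 2 <= 1 & 0 <= t + h / 2].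
Proof. by move=> t0 h0 th1; split; lra. Qed.

Lemma div_le x n : 0 <= x -> x / n.+1%:R <= x.
Proof. by move=> x0; rewrite ler_pdivrMr// ler_peMr// ler1n. Qed.

End telescoping.

Section kernel.
Context {R : realType} {X : pointedType}.
Variables (A : rel X) (j : R -> X -> X -> R) (M : R).
Hypothesis adm : admissible A j M.
Let X_countable := adm_countable adm.
Implicit Types (r s t : R) (x y z : X) (p : seq X) (C D E G : set (Omega R A)).
Implicit Types (Q : probability (path_space R A) R).

Lemma Ft_pr_le1 Q s C : s <= 1 -> Ft s C -> 0 <= pr Q C <= 1.
Proof.
by move=> s1 FC; rewrite pr_ge0 (pr_le1 Q (Ft_measurable s1 FC)).
Qed.

(** Both sides, as functions of t, solve the same linear equation, by induction on
the last vertex of p. The two walks and the two events of the past are arbitrary: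
this is the Markov property, together with the independence of the law of the
future from the initial vertex. *)
Lemma itin_uniq Q Q' s t z C C' p : solves j Q -> solves j Q' ->
  0 <= s -> s <= t -> t <= 1 -> Ft s C -> Ft s C' ->
  C `<=` [set w | canproc s w = z] -> C' `<=` [set w | canproc s w = z] ->
  pr Q (C `&` [set w | itin s t w = p]) * pr Q' C' =
  pr Q' (C' `&` [set w | itin s t w = p]) * pr Q C.
Proof.
move=> SQ SQ' s0 st t1 FC FC' Cz C'z; have s1 := le_trans st t1.
have mC := Ft_pr_le1 Q s1 FC; have mC' := Ft_pr_le1 Q' s1 FC'.
elim/last_ind: p t st t1 => [|p y IH] t st t1.
  have [K K0 HK] := step_nil adm z.
  apply/eqP; rewrite -subr_eq0; apply/eqP.
  pose d a := pr Q (C `&` [set w | itin s a w = [::]]) * pr Q' C' -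
    pr Q' (C' `&` [set w | itin s a w = [::]]) * pr Q C.
  apply: (@linear_uniq _ d (fun a => jbar A j a z) s t (2 * K) M) => //.
  - exact: mulr_ge0.
  - exact: M_ge0 adm.
  - rewrite /d; have E : [set w | itin s s w = [::]] = [set: Omega R A].
      by apply/seteqP; split=> w //= _; exact: itinxx.
    by rewrite E !setIT mulrC subrr.
  - move=> a sa at_; have a01 : 0 <= a <= 1 by apply/andP; split; lra.
    by rewrite (jbar_ge0 adm)// (adm_jbar adm).
  move=> a b sa ab bt; have b1 := le_trans bt t1.
  have H := HK Q s C a b SQ s0 sa ab b1 FC Cz.
  have H' := HK Q' s C' a b SQ' s0 sa ab b1 FC' C'z.
  have c0 : 0 <= K * (b - a) ^+ 2 by rewrite mulr_ge0// exprn_ge0// subr_ge0.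
  have := normr_cross_le mC mC' c0 H H'.
  by rewrite -[2 * K * _]mulrA; congr (`|_| <= _); rewrite /d; ring.
have [K K0 HK] := step_rcons adm z p y.
apply/eqP; rewrite -subr_eq0; apply/eqP.
pose d a := pr Q (C `&` [set w | itin s a w = rcons p y]) * pr Q' C' -
  pr Q' (C' `&` [set w | itin s a w = rcons p y]) * pr Q C.
apply: (@linear_uniq _ d (fun a => jbar A j a y) s t (2 * K) M) => //.
- exact: mulr_ge0.
- exact: M_ge0 adm.
- rewrite /d; have E : [set w | itin s s w = rcons p y] = set0 :> set (Omega R A).
    by apply/seteqP; split=> w //=; rewrite itinxx => /(congr1 size); rewrite size_rcons.
  by rewrite E !setI0 !pr0 !mul0r subrr.
- move=> a sa at_; have a01 : 0 <= a <= 1 by apply/andP; split; lra.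
  by rewrite (jbar_ge0 adm)// (adm_jbar adm).
move=> a b sa ab bt; have b1 := le_trans bt t1.
have H := HK Q s C a b SQ s0 sa ab b1 FC Cz.
have H' := HK Q' s C' a b SQ' s0 sa ab b1 FC' C'z.
have c0 : 0 <= K * (b - a) ^+ 2 by rewrite mulr_ge0// exprn_ge0// subr_ge0.
have := normr_cross_le mC mC' c0 H H'.
have := IH a sa (le_trans ab b1); rewrite -[2 * K * _]mulrA /d.
set u := pr Q (C `&` [set w | itin s a w = p]).
set u' := pr Q' (C' `&` [set w | itin s a w = p]) => uu'.
set v := arc_rate _ _ _ _ _; move=> Hd; apply: le_trans Hd.
rewrite le_eqVlt; apply/orP; left; apply/eqP; congr `|_|.
apply/eqP; rewrite -subr_eq0; apply/eqP.
transitivity ((b - a) * v * (u * pr Q' C' - u' * pr Q C)); first by ring.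
by rewrite uu' subrr mulr0.
Qed.

(** Summing over the itineraries that lead from z to y. *)
Lemma state_uniq Q Q' s t z C C' y : solves j Q -> solves j Q' ->
  0 <= s -> s <= t -> t <= 1 -> Ft s C -> Ft s C' ->
  C `<=` [set w | canproc s w = z] -> C' `<=` [set w | canproc s w = z] ->
  pr Q (C `&` [set w | canproc t w = y]) * pr Q' C' =
  pr Q' (C' `&` [set w | canproc t w = y]) * pr Q C.
Proof.
move=> SQ SQ' s0 st t1 FC FC' Cz C'z.
have t0 : 0 <= t by exact: le_trans st.
rewrite mulrC [RHS]mulrC.
apply: (@pr_split_eq _ _ (path_space R A) _ (countable_seq X_countable)
  (itin s t : path_space R A -> seq X)).
- by move=> p; exact: (Ft_measurable t1 (Ft_itin_eq adm p s0 st t1)).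
- exact: pr_ge0.
- exact: pr_ge0.
- exact: (Ft_measurable t1 (Ft_I (Ft_mono st FC) (Ft_at y t0 (lexx t)))).
- exact: (Ft_measurable t1 (Ft_I (Ft_mono st FC') (Ft_at y t0 (lexx t)))).
move=> p; rewrite mulrC [RHS]mulrC.
have E D : D `<=` [set w | canproc s w = z] ->
    D `&` [set w | canproc t w = y] `&` itin s t @^-1` [set p] =
    if last z p == y then D `&` [set w | itin s t w = p] else set0.
  move=> Dz; apply/seteqP; split=> [w [[Dw /= ty] ip]|w].
    by rewrite -(Dz _ Dw) -ip (itin_last w s0 st t1) ty eqxx.
  case: eqP => //= ly [Dw ip]; split=> //; split=> //.
  by rewrite /= -(itin_last w s0 st t1) ip (Dz _ Dw).
rewrite !E//; case: ifP => _; last by rewrite !pr0 !mul0r.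
exact: (itin_uniq p SQ SQ' s0 st t1 FC FC' Cz C'z).
Qed.

(** c is the conditional probability of G given that the walk is at z at time s,
whatever the walk and its past. *)
Definition future_prob s z G (c : R) := forall Q C, solves j Q -> Ft s C ->
  C `<=` [set w | canproc s w = z] -> pr Q (C `&` G) = c * pr Q C.

(** The event G1 joins the past of t. *)
Lemma future_prob_comp s t z y G1 G c1 c2 : s <= t -> Ft t G1 ->
  [set w | canproc s w = z] `&` G1 `<=` [set w | canproc t w = y] ->
  future_prob s z G1 c1 -> future_prob t y G c2 -> future_prob s z (G1 `&` G) (c2 * c1).
Proof.
move=> st FG1 G1y H1 H2 Q C SQ FC Cz.
rewrite setIA H2//; last 2 first.
- exact: Ft_I (Ft_mono st FC) FG1.
- by move=> w [Cw Gw]; apply: G1y; split=> //; exact: Cz.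
by rewrite H1// mulrA.
Qed.

Lemma future_prob_comp_itin s t z p G c1 c2 : 0 <= s -> s <= t -> t <= 1 ->
  future_prob s z [set w | itin s t w = p] c1 -> future_prob t (last z p) G c2 ->
  future_prob s z ([set w | itin s t w = p] `&` G) (c2 * c1).
Proof.
move=> s0 st t1; apply: future_prob_comp => //; first exact: (Ft_itin_eq adm).
by move=> w [/= sz <-]; rewrite /= -(itin_last w s0 st t1) sz.
Qed.

(** The interval is cut into cells of length h with M h < 1: the walk jumps in one of
them with probability at most M h < 1, whatever the past. *)
Lemma stay_gt0 Q r t D : solves j Q -> 0 <= r -> r <= t -> t <= 1 -> Ft r D ->
  0 < pr Q D -> 0 < pr Q (D `&` [set w | itin r t w = [::]]).
Proof.
move=> SQ r0 rt t1 FD D0; have M0 := M_ge0 adm.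
pose n := Num.truncn (M * (t - r)); pose h := (t - r) / n.+1%:R.
have h0 : 0 <= h by rewrite divr_ge0// subr_ge0.
have nE : n.+1%:R * h = t - r by rewrite mulrC divfK// pnatr_eq0.
have Mh : M * h < 1.
  by rewrite mulrA ltr_pdivrMr// mul1r truncnS_gt.
suff : forall k, (k <= n.+1)%N ->
    0 < pr Q (D `&` [set w | itin r (r + k%:R * h) w = [::]]).
  by move/(_ n.+1 (leqnn _)); rewrite nE addrC subrK.
elim=> [|k IH] kn.
  rewrite mul0r addr0 (_ : [set w | _] = setT) ?setIT//.
  by apply/seteqP; split=> w //= _; exact: itinxx.
have kE : r + k.+1%:R * h = r + k%:R * h + h by rewrite -natr1; ring.
have kh0 : 0 <= k%:R * h by rewrite mulr_ge0.
have k1t : r + k.+1%:R * h <= t.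
  by rewrite -lerBrDl -nE ler_wpM2r// ler_nat.
set a := r + k%:R * h in kE IH; set b := r + _ in kE k1t *.
have ra : r <= a by rewrite lerDl.
have ab : a <= b by rewrite kE lerDl.
have b1 : b <= 1 by exact: le_trans t1.
have a0 : 0 <= a by exact: le_trans ra.
have FE := Ft_I (Ft_mono ra FD) (Ft_itin_eq adm [::] r0 ra (le_trans ab b1)).
have := itin_size_le adm 1 SQ a0 ab b1 FE; rewrite expr1.
set E := D `&` _ in FE *.
have mE := Ft_measurable (le_trans ab b1) FE.
have FN := Ft_itin_eq adm [::] a0 ab b1.
have := prID Q mE (Ft_measurable b1 FN).
have -> : E `&` [set w | itin a b w = [::]] = D `&` [set w | itin r b w = [::]].
  rewrite /E -setIA; congr (_ `&` _); apply/seteqP; split=> w /=.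
    by case=> E1 E2; rewrite (itin_cat w ra ab) E1 E2.
  by rewrite (itin_cat w ra ab); case: (itin r a w) => //=.
have -> : ~` [set w : Omega R A | itin a b w = [::]] = [set w | (1 <= size (itin a b w))%N].
  by apply/seteqP; split=> w /=; case: (itin a b w).
have := IH (ltnW kn); rewrite -/E kE [a + h]addrC addrK => E0 EE.
move=> h1; have : M * h * pr Q E < pr Q E by rewrite gtr_pMl.
by move: EE h1 E0; lra.
Qed.

Variable Rx : X -> probability (path_space R A) R.
Hypothesis Rx_walk : forall x, markov_walk j x (Rx x).

Lemma Rx_solves x : solves j (Rx x).
Proof. by have [] := Rx_walk x. Qed.

Lemma Rx_start x : pr (Rx x) [set w | canproc 0 w = x] = 1.
Proof. by have [+ _] := Rx_walk x; rewrite /pr => ->. Qed.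

Lemma Rx_at_gt0 z s : 0 <= s <= 1 -> 0 < pr (Rx z) [set w | canproc s w = z].
Proof.
move=> /andP[s0 s1].
have := @stay_gt0 (Rx z) 0 s [set w | canproc 0 w = z] (@Rx_solves z) (lexx 0) s0 s1.
rewrite Rx_start => /(_ (Ft_at _ (lexx 0) (lexx 0)) ltr01) /lt_le_trans; apply.
apply: pr_le.
- apply: (Ft_measurable s1); apply: Ft_I; first exact: Ft_at.
  exact: (Ft_itin_eq adm).
- exact: (Ft_measurable s1 (Ft_at _ s0 (lexx s))).
by move=> w [/= <- /itin_nil E]; rewrite /= E.
Qed.

(** The walk started at z serves as a reference, since it is at z at time s with
positive probability. *)
Definition future_law s z G : R := pr (Rx z) ([set w | canproc s w = z] `&` G) /
  pr (Rx z) [set w | canproc s w = z].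

Lemma future_prob_itin s t z p : 0 <= s -> s <= t -> t <= 1 ->
  future_prob s z [set w | itin s t w = p] (future_law s z [set w | itin s t w = p]).
Proof.
move=> s0 st t1 Q C SQ FC Cz.
have s01 : 0 <= s <= 1 by rewrite s0 (le_trans st).
have n0 := lt0r_neq0 (Rx_at_gt0 z s01).
have := itin_uniq p SQ (@Rx_solves z) s0 st t1 FC (Ft_at z s0 (lexx s)) Cz (fun _ => id).
by move/(canRL (mulfK n0)) => ->; rewrite /future_law mulrAC.
Qed.

Lemma future_prob_at s t z y : 0 <= s -> s <= t -> t <= 1 ->
  future_prob s z [set w | canproc t w = y] (future_law s z [set w | canproc t w = y]).
Proof.
move=> s0 st t1 Q C SQ FC Cz.
have s01 : 0 <= s <= 1 by rewrite s0 (le_trans st).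
have n0 := lt0r_neq0 (Rx_at_gt0 z s01).
have := state_uniq y SQ (@Rx_solves z) s0 st t1 FC (Ft_at z s0 (lexx s)) Cz (fun _ => id).
by move/(canRL (mulfK n0)) => ->; rewrite /future_law mulrAC.
Qed.

End kernel.

(** * Positivity and expansion of the transition probabilities *)

Section positivity.
Context {R : realType} {X : pointedType}.
Variables (A : rel X) (j : R -> X -> X -> R) (M : R).
Hypothesis adm : admissible A j M.
Implicit Types (r s t : R) (x y z : X) (p : seq X) (C D E G : set (Omega R A)).
Implicit Types (Q : probability (path_space R A) R).

(** In a short enough time r - s, the linear term of [local_one] exceeds the quadratic
error. *)
Lemma jump_gt0 Q s t D z y : solves j Q -> 0 <= s -> s < t -> t <= 1 ->
  Ft s D -> D `<=` [set w | canproc s w = z] -> 0 < pr Q D -> A z y ->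
  exists2 r : R, s < r < t & 0 < pr Q (D `&` [set w | itin s r w = [:: y]]).
Proof.
move=> SQ s0 st t1 FD Dz D0 Azy.
have s01 : 0 <= s <= 1 by apply/andP; split; lra.
have [K K0 HK] := local_one adm z y.
have v0 : 0 < arc_rate A j s z y by rewrite /arc_rate Azy (adm_gt0 adm).
(* Then h < t - s and K h^2 < h v, where v is the intensity of the arc. *)
pose h := Num.min ((t - s) / 2) (arc_rate A j s z y / (K + 1)).
have K1 : 0 < K + 1 by lra.
have h0 : 0 < h by rewrite lt_min !divr_gt0// subr_gt0.
have hts : h <= (t - s) / 2 by rewrite ge_min lexx.
have hv : h <= arc_rate A j s z y / (K + 1) by rewrite ge_min lexx orbT.
have [sh sht sh1] : [/\ s <= s + h, s < s + h < t & s + h <= 1].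
  by split; [lra|apply/andP; split; lra|lra].
exists (s + h) => //.
have := HK Q s (s + h) D SQ s0 sh sh1 FD Dz; rewrite [s + h - s]addrAC subrr add0r.
rewrite ler_norml => /andP[+ _]; rewrite lerBrDr => /(lt_le_trans _); apply.
rewrite addrC -mulNr -mulrDl mulr_gt0//.
have -> : h * arc_rate A j s z y + - (K * h ^+ 2) = h * (arc_rate A j s z y - K * h) by ring.
rewrite mulr_gt0// subr_gt0.
have : h * (K + 1) <= arc_rate A j s z y by rewrite -ler_pdivlMr.
lra.
Qed.

(** Each arc but the last is performed quickly, which leaves time for the next ones. *)
Lemma walk_gt0 Q s t D z p : solves j Q -> 0 <= s -> s < t -> t <= 1 ->
  Ft s D -> D `<=` [set w | canproc s w = z] -> 0 < pr Q D -> path A z p ->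
  0 < pr Q (D `&` [set w | itin s t w = p]).
Proof.
elim: p s z D => [|y p IH] s z D SQ s0 st t1 FD Dz D0 /=.
  by move=> _; apply: (stay_gt0 adm) => //; exact: ltW.
move=> /andP[Azy yp].
have [r /andP[sr rt] Dr] := jump_gt0 SQ s0 st t1 FD Dz D0 Azy.
have [sr' rt' st'] : [/\ s <= r, r <= t & s <= t] by split; lra.
have r0 : 0 <= r by exact: le_trans sr'.
have r1 : r <= 1 by exact: le_trans t1.
have FDr := Ft_I (Ft_mono sr' FD) (Ft_itin_eq adm [:: y] s0 sr' r1).
have Dry : D `&` [set w | itin s r w = [:: y]] `<=` [set w | canproc r w = y].
  by move=> w [_ /= E]; rewrite /= -(itin_last w s0 sr' r1) E.
apply: lt_le_trans (IH r y _ SQ r0 rt t1 FDr Dry Dr yp) _.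
apply: pr_le.
- exact: (Ft_measurable t1 (Ft_I (Ft_mono rt' FDr) (Ft_itin_eq adm p r0 rt' t1))).
- exact: (Ft_measurable t1 (Ft_I (Ft_mono st' FD) (Ft_itin_eq adm _ s0 st' t1))).
move=> w [[Dw /= E1] E2]; split=> //=.
by rewrite (itin_cat w sr' rt') E1 E2.
Qed.

Lemma reach_gt0 Q s t D z y : connected_graph A -> solves j Q ->
  0 <= s -> s < t -> t <= 1 ->
  Ft s D -> D `<=` [set w | canproc s w = z] -> 0 < pr Q D ->
  0 < pr Q (D `&` [set w | canproc t w = y]).
Proof.
move=> con SQ s0 st t1 FD Dz D0.
have [p /andP[_ zp] py] := con z y.
have t0 : 0 <= t by lra.
have st' := ltW st.
apply: lt_le_trans (walk_gt0 SQ s0 st t1 FD Dz D0 zp) _.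
apply: pr_le.
- exact: (Ft_measurable t1 (Ft_I (Ft_mono st' FD) (Ft_itin_eq adm _ s0 st' t1))).
- exact: (Ft_measurable t1 (Ft_I (Ft_mono st' FD) (Ft_at y t0 (lexx t)))).
move=> w [Dw /= E]; split=> //=.
by rewrite -(itin_last w s0 st' t1) E (Dz _ Dw).
Qed.

End positivity.

Section asymptotics.
Context {R : realType} {X : pointedType}.
Variables (A : rel X) (j : R -> X -> X -> R) (M : R).
Hypothesis adm : admissible A j M.
Variable Rx : X -> probability (path_space R A) R.
Hypothesis Rx_walk : forall x, markov_walk j x (Rx x).
Implicit Types (r s t a b h e : R) (x y z : X) (p : seq X).

(** The probability of performing the walk p during [s, t], from z at time s. *)
Definition trans s t z p : R := future_law Rx s z [set w | itin s t w = p].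

Let m s z := pr (Rx z) [set w | canproc s w = z].

Let m_gt0 s z : 0 <= s <= 1 -> 0 < m s z.
Proof. exact: (Rx_at_gt0 adm Rx_walk). Qed.

Let transM s t z p : 0 <= s <= 1 ->
  pr (Rx z) ([set w | canproc s w = z] `&` [set w | itin s t w = p]) =
  trans s t z p * m s z.
Proof. by move=> s01; rewrite /trans /future_law divfK// lt0r_neq0// m_gt0. Qed.

Lemma trans_ge0 s t z p : 0 <= trans s t z p.
Proof. by rewrite divr_ge0// pr_ge0. Qed.

Lemma trans_size s t z p : 0 <= s -> s <= t -> t <= 1 ->
  trans s t z p <= (M * (t - s)) ^+ size p.
Proof.
move=> s0 st t1; have s1 := le_trans st t1.
rewrite ler_pdivrMr; last by apply: m_gt0; rewrite s0.
have FC := Ft_at (A := A) z s0 (lexx s).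
have := itin_size_le adm (size p) (Rx_solves Rx_walk z) s0 st t1 FC.
apply: le_trans; apply: pr_le.
- exact: (Ft_measurable t1 (Ft_I (Ft_mono st FC) (Ft_itin_eq adm _ s0 st t1))).
- exact: (Ft_measurable t1 (Ft_I (Ft_mono st FC) (Ft_jump_set adm _ s0 st t1))).
by move=> w [Cw /= ->].
Qed.

Lemma trans_le1 s t z p : 0 <= s -> s <= t -> t <= 1 -> trans s t z p <= 1.
Proof.
move=> s0 st t1; have s1 := le_trans st t1.
rewrite ler_pdivrMr ?mul1r; last by apply: m_gt0; rewrite s0.
have FC := Ft_at (A := A) z s0 (lexx s).
apply: pr_le.
- exact: (Ft_measurable t1 (Ft_I (Ft_mono st FC) (Ft_itin_eq adm _ s0 st t1))).
- exact: (Ft_measurable s1 FC).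
exact: subIsetl.
Qed.

Lemma trans_nil_ge s t z : 0 <= s -> s <= t -> t <= 1 ->
  1 - M * (t - s) <= trans s t z [::].
Proof.
move=> s0 st t1; have s1 := le_trans st t1.
have s01 : 0 <= s <= 1 by rewrite s0.
have FC := Ft_at (A := A) z s0 (lexx s).
have := itin_size_le adm 1 (Rx_solves Rx_walk z) s0 st t1 FC; rewrite expr1.
have := prID (Rx z) (Ft_measurable s1 FC)
  (Ft_measurable t1 (Ft_itin_eq adm [::] s0 st t1)).
have -> : ~` [set w : Omega R A | itin s t w = [::]] =
    [set w | (1 <= size (itin s t w))%N].
  by apply/seteqP; split=> w /=; case: (itin s t w).
rewrite transM// -/(m s z) => mE le1.
rewrite -(ler_pM2r (m_gt0 z s01)) mulrBl mul1r lerBlDr.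
by rewrite [leLHS]mE lerD2l.
Qed.

Lemma trans_gt0 s t z p : 0 <= s -> s < t -> t <= 1 -> path A z p ->
  0 < trans s t z p.
Proof.
move=> s0 st t1 zp; have s01 : 0 <= s <= 1 by apply/andP; split; lra.
rewrite divr_gt0//; last exact: m_gt0.
apply: (walk_gt0 adm (Rx_solves Rx_walk z) s0 st t1 _ _ _ zp) => //.
  exact: (Ft_at z s0 (lexx s)).
exact: m_gt0.
Qed.

Lemma trans_step_nil z : exists2 K : R, 0 <= K & forall s a b,
  0 <= s -> s <= a -> a <= b -> b <= 1 ->
  `|trans s b z [::] - (1 - (b - a) * jbar A j a z) * trans s a z [::]|
  <= K * (b - a) ^+ 2.
Proof.
have [K K0 HK] := step_nil adm z; exists K => // s a b s0 sa ab b1.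
have s01 : 0 <= s <= 1 by apply/andP; split; lra.
have := HK _ s _ a b (Rx_solves Rx_walk z) s0 sa ab b1
  (Ft_at z s0 (lexx s)) (fun _ => id).
rewrite !transM// mulrA -mulrBl normrM [X in _ * X <= _]gtr0_norm ?m_gt0//.
by rewrite ler_pM2r ?m_gt0.
Qed.

Lemma trans_step_rcons z p y : exists2 K : R, 0 <= K & forall s a b,
  0 <= s -> s <= a -> a <= b -> b <= 1 ->
  `|trans s b z (rcons p y) - (1 - (b - a) * jbar A j a y) * trans s a z (rcons p y)
    - (b - a) * arc_rate A j a (last z p) y * trans s a z p| <= K * (b - a) ^+ 2.
Proof.
have [K K0 HK] := step_rcons adm z p y; exists K => // s a b s0 sa ab b1.
have s01 : 0 <= s <= 1 by apply/andP; split; lra.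
have := HK _ s _ a b (Rx_solves Rx_walk z) s0 sa ab b1
  (Ft_at z s0 (lexx s)) (fun _ => id).
rewrite !transM// !mulrA -!mulrBl normrM [X in _ * X <= _]gtr0_norm ?m_gt0//.
by rewrite ler_pM2r ?m_gt0.
Qed.

Lemma transxx s z p : 0 <= s <= 1 -> trans s s z p = (p == [::])%:R.
Proof.
move=> s01; have [->|pN] := eqVneq p [::].
  rewrite /trans /future_law (_ : [set w | itin s s w = [::]] = setT).
    by rewrite setIT divff// lt0r_neq0// m_gt0.
  by apply/seteqP; split=> w //= _; exact: itinxx.
rewrite /trans /future_law (_ : [set w | itin s s w = p] = set0).
  by rewrite setI0 pr0 mul0r.
by apply/seteqP; split=> w //= /eqP; rewrite itinxx eq_sym (negPf pN).
Qed.

Lemma trans_nil_expand z : exists2 K : R, 0 <= K & forall s t,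
  0 <= s -> s <= t -> t <= 1 ->
  `|trans s t z [::] - (1 - (t - s) * jbar A j s z)| <= K * (t - s) ^+ 2.
Proof.
have [K K0 HK] := trans_step_nil z; exists K => // s t s0 st t1.
have s01 : 0 <= s <= 1 by apply/andP; split; lra.
by have := HK s s t s0 (lexx s) st t1; rewrite transxx// eqxx mulr1.
Qed.

Lemma trans_one_expand z y : exists2 K : R, 0 <= K & forall s t,
  0 <= s -> s <= t -> t <= 1 ->
  `|trans s t z [:: y] - (t - s) * arc_rate A j s z y| <= K * (t - s) ^+ 2.
Proof.
have [K K0 HK] := trans_step_rcons z [::] y; exists K => // s t s0 st t1.
have s01 : 0 <= s <= 1 by apply/andP; split; lra.
have := HK s s t s0 (lexx s) st t1.
by rewrite /= !transxx// mulr0 subr0 mulr1.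
Qed.

Fixpoint intensity t z p : R :=
  if p is y :: p' then arc_rate A j t z y * intensity t y p' else 1.

Lemma intensity_rcons t z p y :
  intensity t z (rcons p y) = intensity t z p * arc_rate A j t (last z p) y.
Proof. by elim: p z => [|x p IH] z /=; rewrite ?mul1r ?mulr1// IH mulrA. Qed.

Lemma intensity_ge0 t z p : 0 <= t <= 1 -> 0 <= intensity t z p.
Proof.
move=> t01; elim: p z => [|y p IH] z //=.
by rewrite mulr_ge0// (arc_rate_ge0 adm).
Qed.

(** Induction on the last arc: the derivative of the probability of p y in a is that
of p, of order (a - t)^n / n!, times the intensity of the last arc, up to terms of
order (a - t)^(n + 1), and integrating this derivative is the work of
[telescope_abs]. *)
Lemma trans_asympt t z p : 0 <= t < 1 -> forall e, 0 < e ->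
  exists2 d : R, 0 < d & forall h, 0 <= h -> h < d -> t + h <= 1 ->
    `|trans t (t + h) z p - intensity t z p * (h ^+ size p / (size p)`!%:R)|
      <= e * h ^+ size p.
Proof.
move=> /andP[t0 t1].
have t01 : 0 <= t <= 1 by apply/andP; split; lra.
have M0 := M_ge0 adm.
elim/last_ind: p => [|p y IH] e e0.
  exists (e / (M + 1)); first by rewrite divr_gt0// ltr_wpDl.
  move=> h h0 he th1; rewrite /= !expr0 fact0 divr1 !mulr1.
  have th : t <= t + h by rewrite lerDl.
  have := trans_nil_ge z t0 th th1; rewrite [t + h - t]addrAC subrr add0r => ge.
  rewrite distrC ger0_norm ?subr_ge0 ?trans_le1//.
  apply: (@le_trans _ _ (M * h)); first by rewrite lerBlDr addrC -lerBlDr.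
  apply: (@le_trans _ _ ((M + 1) * h)); first by rewrite ler_wpM2r// lerDl.
  by rewrite mulrC -ler_pdivlMr ?ltr_wpDl// ltW.
set n := size p in IH *; rewrite size_rcons -/n.
have [K K0 HK] := trans_step_rcons z p y.
have [L L0 HL] := arc_rate_lip adm (last z p) y.
pose c := intensity t z p; have c0 : 0 <= c by exact: intensity_ge0.
pose v := arc_rate A j t (last z p) y.
have v0 : 0 <= v by exact: (arc_rate_ge0 adm).
have M1 : 0 < M + 1 by lra.
(* The accuracy e1 for p contributes at most M e1 <= e / 2 to the derivative. *)
pose e1 := e / 2 / (M + 1); have e10 : 0 < e1 by rewrite !divr_gt0.
have [d1 d10 Hd1] := IH e1 e10.
(* C h bounds the other errors of the derivative: variation of the intensity of the
   last arc, and escape from y. *)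
pose C := L * c + M ^+ n.+2 + 1.
have Mn0 : 0 <= M ^+ n.+2 by exact: exprn_ge0.
have Lc0 : 0 <= L * c by exact: mulr_ge0.
have C0 : 0 < C by rewrite /C; lra.
exists (Num.min d1 (e / 2 / C)); first by rewrite lt_min d10 !divr_gt0.
move=> h h0; rewrite lt_min => /andP[hd1 hd2] th1.
have hC : C * h <= e / 2 by rewrite mulrC -ler_pdivlMr// ltW.
pose f u : R := c * v * ((u - t) ^+ n.+1 / n.+1`!%:R).
pose F a := trans t a z (rcons p y) - f a.
have Ft0 : F t = 0.
  rewrite /F /f transxx// subrr expr0n /= mul0r mulr0 subr0.
  by case: (rcons p y) (size_rcons p y).
have nfac : 0 < n`!%:R :> R by rewrite ltr0n fact_gt0.
have nfac1 : 1 <= n`!%:R :> R by rewrite ler1n fact_gt0.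
have Sfac : n.+1`!%:R = n.+1%:R * n`!%:R :> R by rewrite factS natrM.
have Sfac0 : 0 < n.+1`!%:R :> R by rewrite ltr0n fact_gt0.
rewrite intensity_rcons -/c -/v.
suff : `|F (t + h) - F t| <= (t + h - t) * (e * h ^+ n).
  rewrite Ft0 subr0 /F /f [t + h - t]addrAC subrr add0r.
  by rewrite [leRHS]mulrCA -exprS.
pose K' := K + c * v * n.+1%:R ^+ 2.
have cv0 : 0 <= c * v by exact: mulr_ge0.
apply: (@telescope_abs _ F t (t + h) _ K'); first by rewrite lerDl.
  by rewrite addr_ge0// mulr_ge0// exprn_ge0.
move=> a b ta ab bth; have b1 := le_trans bth th1.
have a01 : 0 <= a <= 1 by rewrite (le_trans t0 ta) (le_trans ab).
pose u := a - t; have u0 : 0 <= u by rewrite subr_ge0.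
have uh : u <= h by rewrite lerBlDl (le_trans ab).
have unhn : u ^+ n <= h ^+ n by rewrite lerXn2r.
have un0 : 0 <= u ^+ n by exact: exprn_ge0.
pose G := arc_rate A j a (last z p) y * trans t a z p
  - jbar A j a y * trans t a z (rcons p y) - c * v * (u ^+ n / n`!%:R).
have GB : `|G| <= e * h ^+ n.
  have G1 := Hd1 u u0 (le_lt_trans uh hd1).
  rewrite /u [t + (a - t)]addrC subrK in G1; have /andP[_ a1] := a01.
  have {}G1 := G1 a1; rewrite -/u -/c in G1.
  have G2 := HL t a t0 ta a1; rewrite -/v -/u in G2.
  have G3 := trans_size z (rcons p y) t0 ta a1; rewrite size_rcons -/n -/u in G3.
  have G4 := trans_ge0 t a z (rcons p y).
  have jM := arc_rate_le adm (last z p) y a01; have j0 := arc_rate_ge0 adm (last z p) y a01.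
  have bM := adm_jbar adm y a01; have b0 := jbar_ge0 adm y a01.
  have -> : G = arc_rate A j a (last z p) y * (trans t a z p - c * (u ^+ n / n`!%:R))
      + (arc_rate A j a (last z p) y - v) * (c * (u ^+ n / n`!%:R))
      - jbar A j a y * trans t a z (rcons p y) by rewrite /G; ring.
  apply: le_trans (ler_normB _ _) _.
  apply: le_trans (lerD (ler_normD _ _) (lexx _)) _.
  rewrite (normrM (arc_rate _ _ _ _ _)) (normrM (_ - v)) (normrM c) (normrM (jbar _ _ _ _)).
  rewrite (ger0_norm j0) (ger0_norm c0) (ger0_norm b0) (ger0_norm G4).
  have q0 : 0 <= u ^+ n / n`!%:R by rewrite divr_ge0// ltW.
  have q1 : u ^+ n / n`!%:R <= h ^+ n.
    by rewrite ler_pdivrMr//; apply: le_trans unhn _; rewrite ler_peMr// exprn_ge0.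
  rewrite (ger0_norm q0).
  have T1 : arc_rate A j a (last z p) y * `|trans t a z p - c * (u ^+ n / n`!%:R)|
      <= M * (e1 * h ^+ n).
    apply: ler_pM => //; apply: le_trans G1 _.
    by rewrite ler_wpM2l// ltW.
  have T2 : `|arc_rate A j a (last z p) y - v| * (c * (u ^+ n / n`!%:R))
      <= (L * h) * (c * h ^+ n).
    apply: ler_pM => //; first by rewrite mulr_ge0.
      by apply: le_trans G2 _; rewrite ler_wpM2l.
    by rewrite ler_wpM2l.
  have T3 : jbar A j a y * trans t a z (rcons p y) <= M * (M ^+ n.+1 * (h * h ^+ n)).
    apply: ler_pM => //; apply: le_trans G3 _; rewrite exprMn.
    by rewrite ler_wpM2l ?exprn_ge0// exprS ler_pM.
  apply: le_trans (lerD (lerD T1 T2) T3) _.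
  have -> : M * (e1 * h ^+ n) + L * h * (c * h ^+ n) +
      M * (M ^+ n.+1 * (h * h ^+ n)) =
      (M * e1 + (L * c + M ^+ n.+2) * h) * h ^+ n by rewrite [M ^+ n.+2]exprS; ring.
  rewrite ler_wpM2r ?exprn_ge0//.
  have : (M + 1) * e1 = e / 2 by rewrite mulrC divfK// lt0r_neq0.
  move=> Me1; rewrite [leRHS]splitr; apply: lerD.
    by rewrite -Me1 ler_wpM2r ?lerDl// ltW.
  by apply: le_trans hC; rewrite ler_wpM2r// lerDl.
have HK1 := HK t a b t0 ta ab b1.
pose g (u : R) : R := (u - t) ^+ n.+1.
have /andP[P1 P2] : 0 <= g b - g a - n.+1%:R * ((b - a) * u ^+ n)
    <= n.+1%:R ^+ 2 * (b - a) ^+ 2.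
  have := @pow_incr _ u (b - t) n u0; rewrite /g /u => H.
  have E : b - t - (a - t) = b - a by ring.
  have b1t : b - t <= 1 by rewrite lerBlDr (le_trans b1)// lerDl.
  by have := H (lerB ab (lexx t)) b1t; rewrite E.
set eg := g b - _ - _ in P1 P2.
have fE : f b - f a = (b - a) * (c * v * (u ^+ n / n`!%:R))
    + c * v * (eg / n.+1`!%:R).
  have alg (k g1 g2 d N w q : R) : N != 0 -> q != 0 ->
      k * (g1 / (N * q)) - k * (g2 / (N * q)) =
      d * (k * (w / q)) + k * ((g1 - g2 - N * (d * w)) / (N * q)).
    by move=> N0 q0; field; rewrite q0.
  by rewrite /f -/(g b) -/(g a) /eg Sfac; apply: alg; [rewrite pnatr_eq0|rewrite lt0r_neq0].
have eg0 : 0 <= eg / n.+1`!%:R <= n.+1%:R ^+ 2 * (b - a) ^+ 2.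
  apply/andP; split; first by apply: divr_ge0 => //; exact: ltW.
  rewrite ler_pdivrMr//; apply: le_trans P2 _.
  by rewrite ler_peMr ?ler1n ?fact_gt0// mulr_ge0// exprn_ge0// subr_ge0.
move: eg0; set q := eg / _ => /andP[q0 q1].
have cq0 : 0 <= c * v * q by rewrite mulr_ge0.
have cq1 : c * v * q <= c * v * (n.+1%:R ^+ 2 * (b - a) ^+ 2) by rewrite ler_wpM2l.
have -> : F b - F a = (b - a) * G
    + (trans t b z (rcons p y) - (1 - (b - a) * jbar A j a y) * trans t a z (rcons p y)
      - (b - a) * arc_rate A j a (last z p) y * trans t a z p) - c * v * q.
  have -> : F b - F a = trans t b z (rcons p y) - trans t a z (rcons p y) - (f b - f a).
    by rewrite /F; ring.
  by rewrite fE -/q /G; ring.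
apply: le_trans (ler_normB _ _) _.
apply: le_trans (lerD (ler_normD _ _) (lexx _)) _.
rewrite normrM (ger0_norm cq0) ger0_norm ?subr_ge0//.
have : (b - a) * `|G| <= (b - a) * (e * h ^+ n) by rewrite ler_wpM2l// subr_ge0.
have -> : K' * (b - a) ^+ 2 = K * (b - a) ^+ 2 + c * v * (n.+1%:R ^+ 2 * (b - a) ^+ 2).
  by rewrite /K'; ring.
by lra.
Qed.

End asymptotics.

(** * One jump at the second order *)

Section one_jump.
Context {R : realType} {X : pointedType}.
Variables (A : rel X) (j : R -> X -> X -> R) (M : R).
Hypothesis adm : admissible A j M.
Variable Rx : X -> probability (path_space R A) R.
Hypothesis Rx_walk : forall x, markov_walk j x (Rx x).
Implicit Types (r s a b h e : R).

Variables (t : R) (z y : X) (df : R).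
Hypothesis t01 : 0 <= t < 1.

Let v := arc_rate A j t z y.
Let outz := jbar A j t z.
Let outy := jbar A j t y.
Let kappa := df - outz * v - outy * v.

Hypothesis v_diff : forall e, 0 < e -> exists2 d : R, 0 < d & forall s,
  0 <= s <= 1 -> `|s - t| < d ->
  `|arc_rate A j s z y - v - df * (s - t)| <= e * `|s - t|.

(** The derivative of the probability in a is v(a) I(a) - jbar(a, y) J(a), where v is
the intensity of the arc and I, J are the probabilities of no jump and of this
jump; first order expansions of the four functions give the second order
coefficient kappa / 2. *)
Lemma trans_one_expand2 e : 0 < e ->
  exists2 d : R, 0 < d & forall h, 0 <= h -> h < d -> t + h <= 1 ->
    `|trans Rx t (t + h) z [:: y] - (h * v + h ^+ 2 / 2 * kappa)| <= e * h ^+ 2.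
Proof.
move=> e0; have /andP[t0 t1] := t01; have M0 := M_ge0 adm.
have t01' : 0 <= t <= 1 by rewrite t0 ltW.
have v0 : 0 <= v by exact: (arc_rate_ge0 adm).
have vM : v <= M by exact: (arc_rate_le adm).
have bz0 : 0 <= outz by exact: (jbar_ge0 adm).
have bzM : outz <= M by exact: (adm_jbar adm).
have by0 : 0 <= outy by exact: (jbar_ge0 adm).
have byM : outy <= M by exact: (adm_jbar adm).
have [d1 d10 Hd1] := v_diff (divr_gt0 e0 (ltr0n _ 2)).
have [K0 K00 HK0] := trans_nil_expand adm Rx_walk z.
have [K1 K10 HK1] := trans_one_expand adm Rx_walk z y.
have [K2 K20 HK2] := jbar_lip adm y.
have [K K_0 HK] := trans_step_rcons adm Rx_walk z [::] y.
(* C collects the products of a first order term by an error. *)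
pose C := M * K0 + `|df| * M + M * K1 + K2 * M + 1.
have C0 : 0 < C.
  by rewrite ltr_wpDl// !addr_ge0// mulr_ge0.
exists (Num.min 1 (Num.min d1 (e / 2 / C))).
  by rewrite !lt_min ltr01 d10 !divr_gt0.
move=> h h0; rewrite !lt_min => /and3P[h1 hd1 hd2] th1.
have hC : C * h <= e / 2 by rewrite mulrC -ler_pdivlMr// ltW.
pose f (s : R) := (s - t) * v + (s - t) ^+ 2 / 2 * kappa.
pose F s := trans Rx t s z [:: y] - f s.
have Ft0 : F t = 0.
  by rewrite /F /f (transxx adm Rx_walk)// subrr expr0n /= !mul0r addr0 subr0.
suff : `|F (t + h) - F t| <= (t + h - t) * (e * h).
  rewrite Ft0 subr0 /F /f [t + h - t]addrAC subrr add0r.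
  by rewrite [leRHS]mulrCA -expr2.
apply: (@telescope_abs _ F t (t + h) _ (K + `|kappa|)); first by rewrite lerDl.
  by rewrite addr_ge0.
move=> a b ta ab bth; have b1 := le_trans bth th1.
have a1 := le_trans ab b1.
have a01 : 0 <= a <= 1 by rewrite (le_trans t0 ta).
pose u := a - t; have u0 : 0 <= u by rewrite subr_ge0.
have uh : u <= h by rewrite lerBlDl (le_trans ab).
have u1 : u <= 1 by rewrite (le_trans uh) ?ltW.
have G1 := Hd1 a a01; rewrite -/u (ger0_norm u0) in G1.
have {}G1 := G1 (le_lt_trans uh hd1).
have G2 := HK0 t a t0 ta a1; rewrite -/u -/outz in G2.
have G3 := HK1 t a t0 ta a1; rewrite -/u -/v in G3.
have G4 := HK2 t a t0 ta a1; rewrite -/u -/outy in G4.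
have I0 := trans_ge0 Rx t a z [::].
have I1 := trans_le1 adm Rx_walk z [::] t0 ta a1.
have Ige := trans_nil_ge adm Rx_walk z t0 ta a1; rewrite -/u in Ige.
have J0 := trans_ge0 Rx t a z [:: y].
have := trans_size adm Rx_walk z [:: y] t0 ta a1; rewrite /= expr1 -/u => J1.
have HKab := HK t a b t0 ta ab b1; rewrite /= in HKab.
set I := trans Rx t a z [::] in G2 I0 I1 Ige HKab.
set J := trans Rx t a z [:: y] in G3 J0 J1 HKab *.
set va := arc_rate A j a z y in G1 HKab.
set ba := jbar A j a y in G4 HKab.
pose G := va * I - ba * J - v - kappa * u.
have GB : `|G| <= e * h.
  have -> : G = (va - v - df * u) * I + v * (I - (1 - u * outz))
      + df * u * (I - 1) - outy * (J - u * v) - (ba - outy) * J.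
    by rewrite /G /kappa; ring.
  have T1 : `|(va - v - df * u) * I| <= e / 2 * u.
    by rewrite normrM (ger0_norm I0); apply: le_trans G1; rewrite ler_piMr.
  have uu : u ^+ 2 <= u by rewrite expr2 ler_piMr.
  have T2 : `|v * (I - (1 - u * outz))| <= M * K0 * h * u.
    rewrite normrM (ger0_norm v0) -!mulrA; apply: ler_pM => //.
    apply: le_trans G2 _; rewrite ler_wpM2l// expr2; exact: ler_wpM2r.
  have T3 : `|df * u * (I - 1)| <= `|df| * M * h * u.
    rewrite !normrM (ger0_norm u0) mulrAC ler_wpM2r// -mulrA ler_wpM2l//.
    apply: (@le_trans _ _ (M * u)); last by rewrite ler_wpM2l.
    by rewrite distrC ger0_norm ?subr_ge0// lerBlDr addrC -lerBlDr.
  have T4 : `|outy * (J - u * v)| <= M * K1 * h * u.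
    rewrite normrM (ger0_norm by0) -!mulrA; apply: ler_pM => //.
    apply: le_trans G3 _; rewrite ler_wpM2l// expr2; exact: ler_wpM2r.
  have T5 : `|(ba - outy) * J| <= K2 * M * h * u.
    rewrite normrM (ger0_norm J0).
    have -> : K2 * M * h * u = K2 * u * (M * h) by ring.
    apply: ler_pM => //; apply: le_trans J1 _; exact: ler_wpM2l.
  have T : e / 2 * u + (M * K0 * h * u + `|df| * M * h * u + M * K1 * h * u
      + K2 * M * h * u) <= e * h.
    have -> : e / 2 * u + (M * K0 * h * u + `|df| * M * h * u + M * K1 * h * u
      + K2 * M * h * u) = (e / 2 + (C * h - h)) * u by rewrite /C; ring.
    apply: (@le_trans _ _ (e * u)); last by rewrite ler_wpM2l// ltW.
    rewrite ler_wpM2r// [leRHS]splitr lerD2l; apply: le_trans hC.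
    by rewrite gerBl.
  apply: le_trans T.
  have := ler_normD ((va - v - df * u) * I) (v * (I - (1 - u * outz))).
  set S1 := _ + v * _.
  have := ler_normD S1 (df * u * (I - 1)); set S2 := S1 + _.
  have := ler_normB S2 (outy * (J - u * v)); set S3 := S2 - _.
  have := ler_normB S3 ((ba - outy) * J).
  lra.
have -> : F b - F a = (b - a) * G + (trans Rx t b z [:: y]
    - (1 - (b - a) * ba) * J - (b - a) * va * I) - (b - a) ^+ 2 / 2 * kappa.
  by rewrite /F /f /G -/J /u; field.
apply: le_trans (ler_normB _ _) _.
apply: le_trans (lerD (ler_normD _ _) (lexx _)) _.
have d0 : 0 <= b - a by rewrite subr_ge0.
have d2 : 0 <= (b - a) ^+ 2 by rewrite exprn_ge0.
have : `|(b - a) ^+ 2 / 2 * kappa| <= `|kappa| * (b - a) ^+ 2.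
  by rewrite normrM ger0_norm ?divr_ge0// mulrC ler_wpM2l//; exact: (div_le 1).
have : `|(b - a) * G| <= (b - a) * (e * h).
  by rewrite normrM (ger0_norm d0) ler_wpM2l.
by move: HKab; lra.
Qed.

Hypothesis v_gt0 : 0 < v.

Let chi := df / v + outy - outz.

(** The quotient of the two probabilities is 1 / 2 - h chi / 8 up to o(h): in the
second order expansions, the terms in h^2 cancel because of the value of chi. *)
Lemma half_ratio e : 0 < e ->
  exists2 d : R, 0 < d & forall h, 0 < h -> h < d ->
    `|trans Rx (t + h / 2) (t + h) y [::] * trans Rx t (t + h / 2) z [:: y]
      - (1 / 2 - h / 8 * chi) * trans Rx t (t + h) z [:: y]|
      <= e * h * trans Rx t (t + h) z [:: y].
Proof.
move=> e0; have /andP[t0 t1] := t01.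
have t01' : 0 <= t <= 1 by rewrite t0 ltW.
have by0 : 0 <= outy by exact: (jbar_ge0 adm).
(* The denominator is at least h v / 2, and the errors n h^2 of the two second order
   expansions must be small with respect to e h times it. *)
pose n := e * v / 8; have n0 : 0 < n by rewrite divr_gt0// mulr_gt0.
have [d1 d10 Hd1] := trans_one_expand2 n0.
have [K0 K00 HK0] := trans_nil_expand adm Rx_walk y.
have [K2 K20 HK2] := jbar_lip adm y.
pose K := K0 + K2.
have K_0 : 0 <= K by exact: addr_ge0.
pose k := `|kappa|; have k0 : 0 <= k by exact: normr_ge0.
pose c := `|chi|; have c0 : 0 <= c by exact: normr_ge0.
(* C h^3 bounds the terms of order h^3 and more, and B h^2 the deviation of the
   denominator from h v. *)
pose C := v * K + k * outy + k * K + c * k + c * n + 1.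
have v0 := ltW v_gt0.
have C0 : 0 < C.
  by rewrite ltr_wpDl// !addr_ge0// mulr_ge0// ltW.
pose B := k + n; have B0 : 0 < B by rewrite ltr_wpDl.
exists (Num.min (1 - t) (Num.min d1 (Num.min (e * v / 4 / C) (v / 2 / B)))).
  by rewrite !lt_min subr_gt0 t1 d10 !divr_gt0// mulr_gt0.
move=> h h0; rewrite !lt_min => /and4P[ht hd1 hC hB].
have h1 : h <= 1 by rewrite (le_trans (ltW ht))// gerBl.
have th1 : t + h < 1 by rewrite addrC -ltrBrDr.
have [_ _ th1'] := window t0 h0 th1.
have [tw1 tw2 tw3 tw4] := half_window t0 h0 th1.
have {}hC : C * h <= e * v / 4 by rewrite mulrC -ler_pdivlMr// ltW.
have {}hB : B * h <= v / 2 by rewrite mulrC -ler_pdivlMr// ltW.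
have hh : 0 <= h / 2 by rewrite divr_ge0// ltW.
have hle : h / 2 <= h by exact: (div_le 1 (ltW h0)).
have hh2 : (h / 2) ^+ 2 <= h ^+ 2 by rewrite lerXn2r// nnegrE ltW.
have X1 := Hd1 (h / 2) hh (le_lt_trans hle hd1) tw3.
have X2 := Hd1 h (ltW h0) hd1 th1'.
have X3 := HK0 (t + h / 2) (t + h) tw4 tw2 th1'.
have X4 := HK2 t (t + h / 2) t0 tw1 tw3.
have Y0 := trans_ge0 Rx (t + h / 2) (t + h) y [::].
have Y1 := trans_le1 adm Rx_walk y [::] tw4 tw2 th1'.
rewrite (_ : t + h - (t + h / 2) = h / 2) in X3; last by field.
rewrite (_ : t + h / 2 - t = h / 2) in X4; last by ring.
set yy := trans Rx (t + h / 2) (t + h) y [::] in X3 Y0 Y1 *.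
set x := trans Rx t (t + h / 2) z [:: y] in X1 *.
set c2 := trans Rx t (t + h) z [:: y] in X2 *.
pose ea := x - (h / 2 * v + (h / 2) ^+ 2 / 2 * kappa).
pose ec := c2 - (h * v + h ^+ 2 / 2 * kappa).
pose eb := yy - (1 - h / 2 * outy).
have hp0 : 0 <= h ^+ 2 by rewrite exprn_ge0// ltW.
have Ea : `|ea| <= n * h ^+ 2.
  by apply: le_trans X1 _; rewrite ler_wpM2l ?(ltW n0).
have Eb : `|eb| <= K * h ^+ 2.
  have -> : eb = (yy - (1 - h / 2 * jbar A j (t + h / 2) y))
      - h / 2 * (jbar A j (t + h / 2) y - outy) by rewrite /eb; ring.
  apply: le_trans (ler_normB _ _) _.
  rewrite /K mulrDl; apply: lerD.
    by apply: le_trans X3 _; rewrite ler_wpM2l.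
  rewrite normrM (ger0_norm hh).
  apply: le_trans (ler_wpM2l hh X4) _.
  have -> : h / 2 * (K2 * (h / 2)) = K2 * h ^+ 2 / 4 by field.
  by apply: (div_le 3); rewrite mulr_ge0.
have c2B : h * v / 2 <= c2.
  have E : c2 = h * v + h ^+ 2 / 2 * kappa + ec by rewrite /ec; ring.
  have P1 : - (k * h ^+ 2) <= h ^+ 2 / 2 * kappa.
    have : `|h ^+ 2 / 2 * kappa| <= k * h ^+ 2.
      rewrite normrM ger0_norm; last by rewrite divr_ge0.
      by rewrite mulrC ler_wpM2l//; exact: (div_le 1).
    by rewrite ler_norml => /andP[].
  have P2 : - (n * h ^+ 2) <= ec by move: X2; rewrite ler_norml => /andP[].
  have P3 : B * h * h <= v / 2 * h by rewrite ler_wpM2r// ltW.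
  have : B * h * h = k * h ^+ 2 + n * h ^+ 2 by rewrite /B; ring.
  by rewrite E; lra.
have -> : yy * x - (1 / 2 - h / 8 * chi) * c2 =
    h / 2 * v * eb - h ^+ 3 / 16 * (kappa * outy) + h ^+ 2 / 8 * (kappa * eb) + ea * yy
    + h ^+ 3 / 16 * (chi * kappa) + h / 8 * (chi * ec) - ec / 2.
  have vchi : chi * v = df + outy * v - outz * v.
    by rewrite /chi; field; rewrite lt0r_neq0.
  have -> : x = h / 2 * v + (h / 2) ^+ 2 / 2 * kappa + ea by rewrite /ea; ring.
  have -> : c2 = h * v + h ^+ 2 / 2 * kappa + ec by rewrite /ec; ring.
  have -> : yy = 1 - h / 2 * outy + eb by rewrite /eb; ring.
  apply/eqP; rewrite -subr_eq0; apply/eqP.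
  (* All the terms of order at most 2 have cancelled but this one. *)
  transitivity (h ^+ 2 / 8 * (chi * v - (df + outy * v - outz * v))); last first.
    by rewrite vchi subrr mulr0.
  by rewrite /kappa; field.
have Ec : `|ec| <= n * h ^+ 2 by [].
have h3 : 0 <= h ^+ 3 by rewrite exprn_ge0// ltW.
have hh3 : h * h ^+ 2 = h ^+ 3 by rewrite -exprS.
have h23 : h ^+ 2 * h ^+ 2 <= h ^+ 3.
  have -> : h ^+ 2 * h ^+ 2 = h ^+ 3 * h by ring.
  by rewrite ler_piMr.
have T1 : `|h / 2 * v * eb| <= v * K * h ^+ 3.
  rewrite normrM ger0_norm; last by rewrite mulr_ge0.
  have -> : v * K * h ^+ 3 = h * v * (K * h ^+ 2) by ring.
  apply: ler_pM => //; first by rewrite mulr_ge0.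
  by rewrite ler_wpM2r.
have T2 : `|h ^+ 3 / 16 * (kappa * outy)| <= k * outy * h ^+ 3.
  rewrite normrM ger0_norm; last by rewrite divr_ge0.
  rewrite normrM (ger0_norm by0) mulrC ler_wpM2l ?mulr_ge0//.
  exact: (div_le 15).
have T3 : `|h ^+ 2 / 8 * (kappa * eb)| <= k * K * h ^+ 3.
  rewrite normrM ger0_norm; last by rewrite divr_ge0.
  rewrite normrM.
  apply: (@le_trans _ _ (h ^+ 2 * (k * (K * h ^+ 2)))).
    apply: ler_pM; [by rewrite divr_ge0|by rewrite mulr_ge0| |by rewrite ler_wpM2l].
    exact: (div_le 7).
  have -> : h ^+ 2 * (k * (K * h ^+ 2)) = k * K * (h ^+ 2 * h ^+ 2) by ring.
  by rewrite ler_wpM2l// mulr_ge0.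
have T4 : `|ea * yy| <= n * h ^+ 2.
  by rewrite normrM (ger0_norm Y0); apply: le_trans Ea; rewrite ler_piMr.
have T5 : `|h ^+ 3 / 16 * (chi * kappa)| <= c * k * h ^+ 3.
  rewrite normrM ger0_norm; last by rewrite divr_ge0.
  rewrite normrM mulrC ler_wpM2l ?mulr_ge0//; exact: (div_le 15).
have T6 : `|h / 8 * (chi * ec)| <= c * n * h ^+ 3.
  rewrite normrM ger0_norm; last by rewrite divr_ge0// ltW.
  rewrite normrM.
  have -> : c * n * h ^+ 3 = h * (c * (n * h ^+ 2)) by ring.
  apply: ler_pM; [by rewrite divr_ge0// ltW|by rewrite mulr_ge0| |by rewrite ler_wpM2l].
  exact: (div_le 7 (ltW h0)).
have T7 : `|ec / 2| <= n * h ^+ 2.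
  rewrite normrM [X in _ * X]ger0_norm; last by rewrite invr_ge0.
  exact: le_trans (div_le 1 (normr_ge0 ec)) Ec.
have T : v * K * h ^+ 3 + k * outy * h ^+ 3 + k * K * h ^+ 3 + n * h ^+ 2
    + c * k * h ^+ 3 + c * n * h ^+ 3 + n * h ^+ 2 <= e * h * c2.
  apply: (@le_trans _ _ (C * h * h ^+ 2 + 2 * n * h ^+ 2)).
    have : C * h * h ^+ 2 = v * K * h ^+ 3 + k * outy * h ^+ 3 + k * K * h ^+ 3
      + c * k * h ^+ 3 + c * n * h ^+ 3 + h ^+ 3 by rewrite /C; ring.
    lra.
  have : C * h * h ^+ 2 <= e * v / 4 * h ^+ 2 by rewrite ler_wpM2r.
  have : e * h * (h * v / 2) <= e * h * c2 by rewrite ler_wpM2l// mulr_ge0// ltW.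
  have -> : e * h * (h * v / 2) = e * v / 2 * h ^+ 2 by field.
  have -> : 2 * n * h ^+ 2 = e * v / 4 * h ^+ 2 by rewrite /n; field.
  lra.
apply: le_trans T.
set a1 := h / 2 * v * eb; set a2 := h ^+ 3 / 16 * (kappa * outy).
have N1 := ler_normB a1 a2; set S1 := a1 - a2 in N1 *.
have N2 := ler_normD S1 (h ^+ 2 / 8 * (kappa * eb)); set S2 := S1 + _ in N2 *.
have N3 := ler_normD S2 (ea * yy); set S3 := S2 + _ in N3 *.
have N4 := ler_normD S3 (h ^+ 3 / 16 * (chi * kappa)); set S4 := S3 + _ in N4 *.
have N5 := ler_normD S4 (h / 8 * (chi * ec)); set S5 := S4 + _ in N5 *.
have N6 := ler_normB S5 (ec / 2).
lra.
Qed.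

End one_jump.

(** * Jump times, null events and mixtures of bridges *)

Section jump_times.
Context {R : realType} {X : pointedType} {A : rel X}.
Implicit Types (w : Omega R A) (r s t : R) (k n : nat).

Lemma jumps_in_sorted s t w : sorted <%R (jumps_in s t w).
Proof. by apply: sorted_filter; [exact: lt_trans|exact: jumps_sorted]. Qed.

Lemma mem_jumps_in r s t w :
  (r \in jumps_in s t w) = (s < r <= t) && (r \in jumps w).
Proof. by rewrite mem_filter. Qed.

Lemma ereal_inf_min (S : set R) (x : R) : S x -> (forall y, S y -> x <= y) ->
  ereal_inf [set s%:E | s in S] = x%:E.
Proof.
move=> Sx xS; apply/eqP; rewrite eq_le; apply/andP; split.
  by apply: ereal_inf_lbound; exists x.
by apply: le_ereal_inf_tmp => _ [y Sy <-]; rewrite lee_fin xS.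
Qed.

(** The infimum that defines the next jump time is a minimum over the list of the later
jumps. *)
Lemma jump_timeE t k w : 0 <= t ->
  jump_time t k.+1 w = if (k < size (jumps_in t 1 w))%N
    then (nth 0 (jumps_in t 1 w) k)%:E else +oo%E.
Proof.
move=> t0; set l := jumps_in t 1 w.
have lS : sorted <%R l by exact: jumps_in_sorted.
have jP s : t < s -> (s <= 1 /\ left_lim (sval w) s <> sval w s) <-> s \in l.
  move=> ts; rewrite mem_jumps_in ts /=; split=> [[s1 js]|/andP[-> /mem_jumps[]//]].
  by rewrite s1; apply/mem_jumps; split=> //; rewrite s1 andbT ltW// (le_lt_trans t0).
have lt_l s : s \in l -> t < s by rewrite mem_jumps_in => /andP[/andP[]].
have nth_lt i i' : (i < size l)%N -> (i' < size l)%N -> (nth 0 l i < nth 0 l i') = (i < i')%N.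
  by move=> il i'l; rewrite lt_sorted_ltn_nth.
elim: k => [|k IH].
  rewrite /=; case: ifPn => l0.
    apply: ereal_inf_min => [|y [+ ys]].
      have l0l : nth 0 l 0 \in l by rewrite mem_nth.
      by split; [rewrite lte_fin lt_l|apply/jP => //; exact: lt_l].
    rewrite lte_fin => ty; have /(nthP 0)[i il <-] : y \in l by apply/jP.
    by rewrite leNgt nth_lt.
  rewrite (_ : [set s | _] = set0) ?image_set0 ?ereal_inf0//.
  apply/seteqP; split=> // s [+ js]; rewrite lte_fin => ts.
  have : s \in l by apply/jP.
  by move: l0; rewrite -leqNgt leqn0 => /nilP ->.
rewrite [LHS]/= -/(jump_time t k.+1 w) IH.
have tl i : (i < size l)%N -> t < nth 0 l i by move=> il; rewrite lt_l// mem_nth.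
case: ifPn => [kl|kl]; last first.
  rewrite (_ : [set s | _] = set0) ?image_set0 ?ereal_inf0//.
    by rewrite ifF//; apply: contraNF kl => /ltnW.
  by apply/seteqP; split=> // s []; rewrite ltNge leey.
case: ifPn => Skl.
  apply: ereal_inf_min => [|y [+ ys]].
    split; first by rewrite lte_fin nth_lt.
    by apply/jP; [exact: tl|rewrite mem_nth].
  rewrite lte_fin => ky.
  have /(nthP 0)[i il yE] : y \in l by apply/jP => //; exact: lt_trans (tl _ kl) ky.
  by rewrite -yE leNgt nth_lt// -leqNgt; rewrite -yE nth_lt// in ky.
rewrite (_ : [set s | _] = set0) ?image_set0 ?ereal_inf0//.
apply/seteqP; split=> // s [+ js]; rewrite lte_fin => ks.
have /(nthP 0)[i il sE] : s \in l by apply/jP => //; exact: lt_trans (tl _ kl) ks.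
rewrite -sE nth_lt// in ks.
by rewrite (leq_ltn_trans ks il) in Skl.
Qed.

Lemma jump_time_le t s k w : 0 <= t -> t <= s -> s <= 1 ->
  (jump_time t k.+1 w <= s%:E)%E = (k < size (itin t s w))%N.
Proof.
move=> t0 ts s1; rewrite jump_timeE// size_map.
rewrite (jumps_in_cat w ts s1) size_cat nth_cat.
case: (ltnP k (size (jumps_in t s w))) => kl.
  rewrite ltn_addr// lee_fin.
  have := mem_nth 0 kl; rewrite mem_jumps_in => /andP[/andP[_ ->]]//.
case: ifPn => kl'; last by rewrite leNgt ltry.
rewrite lee_fin; apply/negbTE; rewrite -ltNge.
have kl2 : (k - size (jumps_in t s w) < size (jumps_in s 1 w))%N.
  by rewrite ltn_subLR.
by have := mem_nth 0 kl2; rewrite mem_jumps_in => /andP[/andP[->]].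
Qed.

Lemma jump_time_gt t s k w : 0 <= t -> t <= s -> s <= 1 ->
  (s%:E < jump_time t k.+1 w)%E = (size (itin t s w) <= k)%N.
Proof. by move=> t0 ts s1; rewrite ltNge jump_time_le// -leqNgt. Qed.

Lemma jump_time_nth t s k w : 0 <= t -> t <= s -> s <= 1 ->
  (k < size (itin t s w))%N -> jump_time t k.+1 w = (nth 0 (jumps_in t s w) k)%:E.
Proof.
move=> t0 ts s1; rewrite size_map => kl.
by rewrite jump_timeE// (jumps_in_cat w ts s1) size_cat nth_cat kl ltn_addr.
Qed.

Lemma visited_itin t s w : 0 <= t -> t <= s -> s <= 1 ->
  visited t (size (itin t s w)) w = canproc t w :: itin t s w.
Proof.
move=> t0 ts s1; apply: (@eq_from_nth _ (canproc t w)); first by rewrite size_mkseq.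
move=> [|k]; rewrite size_mkseq => kl; first by rewrite nth_mkseq.
rewrite nth_mkseq// (jump_time_nth t0 ts s1 kl) /=.
by rewrite (nth_map 0)// -(size_map (fun r => canproc r w)).
Qed.

Lemma jump_time_lt t s w k : 0 <= t -> t <= s -> s <= 1 ->
  size (itin t s w) = k.+1 -> s \notin jumps w ->
  (jump_time t k.+1 w < s%:E)%E.
Proof.
move=> t0 ts s1 sz js; have kl : (k < size (itin t s w))%N by rewrite sz.
rewrite (jump_time_nth t0 ts s1 kl) lte_fin lt_neqAle.
have : nth 0 (jumps_in t s w) k \in jumps_in t s w.
  by rewrite mem_nth// -(size_map (fun r => canproc r w)).
rewrite mem_jumps_in => /andP[/andP[_ ->]] kj; rewrite andbT.
by apply: contraNN js => /eqP <-.
Qed.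

Lemma jump_time_ge t s w k : 0 <= t -> t < s -> s <= 1 ->
  size (itin t s w) = k.+1 -> s \in jumps w -> (s%:E <= jump_time t k.+1 w)%E.
Proof.
move=> t0 ts s1 sz js; have kl : (k < size (itin t s w))%N by rewrite sz.
rewrite (jump_time_nth t0 (ltW ts) s1 kl) lee_fin.
have /(nthP 0)[i il iE] : s \in jumps_in t s w by rewrite mem_jumps_in ts lexx.
rewrite size_map in kl sz.
rewrite -{1}iE (lt_sorted_leq_nth 0 (jumps_in_sorted t s w))//.
by rewrite -ltnS -sz.
Qed.

End jump_times.

Section fixed_time.
Context {R : realType} {X : pointedType}.
Variables (A : rel X) (j : R -> X -> X -> R) (M : R).
Hypothesis adm : admissible A j M.

Definition jump_at (s : R) : set (Omega R A) := [set w | s \in jumps w].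

Let e (s : R) (n : nat) : R := s - s / n.+1%:R.

Let e_ge0 s n : 0 <= s -> 0 <= e s n.
Proof.
by move=> s0; rewrite /e subr_ge0 ler_pdivrMr// ler_peMr// ler1n.
Qed.

Let e_le s n : 0 <= s -> e s n <= s.
Proof. by move=> s0; rewrite /e gerBl divr_ge0. Qed.

(** A fixed time is a jump time when there are jumps in arbitrarily short intervals that
end there, the jumps being isolated. *)
Lemma jump_atE s : 0 < s -> s <= 1 ->
  jump_at s = \bigcap_n [set w | (1 <= size (itin (e s n) s w))%N].
Proof.
move=> s0 s1; apply/seteqP; split=> [w /= js n _ /=|w H /=].
  rewrite size_map; case E : (jumps_in _ _ _) => [|//].
  have : s \in jumps_in (e s n) s w.
    by rewrite mem_jumps_in js lexx !andbT /e ltrBlDr ltrDl divr_gt0.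
  by rewrite E.
apply: contrapT => js.
have [d d0 dP] := seq_gap (s :: jumps w).
(* The cell ]s - s / (n + 1), s] is shorter than the gap to the previous jump. *)
pose n := Num.truncn (s / d).
have := H n I; rewrite /= size_map.
case E : (jumps_in (e s n) s w) => [//|a l] _.
have : a \in jumps_in (e s n) s w by rewrite E in_cons eqxx.
rewrite mem_jumps_in => /andP[/andP[sa as_] aw].
have lt_as : a < s by rewrite lt_neqAle as_ andbT; apply: contra_notN js => /eqP <-.
have da : d <= s - a by apply: dP => //; rewrite !in_cons ?aw ?eqxx ?orbT.
have sd : s / n.+1%:R < d.
  by rewrite ltr_pdivrMr// mulrC -ltr_pdivrMr// truncnS_gt.
by move: sa; rewrite /e; move: (s / _) sd => q; lra.
Qed.

Lemma Ft_jump_at s : 0 < s -> s <= 1 -> Ft s (jump_at s).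
Proof.
move=> s0 s1; rewrite jump_atE//; apply: (@bigcap_measurable _
  (g_sigma_algebraType (@cylinders R X A s))); first by exists 0%N.
by move=> n _; apply: (Ft_jump_set adm) => //; [exact: e_ge0 (ltW s0)|exact: e_le (ltW s0)].
Qed.

Lemma pr_jump_at Q s : solves j Q -> 0 < s -> s <= 1 -> pr Q (jump_at s) = 0.
Proof.
move=> SQ s0 s1; apply/eqP; rewrite eq_le pr_ge0 andbT.
have M0 := M_ge0 adm.
apply/ler_addgt0Pr => d d0; rewrite add0r.
pose n := Num.truncn (M * s / d).
have h0 := @e_ge0 s n (ltW s0); have h1 := @e_le s n (ltW s0).
apply: (@le_trans _ _ (pr Q (setT `&` [set w | (1 <= size (itin (e s n) s w))%N]))).
  apply: pr_le.
  - exact: (Ft_measurable s1 (Ft_jump_at s0 s1)).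
  - exact: (Ft_measurable s1 (Ft_I (@Ft_T R X A s) (Ft_jump_set adm 1 h0 h1 s1))).
  by rewrite jump_atE// => w H; split=> //; exact: H.
apply: le_trans (itin_size_le adm 1 SQ h0 h1 s1 (@Ft_T R X A _)) _.
have p1 : pr Q setT <= 1 by apply: pr_le1.
have -> : s - e s n = s / n.+1%:R by rewrite /e; ring.
rewrite expr1; apply: (@le_trans _ _ (M * (s / n.+1%:R))).
  by rewrite ler_piMr// mulr_ge0// divr_ge0// ltW.
rewrite mulrA ler_pdivrMr// [d * _]mulrC -ler_pdivrMr//.
by rewrite ltW// truncnS_gt.
Qed.

End fixed_time.

Lemma esumZ {R : realType} {I : choiceType} (a : I -> \bar R) (c : R) :
  0 <= c -> (forall i, (0 <= a i)%E) ->
  (\esum_(i in [set: I]) (c%:E * a i) = c%:E * \esum_(i in [set: I]) a i)%E.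
Proof.
move=> + a0; rewrite le_eqVlt => /orP[/eqP <-|c0].
  by rewrite mul0e esum1// => i _; rewrite mul0e.
have le_aux (b : I -> \bar R) (k : R) : 0 < k -> (forall i, (0 <= b i)%E) ->
    (\esum_(i in [set: I]) (k%:E * b i) <= k%:E * \esum_(i in [set: I]) b i)%E.
  move=> k0 b0; apply: ge_ereal_sup => _ [D DI <-].
  rewrite -ge0_mule_fsumr// lee_pmul2l ?lte_fin//.
  by apply: esum_ge; exists D.
apply/eqP; rewrite eq_le le_aux//=.
have ca0 i : (0 <= c%:E * a i)%E by rewrite mule_ge0// lee_fin ltW.
have ci0 : 0 < c^-1 by rewrite invr_gt0.
have := le_aux _ _ ci0 ca0.
under eq_esum do rewrite muleA -EFinM mulVf ?lt0r_neq0// mul1e.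
by rewrite -(@lee_pmul2l _ c%:E)// ?lte_fin// muleA -EFinM divff ?lt0r_neq0// mul1e.
Qed.

Section reciprocal.
Context {R : realType} {X : pointedType}.
Variables (A : rel X) (j : R -> X -> X -> R) (M : R).
Hypothesis adm : admissible A j M.
Let X_countable := adm_countable adm.
Variable Rx : X -> probability (path_space R A) R.
Hypothesis Rx_walk : forall x, markov_walk j x (Rx x).
Variable p : probability (discrete (X * X)%type) R.
Variable P : probability (path_space R A) R.
Hypothesis P_mixture : forall E : set (path_space R A), measurable E ->
  P E = mixture p (bridge Rx) E.

Let ending y : set (Omega R A) := [set w | canproc 1 w = y].

Let mixture_ge0 (E : set (path_space R A)) i : (0 <= p [set i] * bridge Rx i E)%E.
Proof.
by rewrite mule_ge0// /bridge lee_fin /cond_prob divr_ge0// fine_ge0.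
Qed.

(** A linear relation that holds under every bridge holds under their mixture. *)
Lemma mixture_linear (E1 E2 : set (path_space R A)) (c1 c2 : R) :
  measurable E1 -> measurable E2 -> 0 <= c1 -> 0 <= c2 ->
  (forall x y, c2 * pr (Rx x) (E1 `&` ending y) = c1 * pr (Rx x) (E2 `&` ending y)) ->
  c2 * pr P E1 = c1 * pr P E2.
Proof.
move=> m1 m2 c10 c20 H; apply: EFin_inj.
rewrite !EFinM !EFin_pr// !P_mixture// /mixture -!esumZ//.
apply: eq_esum => -[x y] _; rewrite !muleA ![(_%:E * p _)%E]muleC -!muleA.
congr (_ * _)%E; rewrite /bridge /cond_prob -!EFinM !mulrA.
by congr ((_ / _)%:E); exact: H.
Qed.

(** The mixing measure charges a point, since there are countably many pairs of
vertices. *)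
Lemma mixture_gt0 (E : set (path_space R A)) : measurable E ->
  (forall x y, 0 < pr (Rx x) (E `&` ending y)) -> 0 < pr P E.
Proof.
move=> mE H.
have [[x y] pxy] : exists i, (0 < p [set i])%E.
  apply: contrapT => np.
  have I_countable : countable [set: (X * X)%type].
    have /countable_injP[g gi] := X_countable; apply/countable_injP.
    exists (fun xy => choice.pickle (g xy.1, g xy.2)) => -[x y] [x' y'] _ _.
    move=> /(pcan_inj choice.pickleK)[/gi + /gi].
    by rewrite !mem_setT => /(_ isT isT) -> /(_ isT isT) ->.
  have : 1 * pr p setT <= 0 * pr p setT.
    apply: (@pr_split_le _ _ (discrete (X * X)%type) _ I_countable id) => //.
      by move=> i; exact: sub_sigma_algebra.
    move=> i; rewrite setTI mul0r mul1r.
    have pi0 : (p [set i] <= 0)%E by rewrite leNgt; apply/negP => ?; apply: np; exists i.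
    by rewrite -lee_fin EFin_pr//; exact: sub_sigma_algebra.
  by rewrite mul0r mul1r /pr probability_setT ler10.
rewrite -lte_fin EFin_pr// P_mixture//.
apply: (@lt_le_trans _ _ (p [set (x, y)] * bridge Rx (x, y) E)%E).
  rewrite mule_gt0// /bridge lte_fin divr_gt0//; first exact: H.
  apply: lt_le_trans (H x y) _; apply: pr_le.
  - apply: measurableI => //.
    exact: (Ft_measurable (lexx 1) (Ft_at y ler01 (lexx 1))).
  - exact: (Ft_measurable (lexx 1) (Ft_at y ler01 (lexx 1))).
  exact: subIsetr.
apply: esum_ge; exists [set (x, y)]; last by rewrite fsbig_set1.
by split=> //; exact: finite_set1.
Qed.

End reciprocal.

(** * Walks of the reciprocal class *)

(** A numerator bounded by m and a denominator in [1 - u, 1]: dividing changes the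
numerator by at most 2 u m. *)
Lemma quotient_close {R : realType} (c1 c2 k m u d : R) :
  0 <= c1 <= m -> 1 - u <= c2 <= 1 -> 0 <= u <= 1 / 2 ->
  `|c1 - k| <= d -> 2 * u * m <= d -> `|c1 / c2 - k| <= 2 * d.
Proof.
move=> /andP[c10 c1m] /andP[c2u c21] /andP[u0 u2] c1k umd.
have c20 : 0 < c2 by clear -c2u u2; lra.
have w0 : 0 <= 1 - c2 <= u by clear -c2u c21; lra.
have /andP[w00 wu] := w0.
have H1 : c1 * (1 - c2) <= m * u by exact: ler_pM.
have m0 : 0 <= m by exact: le_trans c1m.
have mu0 : 0 <= m * u by exact: mulr_ge0.
have H2 : c1 * (1 - c2) / c2 <= 2 * (m * u).
  rewrite ler_pdivrMr//; apply: le_trans H1 _.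
  have : m * u * (1 / 2) <= m * u * c2 by rewrite ler_wpM2l//; clear -c2u u2; lra.
  by move: (m * u * c2) (m * u) => x y; lra.
have H3 : 0 <= c1 * (1 - c2) / c2 by rewrite divr_ge0 ?mulr_ge0// ltW.
have -> : c1 / c2 - k = (c1 - k) + c1 * (1 - c2) / c2 by field; rewrite lt0r_neq0.
apply: le_trans (ler_normD _ _) _; rewrite (ger0_norm H3).
by clear -c1k umd H2; lra.
Qed.

Lemma chi_cE {R : realType} {X : pointedType} (A : rel X) (j : R -> X -> X -> R)
    (t : R) (x0 : X) (q : seq X) : path A x0 q ->
  chi_c j t x0 q = intensity A j t x0 q.
Proof.
rewrite /chi_c => xq.
have H d z : path A z q -> \prod_(i < size q)
    j t (nth d (z :: q) i) (nth d (z :: q) i.+1) = intensity A j t z q.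
  elim: q z {xq} => [|y q IH] z; first by rewrite big_ord0.
  move=> /= /andP[Azy yq]; rewrite big_ord_recl /= /arc_rate Azy; congr (_ * _).
  exact: IH.
exact: H.
Qed.

Section reciprocal_walk.
Context {R : realType} {X : pointedType}.
Variables (A : rel X) (j : R -> X -> X -> R) (M : R).
Hypothesis adm : admissible A j M.
Variable Rx : X -> probability (path_space R A) R.
Hypothesis Rx_walk : forall x, markov_walk j x (Rx x).
Variable p : probability (discrete (X * X)%type) R.
Variable P : probability (path_space R A) R.
Hypothesis P_mixture : forall E : set (path_space R A), measurable E ->
  P E = mixture p (bridge Rx) E.
Hypothesis con : connected_graph A.
Implicit Types (t u h : R) (x y z : X) (q : seq X) (G : set (Omega R A)).

(** The past of t and the future of u contribute the same factors to both events, under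
every bridge. *)
Lemma pr_proportional t u z z' G1 G2 c1 c2 : 0 <= t -> t <= u -> u <= 1 ->
  0 <= c1 -> 0 <= c2 -> Ft u G1 -> Ft u G2 ->
  [set w | canproc t w = z] `&` G1 `<=` [set w | canproc u w = z'] ->
  [set w | canproc t w = z] `&` G2 `<=` [set w | canproc u w = z'] ->
  future_prob j t z G1 c1 -> future_prob j t z G2 c2 ->
  c2 * pr P ([set w | canproc t w = z] `&` G1) =
  c1 * pr P ([set w | canproc t w = z] `&` G2).
Proof.
move=> t0 tu u1 c10 c20 F1 F2 S1 S2 M1 M2.
have Fz := Ft_at (A := A) z t0 tu.
have m G : Ft u G -> measurable ([set w | canproc t w = z] `&` G : set (path_space R A)).
  by move=> FG; exact: (Ft_measurable u1 (Ft_I Fz FG)).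
apply: (mixture_linear P_mixture (m _ F1) (m _ F2) c10 c20) => x y.
have H := @future_prob_at _ _ _ _ _ adm _ Rx_walk u 1 z' y (le_trans t0 tu) u1 (lexx 1).
have H1 := future_prob_comp tu F1 S1 M1 H.
have H2 := future_prob_comp tu F2 S2 M2 H.
have Fzt := Ft_at (A := A) z t0 (lexx t).
rewrite -!setIA (H1 _ _ (Rx_solves Rx_walk x) Fzt (fun _ => id)).
rewrite (H2 _ _ (Rx_solves Rx_walk x) Fzt (fun _ => id)); ring.
Qed.

(** The graph being connected, the walk can reach z before t, and any endpoint after u. *)
Lemma pr_walk_gt0 t u z q : 0 < t -> t < u -> u < 1 -> path A z q ->
  0 < pr P ([set w | canproc t w = z] `&` [set w | itin t u w = q]).
Proof.
move=> t0 tu u1 zq.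
have [t0' tu' u1'] : [/\ 0 <= t, t <= u & u <= 1] by split; exact: ltW.
have t1' := le_trans tu' u1'; have u0 := le_trans t0' tu'.
have FE := Ft_I (Ft_at (A := A) z t0' tu') (Ft_itin_eq adm q t0' tu' u1').
apply: (mixture_gt0 adm P_mixture (Ft_measurable u1' FE)) => x y.
have SQ := Rx_solves Rx_walk x.
have F0 := Ft_at (A := A) x (lexx (0 : R)) (lexx (0 : R)).
have p0 : 0 < pr (Rx x) [set w | canproc 0 w = x] by rewrite (Rx_start Rx_walk).
have p1 := reach_gt0 adm z con SQ (lexx 0) t0 t1' F0 (fun _ => id) p0.
have F1 := Ft_I (Ft_mono t0' F0) (Ft_at z t0' (lexx t)).
have p2 := walk_gt0 adm SQ t0' tu u1' F1 (@subIsetr _ _ _) p1 zq.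
have F2 := Ft_I (Ft_mono tu' F1) (Ft_itin_eq adm q t0' tu' u1').
have S2 : [set w : Omega R A | canproc 0 w = x] `&` [set w | canproc t w = z]
    `&` [set w | itin t u w = q] `<=` [set w | canproc u w = last z q].
  by move=> w [[_ /= tz] E]; rewrite /= -(itin_last w t0' tu' u1') E tz.
have p3 := reach_gt0 adm y con SQ u0 u1 (lexx 1) F2 S2 p2.
apply: lt_le_trans p3 _; apply: pr_le.
- exact: (Ft_measurable (lexx 1) (Ft_I (Ft_mono u1' F2) (Ft_at y ler01 (lexx 1)))).
- exact: (Ft_measurable (lexx 1) (Ft_I (Ft_mono u1' FE) (Ft_at y ler01 (lexx 1)))).
by move=> w [[[_ tz] E] y1].
Qed.

Lemma pr_mixture_jump_at u : 0 < u -> u <= 1 -> pr P (jump_at u) = 0.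
Proof.
move=> u0 u1; have FJ := Ft_jump_at adm u0 u1.
have mJ := Ft_measurable u1 FJ.
have := @mixture_linear _ _ _ Rx p P P_mixture _ setT 0 1 mJ measurableT (lexx 0) ler01.
rewrite mul1r mul0r; apply => x y; rewrite mul1r mul0r.
apply/eqP; rewrite eq_le pr_ge0 andbT.
rewrite -(pr_jump_at adm (Rx_solves Rx_walk x) u0 u1); apply: pr_le => //.
apply: measurableI => //.
exact: (Ft_measurable (lexx 1) (Ft_at y ler01 (lexx 1))).
Qed.

Lemma one_jumpE t h z z' : 0 < t -> 0 < h -> t + h < 1 -> z != z' ->
  [set w : Omega R A | [/\ canproc t w = z, canproc (t + h) w = z' &
     ((t + h)%:E < jump_time t 2 w)%E]] =
  [set w | canproc t w = z] `&` [set w | itin t (t + h) w = [:: z']].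
Proof.
move=> t0 h0 th1 zz'.
have [t0' /ltW th th1'] := window (ltW t0) h0 th1.
apply/seteqP; split=> w.
  move=> [tz thz]; rewrite (jump_time_gt _ w t0' th th1') => sz; split=> //=.
  by rewrite (itin_size1 t0' th th1' sz) tz thz (negPf zz').
move=> [tz E]; split=> //; first by rewrite -(itin_last w t0' th th1') E.
by rewrite (jump_time_gt _ w t0' th th1') E.
Qed.

Lemma half_jumpE t h z z' : 0 < t -> 0 < h -> t + h < 1 -> z != z' ->
  [set w : Omega R A | (jump_time t 1 w <= (t + h / 2)%:E)%E] `&`
  [set w : Omega R A | [/\ canproc t w = z, canproc (t + h) w = z' &
     ((t + h)%:E < jump_time t 2 w)%E]] =
  [set w | canproc t w = z] `&` ([set w | itin t (t + h / 2) w = [:: z']] `&`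
     [set w | itin (t + h / 2) (t + h) w = [::]]).
Proof.
move=> t0 h0 th1 zz'; rewrite one_jumpE//.
have [t0' /ltW th th1'] := window (ltW t0) h0 th1.
have [h1 h2 h3 h4] := half_window (ltW t0) h0 th1.
rewrite setICA; congr (_ `&` _); apply/seteqP; split=> w.
  rewrite /setI /mkset (jump_time_le _ w t0' h1 h3) (itin_cat w h1 h2).
  by case: (itin t (t + h / 2) w) => [|y [|y' l]] [] //= _ [-> ->].
by rewrite /setI /mkset (jump_time_le _ w t0' h1 h3) (itin_cat w h1 h2) => -[-> ->].
Qed.

(** The strict inequality between the last jump time and t + h removes from the event
on the itinerary the paths that jump exactly at t + h. *)
Lemma closed_walkE t h z q : 0 < t -> 0 < h -> t + h < 1 -> q != [::] ->
  last z q = z ->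
  [set w : Omega R A | [/\ visited t (size q) w = z :: q,
     (jump_time t (size q) w < (t + h)%:E)%E &
     ((t + h)%:E < jump_time t (size q).+1 w)%E]] `&`
  [set w : Omega R A | canproc t w = z /\ canproc (t + h) w = z] =
  ([set w | canproc t w = z] `&` [set w | itin t (t + h) w = q]) `&`
    ~` jump_at (t + h).
Proof.
move=> t0 h0 th1 q0 qz.
have [t0' th th1'] := window (ltW t0) h0 th1.
have th' := ltW th.
have [k szq] : exists k, size q = k.+1 by case: (q) q0 => // y l _; exists (size l).
apply/seteqP; split=> w.
  rewrite /setI /mkset (jump_time_gt _ w t0' th' th1') => -[[vis + sz] [tz _]].
  rewrite {1}szq => lt_th.
  have sz' : size (itin t (t + h) w) = size q.
    apply/eqP; rewrite eqn_leq sz szq -(jump_time_le _ w t0' th' th1').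
    exact: ltW.
  have := visited_itin w t0' th' th1'; rewrite sz' vis => -[_ Eq].
  split=> // js; have := jump_time_ge t0' th th1' _ js.
  by rewrite sz' szq => /(_ _ erefl); rewrite leNgt lt_th.
move=> [[tz E] js].
have zth : canproc (t + h) w = z by rewrite -(itin_last w t0' th' th1') E tz.
have := visited_itin w t0' th' th1'; rewrite E tz => vis.
split=> //; split=> //.
  rewrite szq; apply: (jump_time_lt t0' th' th1'); first by rewrite E.
  exact/negP.
by rewrite (jump_time_gt _ w t0' th' th1') E.
Qed.

Lemma half_time_expansion t z z' : 0 < t < 1 -> A z z' ->
  (fun h : R => cond_prob P
     [set w | (jump_time t 1 w <= (t + h / 2)%:E)%E]
     [set w | [/\ canproc t w = z, canproc (t + h) w = z' &
                  ((t + h)%:E < jump_time t 2 w)%E]])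
  = (fun h : R => 1 / 2 - h / 8 * chi_a A j t z z')
    +o_ (0^'+) (fun h : R => h).
Proof.
move=> /andP[t0 t1] Azz'; apply/eqaddoP => e e0.
have t01 : 0 <= t < 1 by rewrite ltW.
have t01' : 0 <= t <= 1 by rewrite !ltW.
have zz' : z != z' by apply: contraTneq Azz' => ->; exact: (adm_loopless adm).
have [df _ dfP] := adm_C1 adm Azz'.
have arcE s : arc_rate A j s z z' = j s z z' by rewrite /arc_rate Azz'.
have v_diff d : 0 < d -> exists2 k : R, 0 < k & forall s, 0 <= s <= 1 ->
    `|s - t| < k ->
    `|arc_rate A j s z z' - arc_rate A j t z z' - df t * (s - t)| <= d * `|s - t|.
  move=> d0; have [k k0 kP] := C1_diff_quotient t01' (dfP _ t01') d0.
  by exists k => // s s01 sk; rewrite !arcE; exact: kP.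
have v0 : 0 < arc_rate A j t z z' by rewrite arcE (adm_gt0 adm).
have chiE : chi_a A j t z z' =
    df t / arc_rate A j t z z' + jbar A j t z' - jbar A j t z.
  rewrite /chi_a arcE; congr (_ + _ - _); rewrite derive1E.
  have Dj : is_derive t 1 (fun s => j s z z') (df t).
    by apply: C1_is_derive; [rewrite t0|exact: dfP].
  have jt0 : 0 < j t z z' by rewrite (adm_gt0 adm).
  have Dl := is_derive1_ln jt0.
  have [_ ->] := is_derive1_comp (f := @ln R) (g := fun s => j s z z') (x := t).
  by rewrite mulrC.
have [d d0 dP] := half_ratio adm Rx_walk t01 v_diff v0 e0.
near=> h.
have h0 : 0 < h by near: h; exact: nbhs_right_gt.
have hd : h < d by near: h; exact: nbhs_right_lt.
have th1 : t + h < 1.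
  by rewrite addrC -ltrBrDr; near: h; apply: nbhs_right_lt; rewrite subr_gt0.
have [t0' th th1'] := window (ltW t0) h0 th1.
have th' := ltW th.
have [h1 h2 h3 h4] := half_window (ltW t0) h0 th1.
have := dP h h0 hd.
set c1 := _ * trans Rx t (t + h / 2) z [:: z'].
set c2 := trans Rx t (t + h) z [:: z'] => c12.
have c20 : 0 < c2 by apply: (trans_gt0 adm Rx_walk) => //=; rewrite Azz'.
have M1 : future_prob j t z ([set w : Omega R A | itin t (t + h / 2) w = [:: z']] `&`
    [set w | itin (t + h / 2) (t + h) w = [::]]) c1.
  exact: (future_prob_comp_itin adm t0' h1 h3
    (@future_prob_itin _ _ _ _ _ adm _ Rx_walk t _ z [:: z'] t0' h1 h3)
    (@future_prob_itin _ _ _ _ _ adm _ Rx_walk _ _ z' [::] h4 h2 th1')).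
have M2 : future_prob j t z [set w : Omega R A | itin t (t + h) w = [:: z']] c2.
  exact: (@future_prob_itin _ _ _ _ _ adm _ Rx_walk t _ z [:: z'] t0' th' th1').
have F1 : Ft (t + h) ([set w : Omega R A | itin t (t + h / 2) w = [:: z']] `&`
    [set w | itin (t + h / 2) (t + h) w = [::]]).
  apply: Ft_I; last exact: (Ft_itin_eq adm).
  exact: (Ft_mono h2 (Ft_itin_eq adm _ t0' h1 h3)).
have F2 : Ft (t + h) [set w : Omega R A | itin t (t + h) w = [:: z']].
  exact: (Ft_itin_eq adm).
have S2 : [set w : Omega R A | canproc t w = z] `&`
    [set w | itin t (t + h) w = [:: z']] `<=` [set w | canproc (t + h) w = z'].
  by move=> w [_ /= E]; rewrite /= -(itin_last w t0' th' th1') E.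
have S1 : [set w : Omega R A | canproc t w = z] `&`
    ([set w | itin t (t + h / 2) w = [:: z']] `&`
     [set w | itin (t + h / 2) (t + h) w = [::]]) `<=` [set w | canproc (t + h) w = z'].
  move=> w [tz [/= E1 E2]]; apply: S2; split=> //=.
  by rewrite (itin_cat w h1 h2) E1 E2.
have c10 : 0 <= c1 by rewrite mulr_ge0 ?trans_ge0.
have := pr_proportional t0' th' th1' c10 (ltW c20) F1 F2 S1 S2 M1 M2.
have := pr_walk_gt0 t0 th th1 (q := [:: z']) (z := z).
rewrite /= Azz' => /(_ isT).
rewrite -[X in `|X|]/(cond_prob _ _ _ - (1 / 2 - h / 8 * _)) chiE.
rewrite /cond_prob (half_jumpE t0 h0 th1 zz') (one_jumpE t0 h0 th1 zz').
rewrite -/(pr P _) -/(pr P ([set w | canproc t w = z] `&` [set w | itin _ _ w = _])).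
set P1 := pr P _; set P2 := pr P _ => P20 PE.
have -> : P1 / P2 = c1 / c2.
  by apply/eqP; rewrite eqr_div ?lt0r_neq0// mulrC PE.
rewrite (gtr0_norm h0) -(ler_pM2r c20) -[X in _ * X <= _](gtr0_norm c20) -normrM.
by rewrite mulrBl divfK// lt0r_neq0.
Unshelve. all: by end_near. Qed.

Lemma closed_walk_expansion t x0 q : 0 < t < 1 -> closed_walk A x0 q ->
  (fun h : R => cond_prob P
     [set w | [/\ visited t (size q) w = x0 :: q,
                  (jump_time t (size q) w < (t + h)%:E)%E &
                  ((t + h)%:E < jump_time t (size q).+1 w)%E]]
     [set w | canproc t w = x0 /\ canproc (t + h) w = x0])
  = (fun h : R => chi_c j t x0 q * (h ^+ size q / (size q)`!%:R))
    +o_ (0^'+) (fun h : R => h ^+ size q).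
Proof.
move=> /andP[t0 t1] /andP[/andP[q0 xq] /eqP qx]; apply/eqaddoP => e e0.
have t01 : 0 <= t < 1 by rewrite ltW.
have M0 := M_ge0 adm.
have e20 : 0 < e / 2 by rewrite divr_gt0.
have [d d0 dP] := trans_asympt adm Rx_walk x0 q t01 e20.
pose C := M + 1; have C0 : 0 < C by rewrite ltr_wpDl.
(* 1 - C h bounds the denominator from below, and B h the effect of the denominator. *)
pose B := 2 * C * M ^+ size q + 1.
have Mn0 : 0 <= M ^+ size q by exact: exprn_ge0.
have B0 : 0 < B by rewrite ltr_wpDl// !mulr_ge0// ltW.
near=> h.
have h0 : 0 < h by near: h; exact: nbhs_right_gt.
have hd : h < d by near: h; exact: nbhs_right_lt.
have hC : h < 1 / 2 / C by near: h; apply: nbhs_right_lt; rewrite !divr_gt0.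
have hB : h < e / 2 / B by near: h; apply: nbhs_right_lt; rewrite !divr_gt0.
have th1 : t + h < 1.
  by rewrite addrC -ltrBrDr; near: h; apply: nbhs_right_lt; rewrite subr_gt0.
have [t0' th th1'] := window (ltW t0) h0 th1.
have th' := ltW th; have th0 := le_trans t0' th'.
have t01' : 0 <= t <= 1 by rewrite t0' ltW.
have := dP h (ltW h0) hd th1'.
have := trans_size adm Rx_walk x0 q t0' th' th1'.
rewrite [t + h - t]addrAC subrr add0r exprMn -(chi_cE j t xq).
set c1 := trans Rx t (t + h) x0 q => c1M c1E.
pose c2 := future_law Rx t x0 [set w : Omega R A | canproc (t + h) w = x0].
have M1 : future_prob j t x0 [set w : Omega R A | itin t (t + h) w = q] c1.
  exact: (@future_prob_itin _ _ _ _ _ adm _ Rx_walk t _ x0 q t0' th' th1').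
have M2 : future_prob j t x0 [set w : Omega R A | canproc (t + h) w = x0] c2.
  exact: (@future_prob_at _ _ _ _ _ adm _ Rx_walk t _ x0 x0 t0' th' th1').
have Fx := Ft_at (A := A) x0 t0' (lexx t).
have Fxh := Ft_at (A := A) x0 th0 (lexx (t + h)).
have Rx0 := Rx_at_gt0 adm Rx_walk x0 t01'.
have c2_le1 : c2 <= 1.
  rewrite ler_pdivrMr// mul1r; apply: pr_le.
  - exact: (Ft_measurable th1' (Ft_I (Ft_mono th' Fx) Fxh)).
  - exact: (Ft_measurable (ltW t1) Fx).
  exact: subIsetl.
have c2_ge : 1 - C * h <= c2.
  apply: (@le_trans _ _ (trans Rx t (t + h) x0 [::])).
    apply: le_trans (trans_nil_ge adm Rx_walk x0 t0' th' th1').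
    by rewrite [t + h - t]addrAC subrr add0r lerD2l lerN2 (ler_wpM2r (ltW h0))// lerDl.
  rewrite ler_pM2r ?invr_gt0//; apply: pr_le.
  - exact: (Ft_measurable th1' (Ft_I (Ft_mono th' Fx) (Ft_itin_eq adm _ t0' th' th1'))).
  - exact: (Ft_measurable th1' (Ft_I (Ft_mono th' Fx) Fxh)).
  by move=> w [/= tx E]; split=> //=; rewrite -(itin_nil t0' th' th1' E).
have Ch : C * h <= 1 / 2 by rewrite mulrC -ler_pdivlMr// ltW.
have c20 : 0 < c2.
  apply: lt_le_trans c2_ge; rewrite subr_gt0 (le_lt_trans Ch)//.
  by rewrite ltr_pdivrMr// mul1r ltr1n.
have F1 := Ft_itin_eq adm q t0' th' th1'.
have S1 : [set w : Omega R A | canproc t w = x0] `&` [set w | itin t (t + h) w = q]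
    `<=` [set w | canproc (t + h) w = x0].
  by move=> w [/= tx E]; rewrite /= -(itin_last w t0' th' th1') E tx.
have c10 : 0 <= c1 by exact: trans_ge0.
have := pr_proportional t0' th' th1' c10 (ltW c20)
  F1 Fxh S1 (@subIsetr _ _ _) M1 M2.
have := pr_walk_gt0 t0 th th1 xq.
rewrite -[X in `|X|]/(cond_prob _ _ _ - chi_c j t x0 q * _).
rewrite /cond_prob (closed_walkE t0 h0 th1 q0 qx).
rewrite -/(pr P _) -/(pr P ([set w | canproc t w = x0] `&` [set w | canproc (t + h) w = x0])).
set N := _ `&` [set w | itin t (t + h) w = q].
have FN := Ft_I (Ft_mono th' Fx) F1; rewrite -/N in FN.
have FJ := Ft_jump_at adm (lt_trans t0 th) th1'.
have -> : pr P (N `&` ~` jump_at (t + h)) = pr P N.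
  rewrite (prID P (Ft_measurable th1' FN) (Ft_measurable th1' FJ)).
  suff -> : pr P (N `&` jump_at (t + h)) = 0 by rewrite add0r.
  apply/eqP; rewrite eq_le pr_ge0 andbT.
  rewrite -(pr_mixture_jump_at (lt_trans t0 th) th1').
  apply: pr_le; [|exact: (Ft_measurable th1' FJ)|exact: subIsetr].
  exact: (Ft_measurable th1' (Ft_I FN FJ)).
set P1 := pr P N; set P2 := pr P _ => P10 PE.
have P20 : 0 < P2.
  rewrite lt_neqAle pr_ge0 andbT; apply/eqP => P20.
  by move: PE; rewrite -P20 mulr0 => /eqP; rewrite mulf_eq0 !gt_eqF.
have -> : P1 / P2 = c1 / c2.
  by apply/eqP; rewrite eqr_div ?lt0r_neq0// mulrC PE.
have hq0 : 0 <= h ^+ size q by rewrite exprn_ge0// ltW.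
rewrite (ger0_norm hq0).
have -> : e * h ^+ size q = 2 * (e / 2 * h ^+ size q) by field.
have c1_in : 0 <= c1 <= M ^+ size q * h ^+ size q by rewrite c10.
have c2_in : 1 - C * h <= c2 <= 1 by rewrite c2_ge.
have Ch_in : 0 <= C * h <= 1 / 2 by rewrite Ch mulr_ge0 ?ltW.
apply: (quotient_close c1_in c2_in Ch_in c1E).
have -> : 2 * (C * h) * (M ^+ size q * h ^+ size q) =
    2 * C * M ^+ size q * h * h ^+ size q by ring.
rewrite ler_wpM2r//; apply: (@le_trans _ _ (B * h)).
  by rewrite (ler_wpM2r (ltW h0))// lerDl.
by rewrite mulrC -ler_pdivlMr// ltW.
Unshelve. all: by end_near. Qed.

End reciprocal_walk.

Theorem theorem2p7 (R : realType) (X : pointedType) (A : rel X)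
    (j : R -> X -> X -> R)
    (R0 : probability (discrete X) R)
    (Rx : X -> probability (path_space R A) R)
    (P : probability (path_space R A) R)
    (X_countable : countable [set: X])
    (A_sym : forall x y : X, A x y -> A y x)
    (A_connected : connected_graph A)
    (A_bounded : bounded_degree A)
    (A_loopless : forall z : X, ~~ A z z)
    (jbar_bounded : exists M : R, forall (t : R) (z : X), 0 <= t <= 1 ->
       jbar A j t z <= M)
    (j_C1 : forall z z' : X, A z z' -> C1_01 (fun t => j t z z'))
    (j_gt0 : forall (t : R) (z z' : X), 0 <= t <= 1 -> A z z' -> 0 < j t z z')
    (R0_full : supp R0 = [set: X])
    (Rx_markov : forall x : X, markov_walk j x (Rx x))
    (P_reciprocal : reciprocal_class R0 Rx P) :
  (forall (t : R) (z z' : X), 0 < t < 1 -> A z z' ->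
     (fun h : R => cond_prob P
       [set w | (jump_time t 1 w <= (t + h / 2)%:E)%E]
       [set w | [/\ canproc t w = z, canproc (t + h) w = z' &
                    ((t + h)%:E < jump_time t 2 w)%E]])
     = (fun h : R => 1 / 2 - h / 8 * chi_a A j t z z')
       +o_ (0^'+) (fun h : R => h))
  /\
  (forall (t : R) (x0 : X) (p : seq X), 0 < t < 1 -> closed_walk A x0 p ->
     (fun h : R => cond_prob P
       [set w | [/\ visited t (size p) w = x0 :: p,
                    (jump_time t (size p) w < (t + h)%:E)%E &
                    ((t + h)%:E < jump_time t (size p).+1 w)%E]]
       [set w | canproc t w = x0 /\ canproc (t + h) w = x0])
     = (fun h : R => chi_c j t x0 p * (h ^+ size p / (size p)`!%:R))
       +o_ (0^'+) (fun h : R => h ^+ size p)).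
Proof.
have [M jbarM] := jbar_bounded.
have adm : admissible A j M by [].
have [p _ P_mixture] := P_reciprocal.
split=> [t z z'|t x0 q].
  exact: (half_time_expansion adm Rx_markov P_mixture A_connected).
exact: (closed_walk_expansion adm Rx_markov P_mixture A_connected).
Qed.
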